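(* Suppose $\mathcal{L}:\mathcal{H}^2\to L^2$ is Gateaux differentiable. Then there exists $K>0$ such that, for all $t\ge0$, $$\int_0^t\|\mathcal{B}\mathcal{L}Q_s\|^2_{L^2}\,ds\le K.$$ In particular, there exists a set $A\subset[0,\infty)$ with $\mathrm{Leb}(A)<\infty$ such that, for all sequences $t_k\to\infty$ which do not take values in $A$, $\|\mathcal{B}\mathcal{L}Q_{t_k}\|_{L^2}\to0$.
   Context: **Domain and spaces.** $\Omega\subset\mathbb{R}^n$ is a bounded open set whose boundary is $C^{3,\kappa}$ for some $\kappa\in(0,1)$. $\mu$ is a measure on $\Omega$ with a continuous density with respect to Lebesgue measure, bounded away from $0$ and $\infty$. All $L^2$ norms and inner products and all Sobolev spaces on $\Omega$ are taken with respect to $\mu$: $\mathcal{H}^p=\{g\in L^2(\Omega,\mu):\|g\|_{\mathcal{H}^p}=\sum_{|\alpha|\le p}\|D^\alpha g\|_{L^2}<\infty\}$ (weak derivatives). $\mathcal{H}^2_{(0)}=\mathcal{H}^2\cap\mathcal{H}^1_0$ is the subspace of functions in $\mathcal{H}^2$ with zero boundary trace. $C^k_b$ denotes functions with bounded continuous derivatives up to order $k$ (order $0$ included). $\mathrm{Leb}$ is Lebesgue measure. The auxiliary function $\eta\in C^3_b(\mathbb{R}^n)$ satisfies $0<\eta<1$ in $\Omega$, $\eta=0$ on $\partial\Omega$, and $\langle\nabla\eta(x),\mathbf{n}_x\rangle\ne0$ for $x\in\partial\Omega$, with $\mathbf{n}_x$ the outward unit normal. **PDE.** $f$ is identified with a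 given extension $f\in\mathcal{H}^2$ whose boundary trace is the boundary datum. $\mathcal{L}$ is a (nonlinear) second-order differential operator for which there is a constant $C$ with, for all $f_1,f_2\in\mathcal{H}^2\cap C^2$ and $x\in\Omega$, $$|\mathcal{L}f_1(x)-\mathcal{L}f_2(x)|\le C\Big[|f_1(x)-f_2(x)|+\sum_{i=1}^n|\partial_{x_i}f_1(x)-\partial_{x_i}f_2(x)|+\tfrac12\sum_{i,j=1}^n|\partial^2_{x_ix_j}f_1(x)-\partial^2_{x_ix_j}f_2(x)|\Big],$$ and $\mathcal{L}0\in L^2$; thus $\mathcal{L}$ is a Lipschitz operator $\mathcal{H}^2\to L^2$. $\mathcal{L}$ is strongly $L^2$-monotone: there is $\gamma>0$ such that $\langle f_1-f_2,\mathcal{L}f_1-\mathcal{L}f_2\rangle_{L^2}\le-\gamma\|f_1-f_2\|^2_{L^2}$ for all $f_1,f_2\in\mathcal{H}^2_{(0)}$. The PDE $\mathcal{L}u=0$ in $\Omega$, $u=f$ on $\partial\Omega$ (trace sense) has a (unique) solution $u\in\mathcal{H}^2$. **Gateaux derivative.** For directions $h\in\mathcal{H}^2$, $\partial\mathcal{L}(w;h)=\lim_{\epsilon\to0}\epsilon^{-1}(\mathcal{L}(w+\epsilon h)-\mathcal{L}(w))$, the limit being taken in $L^2$. **Kernel.** $\sigma\in C^4_b(\mathbb{R})$ is non-constant. $c,b$ (real) and $w$ ($\mathbb{R}^n$-valued) are independent random variables with $|c|<K_0$, $\mathbb{E}[c]=0$; the law of $(w,b)$ charges every nonempty open subset of $\mathbb{R}^{n+1}$;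 $\mathbb{E}[|w_k|^3]<\infty$ for every $k$, $\mathbb{E}[|b|]<\infty$. Set $$A(x,y)=\mathbb{E}_{c,w,b}\big[\sigma(w\cdot x+b)\sigma(w\cdot y+b)+c^2\sigma'(w\cdot x+b)\sigma'(w\cdot y+b)(x\cdot y+1)\big]$$ (the kernel $A(x,y)$ is unrelated to the set $A$ in the claim), $B(x,y)=\eta(x)\eta(y)A(x,y)$, and $(\mathcal{B}v)(y)=\int_\Omega B(x,y)v(x)\,d\mu(x)$. **Wide network limit.** With $\alpha>0$ constant, $Q_t$ is the $\mathcal{H}^2$-valued solution of $\frac{dQ_t}{dt}=\alpha\mathcal{B}\mathcal{L}(Q_t)$, $Q_0=f$. *)

(* Defs.v *)
From HB Require Import structures.
From mathcomp Require Import all_boot all_order all_algebra.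
From mathcomp Require Import all_classical all_reals all_analysis.

Set Implicit Arguments.
Unset Strict Implicit.
Unset Printing Implicit Defensive.

Import Order.TTheory GRing.Theory Num.Theory.
Import numFieldNormedType.Exports.
Local Open Scope classical_set_scope.
Local Open Scope ring_scope.

(* The product sigma-algebra on 'rV[R]_n, generated by the coordinates; it is
   also the Borel sigma-algebra. *)
Section rV_measurable.
Context (R : realType) (n : nat).

Definition rV_coord (i : 'I_n) (x : 'rV[R]_n) : R := x 0 i.

Definition rV_sigma_algebra : set (set 'rV[R]_n) := g_sigma_preimage rV_coord.

Definition rV_display : measure_display.
Proof. exact: (measure_tuple_display default_measure_display). Qed.

Let rV_set0 : rV_sigma_algebra set0.
Proof. exact: sigma_algebra0. Qed.

Let rV_setC A : rV_sigma_algebra A -> rV_sigma_algebra (~` A).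
Proof. exact: sigma_algebraC. Qed.

Let rV_bigcup (F : _^nat) : (forall i, rV_sigma_algebra (F i)) ->
  rV_sigma_algebra (\bigcup_i (F i)).
Proof. exact: sigma_algebra_bigcup. Qed.

HB.instance Definition _ := @isMeasurable.Build rV_display
  'rV[R]_n rV_sigma_algebra rV_set0 rV_setC rV_bigcup.

End rV_measurable.

Lemma measurable_rV_coord (R : realType) (n : nat) (i : 'I_n) :
  measurable_fun [set: 'rV[R]_n] (fun x : 'rV[R]_n => x 0 i).
Proof.
move=> _ Y mY; rewrite setTI; apply: sub_sigma_algebra => /=.
rewrite -bigcup_seq/=; exists i => /=; first by rewrite mem_index_enum.
by exists Y => //; rewrite setTI.
Qed.

Lemma measurable_fun_rVP (R : realType) (n : nat) d (T : measurableType d)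
    (f : T -> 'rV[R]_n) :
  (forall i, measurable_fun [set: T] (fun t => f t 0 i)) ->
  measurable_fun [set: T] f.
Proof.
move=> mf _ A mA; rewrite setTI.
suff : @rV_sigma_algebra R n `<=` [set B | measurable (f @^-1` B)] by exact.
apply: smallest_sub => [|B].
  split => /=; first by rewrite preimage_set0.
    by move=> B mB; rewrite setTD preimage_setC; exact: measurableC.
  by move=> F mF; rewrite preimage_bigcup; exact: bigcup_measurable.
rewrite -bigcup_seq/= => -[i _ [C mC <-]].
by have := mf i measurableT _ mC; rewrite !setTI.
Qed.

Section rV_lebesgue.
Context (R : realType).

Definition rV_cons (n : nat) (p : R * 'rV[R]_n) : 'rV[R]_n.+1 :=
  \row_i oapp (p.2 0) p.1 (unlift ord0 i).

Definition rV_uncons (n : nat) (x : 'rV[R]_n.+1) : R * 'rV[R]_n :=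
  (x 0 ord0, \row_j x 0 (lift ord0 j)).

Lemma rV_consK n : cancel (@rV_cons n) (@rV_uncons n).
Proof.
case=> a v; rewrite /rV_uncons mxE unlift_none /=; congr pair.
by apply/rowP => j; rewrite !mxE liftK.
Qed.

Lemma measurable_rV_cons n : measurable_fun [set: R * 'rV[R]_n] (@rV_cons n).
Proof.
apply: measurable_fun_rVP => i.
under eq_fun do rewrite mxE.
case: (unliftP ord0 i) => [j|] _ /=; last exact: measurable_fst.
exact: (measurableT_comp (measurable_rV_coord j) measurable_snd).
Qed.

Lemma measurable_rV_uncons n :
  measurable_fun [set: 'rV[R]_n.+1] (@rV_uncons n).
Proof.
apply/measurable_fun_pairP; split; first exact: measurable_rV_coord.
apply: measurable_fun_rVP => i /=.
by under eq_fun do rewrite mxE; exact: measurable_rV_coord.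
Qed.

Section step.
Context (n : nat) (m : {sigma_finite_measure set 'rV[R]_n -> \bar R}).

Definition rV_step : set 'rV[R]_n.+1 -> \bar R :=
  pushforward (lebesgue_measure \x m)%E (@rV_cons n).

Let M : {measure set (measurableTypeR R * 'rV[R]_n) -> \bar R} :=
  (lebesgue_measure \x m)%E.

Let mc : measurable_fun [set: measurableTypeR R * 'rV[R]_n] (@rV_cons n).
Proof. exact: measurable_rV_cons. Qed.

Let rV_step0 : rV_step set0 = 0.
Proof. by rewrite /rV_step /pushforward preimage_set0 (measure0 M). Qed.

Let rV_step_ge0 A : (0 <= rV_step A)%E.
Proof. exact: (measure_ge0 M). Qed.

Let rV_step_sigma_additive : semi_sigma_additive rV_step.
Proof.
move=> F mF tF mUF; rewrite /rV_step /pushforward preimage_bigcup.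
have mFc k : measurable (@rV_cons n @^-1` F k).
  by rewrite -[X in measurable X]setTI; exact: mc.
have tFc : trivIset setT (fun k => @rV_cons n @^-1` F k).
  apply/trivIsetP => /= i j _ _ ij; rewrite -preimage_setI.
  by move/trivIsetP : tF => /(_ _ _ _ _ ij) ->//; rewrite preimage_set0.
apply: (@measure_semi_sigma_additive _ _ _ M) => //.
by apply: bigcup_measurable => k _; exact: mFc.
Qed.

HB.instance Definition _ := isMeasure.Build _ _ _ rV_step
  rV_step0 rV_step_ge0 rV_step_sigma_additive.

Let rV_step_sigma_finite : sigma_finite setT rV_step.
Proof.
have /sigma_finiteP[F [TF ndF Foo]] :=
  sigma_finiteT (@lebesgue_measure R : {sigma_finite_measure set _ -> \bar R}).
have /sigma_finiteP[G [TG ndG Goo]] := sigma_finiteT m.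
exists (fun k => @rV_uncons n @^-1` (F k `*` G k)).
  rewrite -preimage_bigcup -[LHS](preimage_setT (@rV_uncons n)); congr (_ @^-1` _).
  rewrite -setXTT TF TG predeqE => -[x y]; split.
    move=> [/= [i _ Fnx] [k _ Gky]]; exists (maxn i k) => //; split.
    - by move: x Fnx; exact/subsetPset/ndF/leq_maxl.
    - by move: y Gky; exact/subsetPset/ndG/leq_maxr.
  by move=> [i _ []/= ? ?]; split; exists i.
move=> k; have [mF Fk] := Foo k; have [mG Gk] := Goo k.
split.
  rewrite -[X in measurable X]setTI; apply: measurable_rV_uncons => //.
  exact: measurableX.
rewrite /rV_step /pushforward -comp_preimage.
rewrite (_ : _ \o _ = id); last by apply/funext => x /=; exact: rV_consK.
by rewrite preimage_id product_measure1E// lte_mul_pinfty// ge0_fin_numE.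
Qed.

HB.instance Definition _ := Measure_isSigmaFinite.Build _ _ _ rV_step
  rV_step_sigma_finite.

End step.

(* Lebesgue measure on R^n, by iterated products; see leb_box below. *)
Fixpoint leb (n : nat) : {sigma_finite_measure set 'rV[R]_n -> \bar R} :=
  match n with
  | 0 => dirac (0 : 'rV[R]_0)
  | n'.+1 => rV_step (leb n')
  end.

End rV_lebesgue.

Lemma leb_box (R : realType) (n : nat) (A : 'I_n -> set R) :
  (forall i, measurable (A i)) ->
  leb R n [set x | forall i, A i (x 0 i)] =
  (\prod_(i < n) lebesgue_measure (A i))%E.
Proof.
elim: n A => [|n IH] A mA.
  by rewrite big_ord0 /= diracE mem_set// => -[].
rewrite big_ord_recl -IH//=.
have mB : measurable [set x : 'rV[R]_n | forall i, A (lift ord0 i) (x 0 i)].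
  have -> : [set x : 'rV[R]_n | forall i, A (lift ord0 i) (x 0 i)] =
      \bigcap_(i in [set: 'I_n])
        (fun x : 'rV[R]_n => x 0 i) @^-1` A (lift ord0 i).
    by apply/seteqP; split => x /= h i; [move=> _; exact: h | exact: h].
  apply: fin_bigcap_measurable => //= i _.
  rewrite -[X in measurable X]setTI.
  exact: (measurable_rV_coord i measurableT (mA _)).
rewrite -product_measure1E//; last exact: mA.
rewrite /rV_step /pushforward; apply: congr1.
apply/seteqP; split => -[a v] /=.
  move=> h; split; first by have := h ord0; rewrite mxE unlift_none.
  by move=> i; have := h (lift ord0 i); rewrite mxE liftK.
by case=> /= ha hv i; rewrite mxE; case: (unliftP ord0 i) => [j ->|->] /=.
Qed.

Section calculus.
Context (R : realType) (n : nat).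
Implicit Types (f g : 'rV[R]_n -> R) (x y : 'rV[R]_n) (s : seq 'I_n).

Definition dotv x y : R := \sum_(i < n) x 0 i * y 0 i.

Definition enorm x : R := Num.sqrt (dotv x x).

Definition pderiv (i : 'I_n) f : 'rV[R]_n -> R :=
  fun x => 'D_(delta_mx 0 i) f x.

Definition pderivs s f : 'rV[R]_n -> R := foldr pderiv f s.

Definition grad f x : 'rV[R]_n := \row_i pderiv i f x.

(* U is meant to be open; s lists the directions of an iterated partial
   derivative, applied from the last one to the first. *)
Definition Ck (k : nat) (U : set 'rV[R]_n) f : Prop :=
  (forall s i x, (size s < k)%N -> U x ->
     derivable (pderivs s f) x (delta_mx 0 i)) /\
  (forall s x, (size s <= k)%N -> U x -> {for x, continuous (pderivs s f)}).

Definition Ckb (k : nat) f : Prop :=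
  Ck k setT f /\
  forall s, (size s <= k)%N -> exists M : R, forall x, `|pderivs s f x| <= M.

Definition test_fun (Omega : set 'rV[R]_n) f : Prop :=
  (forall k, Ck k setT f) /\
  exists K : set 'rV[R]_n,
    [/\ compact K, K `<=` Omega & forall x, ~ K x -> f x = 0].

End calculus.

Definition Ckb1 (R : realType) (k : nat) (h : R -> R) : Prop :=
  (forall j x, (j < k)%N -> derivable (derive1n j h) x 1) /\
  (forall j, (j <= k)%N ->
     continuous (derive1n j h) /\ exists M : R, forall x, `|derive1n j h x| <= M).

Section boundary.
Context (R : realType) (n : nat) (kappa : R) (Omega : set 'rV[R]_n).
Implicit Types (x y z : 'rV[R]_n) (g : 'rV[R]_n -> R).

Definition bdry : set 'rV[R]_n := closure Omega `\` interior Omega.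

(* Near x0 the set Omega is the region (-1)^b y_i < g(y), where g is C^{3,kappa}
   and depends only on the n-1 coordinates other than y_i. The balls and the
   Hoelder condition use the sup norm, which is equivalent to the Euclidean one. *)
Definition local_graph x0 (r : R) (i : 'I_n) (b : bool) g : Prop :=
  [/\ 0 < r, Ck 3 setT g,
      exists H : R, forall s y z, size s = 3%N ->
        ball x0 r y -> ball x0 r z ->
        `|pderivs s g y - pderivs s g z| <= H * `|y - z| `^ kappa,
      forall y (a : R), g (y + a *: delta_mx 0 i) = g y &
      forall y, ball x0 r y -> (Omega y <-> (-1) ^+ b * y 0 i < g y)].

Definition C3_boundary : Prop :=
  forall x0, bdry x0 -> exists r i b g, local_graph x0 r i b g.

(* The normalized gradient of (-1)^b y_i - g(y). *)
Definition outward_normal x0 (nu : 'rV[R]_n) : Prop :=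
  exists r i b g, local_graph x0 r i b g /\
    let N := (-1) ^+ b *: delta_mx 0 i - grad g x0 in
    nu = (enorm N)^-1 *: N.

(* mu, a measure on Omega, is seen as a measure on R^n carried by Omega. *)
Definition good_density (mu : {measure set 'rV[R]_n -> \bar R}) : Prop :=
  exists rho : 'rV[R]_n -> R,
    [/\ {within Omega, continuous rho},
        exists m M : R, 0 < m /\ forall x, Omega x -> m <= rho x <= M &
        forall E, measurable E ->
          mu E = (\int[leb R n]_(x in E `&` Omega) (rho x)%:E)%E].

End boundary.

(* Elements of L^2 and H^p are represented by real functions on R^n; only
   their values on Omega, up to mu-null sets, matter. *)
Section sobolev.
Context (R : realType) (n : nat) (Omega : set 'rV[R]_n).
Context (mu : {measure set 'rV[R]_n -> \bar R}).
Implicit Types (g h v : 'rV[R]_n -> R) (p : nat).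

Definition L2 g : Prop := g \in Lfun mu 2%:E.

Definition L2norm g : \bar R := ('N[mu]_2%:E[EFin \o g])%E.

Definition L2dot g h : R := \int[mu]_(x in Omega) (g x * h x).

Definition mabs (a : 'I_n -> nat) : nat := \sum_(i < n) a i.

Definition mderiv (a : 'I_n -> nat) g : 'rV[R]_n -> R :=
  pderivs (flatten [seq nseq (a i) i | i <- enum 'I_n]) g.

(* Integration by parts is with respect to Lebesgue measure; mu only enters
   the norms. *)
Definition weak_deriv (a : 'I_n -> nat) g v : Prop :=
  forall phi, test_fun Omega phi ->
    \int[leb R n]_(x in Omega) (g x * mderiv a phi x) =
    (-1) ^+ mabs a * \int[leb R n]_(x in Omega) (v x * phi x).

Definition Hp p g : Prop :=
  L2 g /\
  forall a : 'I_n -> nat, (mabs a <= p)%N -> exists v, L2 v /\ weak_deriv a g v.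

(* Unique up to null sets when it exists; otherwise the junk value 0, so that
   Hnorm p is only meaningful on Hp p. *)
Definition wD (a : 'I_n -> nat) g : 'rV[R]_n -> R :=
  xget (cst 0) [set v | L2 v /\ weak_deriv a g v].

Definition Hnorm p g : \bar R :=
  (\sum_(a : {ffun 'I_n -> 'I_p.+1} | (mabs (fun i => a i) <= p)%N)
    L2norm (wD (fun i => a i) g))%E.

(* Zero boundary trace, as the H^1-closure of the test functions. *)
Definition H10 g : Prop :=
  Hp 1 g /\
  forall eps : R, 0 < eps ->
    exists phi, test_fun Omega phi /\ (Hnorm 1 (g - phi)%R < eps%:E)%E.

Definition H20 g : Prop := Hp 2 g /\ H10 g.

(* Here Ck 2 Omega is C^2 on the open set Omega. The bound is required at every point for C^2 functions; on the rest of H^2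
   the operator is its Lipschitz extension. Lipschitz continuity makes L
   compatible with almost everywhere equality. *)
Definition lipschitz_operator (L : ('rV[R]_n -> R) -> ('rV[R]_n -> R)) : Prop :=
  [/\ exists C : R, forall f1 f2,
        Hp 2 f1 -> Ck 2 Omega f1 -> Hp 2 f2 -> Ck 2 Omega f2 ->
        forall x, Omega x ->
        `|L f1 x - L f2 x| <=
          C * (`|f1 x - f2 x|
               + \sum_(i < n) `|pderiv i f1 x - pderiv i f2 x|
               + 2^-1 * \sum_(i < n) \sum_(j < n)
                   `|pderivs [:: i; j] f1 x - pderivs [:: i; j] f2 x|),
      L2 (L 0),
      forall g, Hp 2 g -> L2 (L g) &
      exists C : R, forall f1 f2, Hp 2 f1 -> Hp 2 f2 ->
        (L2norm (L f1 - L f2)%R <= C%:E * Hnorm 2 (f1 - f2)%R)%E].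

Definition strongly_monotone (L : ('rV[R]_n -> R) -> ('rV[R]_n -> R)) : Prop :=
  exists2 gamma : R, 0 < gamma &
    forall f1 f2, H20 f1 -> H20 f2 ->
      ((L2dot (f1 - f2) (L f1 - L f2))%R%:E <=
        (- gamma)%:E * L2norm (f1 - f2)%R ^+ 2)%E.

Definition pde_solution (L : ('rV[R]_n -> R) -> ('rV[R]_n -> R))
    (f u : 'rV[R]_n -> R) : Prop :=
  [/\ Hp 2 u, L u = cst 0 %[ae mu] & H10 (u - f)].

Definition gateaux_differentiable
    (L : ('rV[R]_n -> R) -> ('rV[R]_n -> R)) : Prop :=
  forall g h, Hp 2 g -> Hp 2 h ->
    exists2 v, L2 v &
      L2norm (eps^-1 *: (L (g + eps *: h) - L g) - v) @[eps --> (0 : R)^']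
        --> 0%E.

(* t |-> Q t, t >= 0, is differentiable at t in H^2 with derivative v (on the
   right only if t = 0). *)
Definition H2_deriv (Q : R -> 'rV[R]_n -> R) (t : R) v : Prop :=
  Hp 2 v /\
  Hnorm 2 ((s - t)^-1 *: (Q s - Q t) - v)
    @[s --> within [set s : R | 0 <= s] t^'] --> 0%E.

Definition kernel_op (K : 'rV[R]_n -> 'rV[R]_n -> R) v : 'rV[R]_n -> R :=
  fun y => \int[mu]_(x in Omega) (K x y * v x).

Definition wide_limit (alpha : R) (B L : ('rV[R]_n -> R) -> ('rV[R]_n -> R))
    (f : 'rV[R]_n -> R) (Q : R -> 'rV[R]_n -> R) : Prop :=
  Q 0 = f %[ae mu] /\
  forall t, 0 <= t -> Hp 2 (Q t) /\ H2_deriv Q t (alpha *: B (L (Q t))).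

End sobolev.

Section network.
Context (R : realType) (n : nat) d (T : measurableType d) (P : probability T R).
Context (c : {RV P >-> R}) (w : {RV P >-> 'rV[R]_n}) (b : {RV P >-> R}).

Definition independent3 : Prop :=
  forall (C : set R) (W : set 'rV[R]_n) (B : set R),
    measurable C -> measurable W -> measurable B ->
    P (c @^-1` C `&` w @^-1` W `&` b @^-1` B) =
    (P (c @^-1` C) * P (w @^-1` W) * P (b @^-1` B))%E.

Definition full_support : Prop :=
  forall U : set ('rV[R]_n * R), open U -> U !=set0 ->
    (0 < P ((fun t => (w t, b t)) @^-1` U))%E.

Definition ntk (sigma : R -> R) (x y : 'rV[R]_n) : R :=
  fine 'E_P[(fun t =>
    sigma (dotv (w t) x + b t) * sigma (dotv (w t) y + b t)
    + c t ^+ 2 * derive1 sigma (dotv (w t) x + b t)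
        * derive1 sigma (dotv (w t) y + b t) * (dotv x y + 1))%R].

Definition ntk_eta (sigma : R -> R) (eta : 'rV[R]_n -> R) (x y : 'rV[R]_n) : R :=
  eta x * eta y * ntk sigma x y.

End network.

(* Main.v *)
Require Import Defs.
From HB Require Import structures.
From mathcomp Require Import all_boot all_order all_algebra.
From mathcomp Require Import all_classical all_reals all_analysis measurable_realfun.
From mathcomp Require Import ring lra.

Set Implicit Arguments.
Unset Strict Implicit.
Unset Printing Implicit Defensive.

Import Order.TTheory GRing.Theory Num.Theory.
Import numFieldNormedType.Exports.
Local Open Scope classical_set_scope.
Local Open Scope ring_scope.

(** The quantity that drives the bound is the energy
  [E t = <B (L (Q t)), L (Q t)>]. It is nonnegative, because the form of the
  kernel is an average of squares ([gram_form], [kernel_form]). Differentiating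
  along the flow [Q' = alpha B (L Q)] and using the symmetry of [B],

    [E' = 2 <B (L Q), dL (Q; alpha B (L Q))>],

  so everything reduces to the inequality
  [<h, dL (g; h)> <= - gamma |h|^2] for [h = B (L Q)] and [g = Q]. It gives
  [E' <= - 2 alpha gamma |B (L Q)|^2]; integrating, and using [E >= 0], bounds
  the time integral of [|B (L Q)|^2] by [E 0 / (2 alpha gamma)]
  ([energy_quotient], [dissipation], [flow_dissipation]).

  The difficulty is that [L] is only assumed to be monotone on functions with
  zero trace, whereas [Q t] has the trace of the boundary datum, and [L] is
  nonlinear, so that subtracting this datum is not possible. What saves the
  argument is that [L] is local on functions of class C^2, by its pointwise
  Lipschitz bound, and that the directions [h] in the range of [B] vanish
  linearly at the boundary, since [eta] does ([eta_strip], [kernel_strip]). For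
  such [h] and for every [g] in H^2, [monotone_near_direction] shows

    [<h, L (g + h) - L g> <= - gamma |h|^2].

  To prove it, replace [g] and [h] by functions [G] and [H] that are smooth
  inside the domain (the Meyers-Serrin theorem, [meyers_serrin]) and multiply
  these by a cutoff [chi] that is 1 at distance more than a multiple of [r] from
  the complement of the domain. The functions [chi (G + H)] and [chi G] are test
  functions, to which monotonicity applies, and their images under [L] differ
  from those of [G + H] and [G] only in a strip of width of order [r] along the
  boundary. There the k-th derivatives of [chi] cost a factor [r^-k], and
  [strip_error] bounds the resulting error by a multiple of [a (a + |H|)], where
  [|H|] is the H^2 norm and [a] is the L^2 norm of [H] over the strip divided by
  [r]. As [h] is at most a multiple of [r] in the strip, and the measure of the
  strip tends to 0, so does [a], and with it the error.

  Applied to [t h] and divided by [t^2], the inequality passes to the Gateaux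
  derivative ([gateaux_monotone]). By the Lipschitz continuity of [L] from H^2 to
  L^2, the Gateaux derivative in the direction [Q'] is also the derivative of
  [L (Q t)] in time ([flow_quotient]).

  For the second claim, [phi s = |B (L (Q s))|^2] is integrable over the
  half-line, so each of the sets where [phi > 1 / (m + 1)] has finite measure
  and a tail of measure at most [2^-(m + 1)]; the union of these tails is the
  exceptional set ([exceptional_set]).

  Since the Sobolev spaces are defined by duality with test functions, a good
  part of the text establishes classical facts about mollification and weak
  derivatives on bounded open sets. *)

(** * Square-integrable functions *)
Section integrable_real.
Context d (T : measurableType d) (R : realType) (mu : {measure set T -> \bar R}).
Context (D : set T) (mD : measurable D).
Implicit Types f g : T -> R.

Lemma integrable_realZ (k : R) f : mu.-integrable D (EFin \o f) ->
  mu.-integrable D (EFin \o (fun x => k * f x)).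
Proof.
move=> fi; rewrite (_ : EFin \o _ = (fun x => k%:E * (EFin \o f) x)%E).
  exact: integrableZl.
by apply/funext => x /=; rewrite EFinM.
Qed.

Lemma integrable_realD f g : mu.-integrable D (EFin \o f) -> mu.-integrable D (EFin \o g) ->
  mu.-integrable D (EFin \o (fun x => f x + g x)).
Proof.
move=> fi gi; rewrite (_ : EFin \o _ = ((EFin \o f) \+ (EFin \o g))%E).
  exact: integrableD.
by apply/funext => x /=; rewrite EFinD.
Qed.

Lemma integrable_realB f g : mu.-integrable D (EFin \o f) -> mu.-integrable D (EFin \o g) ->
  mu.-integrable D (EFin \o (fun x => f x - g x)).
Proof.
move=> fi gi; rewrite (_ : EFin \o _ = ((EFin \o f) \- (EFin \o g))%E).
  exact: integrableB.
by apply/funext => x /=; rewrite EFinB.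
Qed.

End integrable_real.

Section pointwise.
Context (T : Type) (R : realType).
Implicit Types (u v : T -> R).

Lemma faddE u v x : (u + v) x = u x + v x. Proof. by []. Qed.

Lemma fsubE u v x : (u - v) x = u x - v x. Proof. by []. Qed.

Lemma fscaleE (a : R) u x : (a *: u) x = a * u x. Proof. by []. Qed.

Lemma fmulE u v x : (u * v) x = u x * v x. Proof. by []. Qed.

End pointwise.

Section l2.
Context d (T : measurableType d) (R : realType) (mu : {measure set T -> \bar R}).
Implicit Types (u v f g : T -> R).

(** A name for membership in the real-valued L^2, whose norm is then a real number
  rather than an extended one. *)
Definition sqint u := u \in Lfun mu 2%:E.

Definition l2n u : R := Num.sqrt (\int[mu]_x (u x ^+ 2)).

Lemma sqint_measurable u : sqint u -> measurable_fun setT u.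
Proof. by rewrite /sqint inE => /andP[/[!inE]/=]. Qed.

Lemma sqint_integrable u : sqint u ->
  mu.-integrable setT (EFin \o (fun x => u x ^+ 2)).
Proof. exact: Lfun2_integrable_sqr. Qed.

Lemma Lnorm2E u :
  ('N[mu]_2%:E[EFin \o u])%E = ((\int[mu]_x (u x ^+ 2)%:E) `^ 2^-1)%E.
Proof.
rewrite unlock; congr (_ `^ _)%E.
by apply: eq_integral => x _ /=; rewrite powR_mulrn// real_normK// num_real.
Qed.

Lemma sqint_intro u : measurable_fun setT u ->
  (\int[mu]_x (u x ^+ 2)%:E < +oo)%E -> sqint u.
Proof.
move=> mu_ iu; rewrite /sqint inE; apply/andP; rewrite !inE/=; split=> //.
by rewrite /finite_norm Lnorm2E; apply: poweR_lty.
Qed.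

Lemma l2n_ge0 u : 0 <= l2n u. Proof. exact: sqrtr_ge0. Qed.
Hint Resolve l2n_ge0 : core.

Lemma l2n_sqr u : l2n u ^+ 2 = \int[mu]_x (u x ^+ 2).
Proof. by rewrite sqr_sqrtr// Rintegral_ge0// => x _; exact: sqr_ge0. Qed.

Lemma sqint_ge0_fin u : sqint u ->
  (\int[mu]_x (u x ^+ 2)%:E)%E = (l2n u ^+ 2)%:E.
Proof.
by move=> /sqint_integrable iu; rewrite l2n_sqr fineK//; exact: integrable_fin_num.
Qed.

Lemma Lnorm_l2n u : sqint u -> ('N[mu]_2%:E[EFin \o u])%E = (l2n u)%:E.
Proof.
move=> su; rewrite Lnorm2E sqint_ge0_fin// poweR_EFin; congr EFin.
rewrite -powR_mulrn// -powRrM mulfV ?powRr1//.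
Qed.

Lemma sqintM_integrable u v : sqint u -> sqint v ->
  mu.-integrable setT (EFin \o (fun x => u x * v x)).
Proof. by move=> su sv; apply/Lfun1_integrable; exact: Lfun2_mul_Lfun1. Qed.

Lemma sqintD u v : sqint u -> sqint v -> sqint (u + v).
Proof. by move=> su sv; apply: (@Lfun_addr_closed _ _ _ mu _ (lee1n 2)).2. Qed.

Lemma sqintZ (a : R) u : sqint u -> sqint (a *: u).
Proof.
move=> su; rewrite (_ : a *: u = a \o* u); last by apply/funext=> x /=; exact: mulrC.
by apply: Lfun_scale => //; rewrite ler1n.
Qed.

Lemma sqintN u : sqint u -> sqint (- u).
Proof. by move=> su; rewrite -scaleN1r; exact: sqintZ. Qed.

Lemma sqintB u v : sqint u -> sqint v -> sqint (u - v).
Proof. by move=> su sv; apply: sqintD => //; exact: sqintN. Qed.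

Lemma sqint0 : sqint 0.
Proof. exact: (@Lfun_addr_closed _ _ _ mu _ (lee1n 2)).1. Qed.

Lemma sqint_sum (I : Type) (r : seq I) (P : pred I) (F : I -> T -> R) :
  (forall i, P i -> sqint (F i)) -> sqint (\sum_(i <- r | P i) F i).
Proof.
move=> sF; elim/big_ind : _ => //; [exact: sqint0|exact: sqintD].
Qed.

(** Domination, which also transports square-integrability between functions
  that agree almost everywhere. *)
Lemma sqint_le u v : measurable_fun setT u -> sqint v ->
  {ae mu, forall x, `|u x| <= `|v x|} -> sqint u /\ l2n u <= l2n v.
Proof.
move=> mu_ sv uv.
have mv := sqint_measurable sv.
have sq (w : T -> R) : measurable_fun setT w ->
    measurable_fun setT (fun x => (w x ^+ 2)%:E).
  by move=> mw; apply/measurable_EFinP; exact: measurable_funX.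
have le2 : (\int[mu]_x (u x ^+ 2)%:E <= \int[mu]_x (v x ^+ 2)%:E)%E.
  apply: ae_ge0_le_integral => //.
  - by move=> x _; rewrite lee_fin sqr_ge0.
  - exact: sq.
  - by move=> x _; rewrite lee_fin sqr_ge0.
  - exact: sq.
  - by apply: filterS uv => x uv _; rewrite lee_fin -ler_sqrt ?sqr_ge0// !sqrtr_sqr.
have su : sqint u.
  apply: sqint_intro => //; apply: le_lt_trans le2 _.
  by rewrite sqint_ge0_fin// ltry.
split=> //; move: le2; rewrite !sqint_ge0_fin// lee_fin.
by rewrite ler_pXn2r// nnegrE.
Qed.

Lemma l2n_le_ae u v : sqint u -> sqint v ->
  {ae mu, forall x, `|u x| <= `|v x|} -> l2n u <= l2n v.
Proof. by move=> su sv /(sqint_le (sqint_measurable su) sv)[]. Qed.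

Lemma l2nZ (a : R) u : sqint u -> l2n (a *: u) = `|a| * l2n u.
Proof.
move=> su; apply/eqP; rewrite -(@eqrXn2 _ 2)// ?mulr_ge0// exprMn !l2n_sqr.
rewrite -RintegralZl//; last exact: sqint_integrable.
apply/eqP; apply: eq_Rintegral => x _ /=.
by rewrite exprMn real_normK// num_real.
Qed.

Lemma l2nN u : l2n (- u) = l2n u.
Proof. by rewrite /l2n; under eq_Rintegral do rewrite /= sqrrN. Qed.

Lemma l2nD u v : sqint u -> sqint v -> l2n (u + v) <= l2n u + l2n v.
Proof.
move=> su sv; rewrite -lee_fin EFinD -!Lnorm_l2n//; last exact: sqintD.
by apply: minkowski_EFin; rewrite ?ler1n//; exact: sqint_measurable.
Qed.

Lemma l2nB u v : sqint u -> sqint v -> l2n (u - v) <= l2n u + l2n v.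
Proof. by move=> su sv; rewrite -(l2nN v); apply: l2nD => //; exact: sqintN. Qed.

Lemma l2n_triB u v : sqint u -> sqint v -> `|l2n u - l2n v| <= l2n (u - v).
Proof.
move=> su sv; rewrite ler_norml lerBlDr lerNl opprB lerBlDr; apply/andP; split.
  have -> : v = (u - (u - v)) by rewrite subKr.
  rewrite [leRHS]addrC; apply: (le_trans (l2nB _ _)) => //; first exact: sqintB.
  by rewrite subKr.
by rewrite -{1}(subrK v u); apply: l2nD => //; exact: sqintB.
Qed.

Lemma l2n0 : l2n 0 = 0.
Proof. by have := l2nZ 0 sqint0; rewrite scale0r normr0 mul0r. Qed.

Lemma l2n_sum (I : Type) (r : seq I) (P : pred I) (F : I -> T -> R) :
  (forall i, P i -> sqint (F i)) ->
  l2n (\sum_(i <- r | P i) F i) <= \sum_(i <- r | P i) l2n (F i).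
Proof.
move=> sF; elim: r => [|i r IH]; first by rewrite !big_nil l2n0.
rewrite !big_cons; case: ifPn => // Pi.
by apply: (le_trans (l2nD _ _)); rewrite ?lerD2l//; [exact: sF|exact: sqint_sum].
Qed.

Lemma cauchy_schwarz u v : sqint u -> sqint v ->
  \int[mu]_x (`|u x * v x|) <= l2n u * l2n v.
Proof.
move=> su sv.
have mu_ := sqint_measurable su; have mv := sqint_measurable sv.
have := @hoelder _ _ _ mu u v 2 2 mu_ mv.
move=> /(_ ltac:(by []) ltac:(by [])).
rewrite !Lnorm_l2n// Lnorm1 => H.
have {}H : (\int[mu]_x `|(u x * v x)%:E| <= (l2n u * l2n v)%:E)%E.
  by apply: H; rewrite [RHS]splitr !div1r.
rewrite -lee_fin fineK//; apply: integrable_fin_num => //.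
apply: integrable_norm => //; exact: sqintM_integrable.
Qed.

Lemma cauchy_schwarz_int u v : sqint u -> sqint v ->
  `|\int[mu]_x (u x * v x)| <= l2n u * l2n v.
Proof.
move=> su sv; apply: le_trans (cauchy_schwarz su sv).
apply: le_normr_Rintegral => //; exact: sqintM_integrable.
Qed.

Lemma l2n_sqrB u v : sqint u -> sqint v ->
  l2n (u - v) ^+ 2 = l2n u ^+ 2 + l2n v ^+ 2 - 2 * \int[mu]_x (u x * v x).
Proof.
move=> su sv; rewrite !l2n_sqr.
have iuv := sqintM_integrable su sv.
rewrite -RintegralD//; [|exact: sqint_integrable..].
rewrite -RintegralZl// -RintegralB//; last exact: integrable_realZ.
  by apply: eq_Rintegral => x _; rewrite fsubE; move: (u x) (v x) => a b; ring.
by apply: integrable_realD => //; exact: sqint_integrable.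
Qed.

Lemma sqintM_bounded (M : R) f u : measurable_fun setT f ->
  (forall x, `|f x| <= M) -> sqint u ->
  sqint (fun x => f x * u x) /\ l2n (fun x => f x * u x) <= M * l2n u.
Proof.
move=> mf fM su.
have M0 : 0 <= `|M| by [].
have [] := @sqint_le (fun x => f x * u x) (M *: u).
- by apply: measurable_funM => //; exact: sqint_measurable.
- exact: sqintZ.
- apply: nearW => x; rewrite normrM normrM ler_wpM2r//.
  exact: le_trans (fM x) (ler_norm _).
move=> sfu; rewrite l2nZ// => le; split=> //; apply: le_trans le _.
have [[x _]|T0] := pselect (exists x : T, True).
  by rewrite ger0_norm// (le_trans _ (fM x)).
have u0 : u = 0 by apply/funext => x; case: T0; exists x.
by rewrite u0 l2n0 !mulr0.
Qed.

End l2.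
#[global] Hint Extern 0 (is_true (0 <= l2n _ _)) => apply: l2n_ge0 : core.

(** * Lebesgue measure on R^n *)
Section leb_theory.
Context (R : realType) (n : nat).
Implicit Types (x y z : 'rV[R]_n) (U : set 'rV[R]_n) (f : 'rV[R]_n -> R).

(** The norm of matrices is the sup norm, so that balls are cubes. *)
Lemma ball_rVP x (r : R) y :
  0 < r -> ball x r y <-> forall i, `|x 0 i - y 0 i| < r.
Proof.
move=> r0; split=> [[_ xy] i|xy]; first exact: xy.
by split=> // i j; rewrite ord1; exact: xy.
Qed.

Lemma normr_coord x i : `|x 0 i| <= `|x|.
Proof.
rewrite [leRHS]/Num.norm/= mx_normrE.
exact: (@le_bigmax _ _ _ 0 (fun ij => `|x ij.1 ij.2|) (0, i)).
Qed.

Definition box (a b : 'I_n -> R) : set 'rV[R]_n :=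
  [set x | forall i, `]a i, b i[%classic (x 0 i)].

Lemma measurable_cylinder (A : 'I_n -> set R) :
  (forall i, measurable (A i)) ->
  measurable [set x : 'rV[R]_n | forall i, A i (x 0 i)].
Proof.
move=> mA.
have -> : [set x : 'rV[R]_n | forall i, A i (x 0 i)] =
    \bigcap_(i in [set: 'I_n]) (fun x : 'rV[R]_n => x 0 i) @^-1` A i.
  by apply/seteqP; split => x /= h i; [move=> _; exact: h | exact: h].
apply: fin_bigcap_measurable => //= i _.
rewrite -[X in measurable X]setTI; exact: (measurable_rV_coord i measurableT (mA _)).
Qed.

Lemma measurable_box a b : measurable (box a b).
Proof.
by apply: (@measurable_cylinder (fun i => `]a i, b i[%classic)) => i; exact: measurable_itv.
Qed.

Lemma leb_box_itv a b : leb R n (box a b) = (\prod_(i < n) (Num.max (b i - a i) 0)%:E)%E.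
Proof.
rewrite /box (@leb_box _ _ (fun i => `]a i, b i[%classic))//; apply: eq_bigr => i _.
rewrite lebesgue_measure_itv/= lte_fin; case: ltP => ab.
  by rewrite -EFinB max_l// subr_ge0 ltW.
by rewrite max_r// subr_le0.
Qed.

Lemma ball_box x (r : R) : 0 < r ->
  ball x r = box (fun i => x 0 i - r) (fun i => x 0 i + r).
Proof.
move=> r0; apply/seteqP; split=> y.
  move/(ball_rVP _ _ r0) => xy i /=; have := xy i.
  by rewrite in_itv/= ltr_norml => /andP[? ?]; apply/andP; split; lra.
move=> xy; apply/(ball_rVP _ _ r0) => i; have := xy i.
by rewrite /= in_itv/= ltr_norml => /andP[? ?]; apply/andP; split; lra.
Qed.

Lemma leb_ball x (r : R) : 0 < r -> leb R n (ball x r) = ((r *+ 2) ^+ n)%:E.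
Proof.
move=> r0; rewrite ball_box// leb_box_itv.
under eq_bigr => i _.
  rewrite (_ : _ - _ = r *+ 2); last by rewrite mulr2n; ring.
  rewrite max_l; last by rewrite mulrn_wge0// ltW.
  over.
by rewrite prodEFin prodr_const card_ord.
Qed.

(** An open set is the union of the cubes with rational centre and radius that it
  contains. *)
Lemma open_measurable_rV U : open U -> measurable U.
Proof.
move=> oU.
pose box_ (qr : 'rV[rat]_n * rat) : set 'rV[R]_n :=
  box (fun i => ratr (qr.1 0 i) - ratr qr.2) (fun i => ratr (qr.1 0 i) + ratr qr.2).
pose F qr := if pselect (box_ qr `<=` U) then box_ qr else set0.
rewrite (_ : U = \bigcup_qr F qr); last first.
  apply/seteqP; split=> [x Ux|x [qr _]]; last first.
    by rewrite /F; case: pselect => // h; exact: h.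
  have /nbhs_ballP[e /= e0 xe] : nbhs x U by exact: open_nbhs_nbhs.
  have [r] := @rat_in_itvoo R 0 (e / 2) ltac:(by rewrite divr_gt0).
  rewrite in_itv/= => /andP[r0 re].
  have H i : exists q : rat, x 0 i - ratr r < ratr q < x 0 i + ratr r.
    have [] := @rat_in_itvoo R (x 0 i - ratr r) (x 0 i + ratr r); first by lra.
    by move=> q; rewrite in_itv/= => h; exists q.
  have [q qP] := choice H.
  exists (\row_i q i, r) => //.
  rewrite /F; case: pselect => [_ i|]/=; rewrite /box_/box/=.
    by rewrite mxE in_itv/=; move/andP: (qP i) => [? ?]; apply/andP; split; lra.
  case=> y yq; apply: xe; apply/(ball_rVP _ _ e0) => i.
  have := yq i; rewrite /= mxE in_itv/= => /andP[? ?].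
  by rewrite ltr_norml; move/andP: (qP i) => [? ?]; apply/andP; split; lra.
apply: countable_bigcupT_measurable => [|qr]; first exact: countableP.
by rewrite /F; case: (pselect _) => _ /=; [exact: measurable_box|exact: measurable0].
Qed.

Lemma closed_measurable_rV U : closed U -> measurable U.
Proof.
move=> cU; rewrite -(setCK U); apply: measurableC.
by apply: open_measurable_rV; rewrite openC.
Qed.

Lemma open_continuous_measurable_fun_rV U f : open U ->
  (forall x, U x -> {for x, continuous f}) -> measurable_fun U f.
Proof.
move=> oU cf; apply: (measurability _ (RGenOInfty.measurableE R)).
move=> _ [_ [a ->] <-]; apply: open_measurable_rV.
rewrite openE => x [Ux fx]; rewrite /interior /=.
apply: filterI; first exact: open_nbhs_nbhs.
apply: (cf _ Ux); apply: open_nbhs_nbhs; split=> //.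
Qed.

Lemma continuous_measurable_fun_rV f :
  continuous f -> measurable_fun setT f.
Proof.
move=> cf; apply: open_continuous_measurable_fun_rV => [|x _]; first exact: openT.
exact: cf.
Qed.

Definition cylinders : set (set 'rV[R]_n) :=
  [set B | exists A : 'I_n -> set R, (forall i, measurable (A i)) /\
     B = [set x : 'rV[R]_n | forall i, A i (x 0 i)]].

Lemma measurable_rVE : @measurable _ 'rV[R]_n = <<s cylinders >>.
Proof.
apply/seteqP; split => B.
  suff : @rV_sigma_algebra R n `<=` <<s cylinders >> by exact.
  apply: smallest_sub; first exact: smallest_sigma_algebra.
  move=> C; rewrite -bigcup_seq/= => -[i _ [D mD <-]].
  apply: sub_sigma_algebra.
  exists (fun j => if j == i then D else setT); split=> [j|].
    by case: ifP.
  apply/seteqP; split=> x/=.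
    by move=> [_ Dx] j; case: eqP => // ->.
  by move=> /(_ i); rewrite eqxx.
apply: smallest_sub; first exact: sigma_algebra_measurable.
by move=> _ [A [mA ->]]; exact: measurable_cylinder.
Qed.

(** Products of measurable sets are stable under intersection and generate the
  sigma-algebra. *)
Lemma leb_unique (m : {measure set 'rV[R]_n -> \bar R}) :
  (forall A : 'I_n -> set R, (forall i, measurable (A i)) ->
     m [set x | forall i, A i (x 0 i)] = (\prod_(i < n) lebesgue_measure (A i))%E) ->
  forall A, measurable A -> leb R n A = m A.
Proof.
move=> mE A mA.
apply: (measure_unique cylinders (fun k => box (fun=> - k%:R) (fun=> k%:R))) => //.
- exact: measurable_rVE.
- move=> _ _ [B [mB ->]] [C [mC ->]]; exists (fun i => B i `&` C i); split.
    by move=> i; exact: measurableI.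
  apply/seteqP; split=> x/=; first by move=> [Bx Cx] i; split; [exact: Bx|exact: Cx].
  by move=> BC; split=> i; have [] := BC i.
- by move=> k; exists (fun=> `](- k%:R), k%:R[%classic); split.
- apply/seteqP; split=> // x _.
  exists (Num.truncn `|x|).+1 => // i /=; rewrite in_itv/= -ltr_norml.
  apply: le_lt_trans (Num.Theory.truncnS_gt _).
  exact: normr_coord.
- move=> _ [B [mB ->]]; rewrite (mE B mB); exact: leb_box.
- move=> k; rewrite [X in (X < _)%E](leb_box_itv (fun=> - k%:R) (fun=> k%:R)).
  by rewrite prodEFin ltry.
Qed.

Definition shift_rV (a x : 'rV[R]_n) := x + a.

Lemma measurable_shift_rV a : measurable_fun setT (shift_rV a).
Proof.
apply: measurable_fun_rVP => i; under eq_fun do rewrite mxE.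
by apply: measurable_funD => //; exact: measurable_rV_coord.
Qed.

End leb_theory.

Lemma lebesgue_measure_shift (R : realType) (a : R) (A : set R) : measurable A ->
  lebesgue_measure [set x | A (x + a)] = lebesgue_measure A.
Proof.
move=> mA.
have ms : measurable_fun [set: measurableTypeR R] (fun x : measurableTypeR R => x + a : measurableTypeR R).
  by apply: measurable_funD.
pose m := pushforward (@lebesgue_measure R) (fun x : measurableTypeR R => x + a : measurableTypeR R) :
  {measure set (measurableTypeR R) -> \bar R}.
rewrite [RHS](@lebesgue_measure_unique R (m ms))// => _ [[b c] _ <-].
rewrite /m/= /pushforward.
rewrite (_ : _ @^-1` _ = `]b - a, c - a]%classic); last first.
  by apply/seteqP; split=> x /=; rewrite !in_itv/= ltrBlDr lerBrDr.
rewrite !lebesgue_measure_itv/= !lte_fin ltrD2r; case: ifP => // _.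
by rewrite -!EFinB; congr EFin; ring.
Qed.

Section leb_shift.
Context (R : realType) (n : nat).
Implicit Types (x y z a : 'rV[R]_n) (U : set 'rV[R]_n).

(** Both sides agree on products of measurable sets, by the invariance of Lebesgue
  measure on the line. *)
Lemma leb_shift a A : measurable A -> leb R n (shift_rV a @^-1` A) = leb R n A.
Proof.
move=> mA.
pose m := pushforward (leb R n) (shift_rV a) : {measure set 'rV[R]_n -> \bar R}.
rewrite [RHS](@leb_unique R n (m (measurable_shift_rV a)))// => B mB.
rewrite /m/= /pushforward.
rewrite (_ : _ @^-1` _ = [set x : 'rV[R]_n | forall i, [set t | B i (t + a 0 i)] (x 0 i)]); last first.
  by apply/seteqP; split=> x /= h i; have := h i; rewrite mxE.
rewrite (@leb_box _ _ (fun i => [set t | B i (t + a 0 i)])).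
  by apply: eq_bigr => i _; rewrite lebesgue_measure_shift.
move=> i; have := @measurable_funD _ _ R setT id (cst (a 0 i)) ltac:(exact: measurable_id) ltac:(exact: measurable_cst) measurableT _ (mB i).
by rewrite setTI.
Qed.

Lemma ge0_integral_leb_shift a (f : 'rV[R]_n -> \bar R) :
  measurable_fun setT f -> (forall x, 0 <= f x)%E ->
  (\int[leb R n]_x f (shift_rV a x) = \int[leb R n]_x f x)%E.
Proof.
move=> mf f0.
have := @ge0_integral_pushforward _ _ _ _ R _ (measurable_shift_rV a) (leb R n) setT f measurableT mf (fun x _ => f0 x).
rewrite preimage_setT => <-; apply: eq_measure_integral.
  exact: measurable_shift_rV.
by move=> ? B mB _; exact: leb_shift.
Qed.

Lemma integral_leb_shift a (f : 'rV[R]_n -> \bar R) :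
  measurable_fun setT f ->
  (\int[leb R n]_x f (shift_rV a x) = \int[leb R n]_x f x)%E.
Proof.
move=> mf; rewrite [LHS]integralE [RHS]integralE; congr (_ - _)%E.
  rewrite -(ge0_integral_leb_shift a (measurable_funepos mf) (funepos_ge0 f)).
  by apply: eq_integral => x _; rewrite (funepos_comp f (shift_rV a)).
rewrite -(ge0_integral_leb_shift a (measurable_funeneg mf) (funeneg_ge0 f)).
by apply: eq_integral => x _; rewrite (funeneg_comp f (shift_rV a)).
Qed.

Lemma integrable_leb_shift a (f : 'rV[R]_n -> \bar R) :
  (leb R n).-integrable setT f -> (leb R n).-integrable setT (fun x => f (shift_rV a x)).
Proof.
move=> /integrableP[mf foo]; apply/integrableP; split.
  exact: (measurableT_comp mf (measurable_shift_rV a)).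
by rewrite (ge0_integral_leb_shift a (f := fun x => `|f x|%E))//; exact: measurableT_comp.
Qed.

End leb_shift.

(** * Calculus of partial derivatives *)
Section Ck_theory.
Context (R : realType) (n : nat).
Implicit Types (x y z : 'rV[R]_n) (U V : set 'rV[R]_n) (f g : 'rV[R]_n -> R).
Implicit Types (i j : 'I_n).

Notation e_ i := (delta_mx 0 i : 'rV[R]_n).

Lemma pderivs_rcons s i f : pderivs (rcons s i) f = pderivs s (pderiv i f).
Proof. by rewrite /pderivs foldr_rcons. Qed.

Lemma near_eq_pderivs s f g x : (\forall y \near x, f y = g y) ->
  \forall y \near x, pderivs s f y = pderivs s g y.
Proof.
elim: s => //= i s IH /IH /near_join; apply: filterS => y fg.
exact: near_eq_derive.
Qed.

Lemma eq_pderivs U s f g : open U -> (forall x, U x -> f x = g x) ->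
  forall x, U x -> pderivs s f x = pderivs s g x.
Proof.
move=> oU fg x Ux; have : \forall y \near x, f y = g y.
  by apply: filterS (open_nbhs_nbhs (conj oU Ux)).
by move=> /(near_eq_pderivs s)/nbhs_singleton.
Qed.

Arguments eq_pderivs {U s f g} _ _ {x} _.
Lemma Ck_local (k : nat) U f :
  (forall x, U x -> exists V g, [/\ open V, V x, Ck k V g & forall y, V y -> f y = g y]) ->
  Ck k U f.
Proof.
move=> loc; split=> [s i x sk Ux|s x sk Ux]; have [V [g [oV Vx [dg cg] fg]]] := loc x Ux.
  apply: near_eq_derivable (dg s i x sk Vx).
  apply: near_eq_pderivs; apply: filterS (open_nbhs_nbhs (conj oV Vx)) => y Vy.
  by rewrite fg.
have E : \forall y \near x, pderivs s g y = pderivs s f y.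
  apply: near_eq_pderivs; apply: filterS (open_nbhs_nbhs (conj oV Vx)) => y Vy.
  by rewrite fg.
rewrite /prop_for /continuous_at -(nbhs_singleton E).
exact: cvg_trans (near_eq_cvg E) (cg s x sk Vx).
Qed.

Lemma eq_Ck k U f g : open U -> (forall x, U x -> f x = g x) -> Ck k U f -> Ck k U g.
Proof.
move=> oU fg Cf; apply: Ck_local => x Ux; exists U, f; split=> // y Uy.
by rewrite fg.
Qed.

Lemma sub_Ck k U V f : U `<=` V -> Ck k V f -> Ck k U f.
Proof. by move=> UV [df cf]; split=> [s i x sk /UV|s x sk /UV]; [exact: df|exact: cf]. Qed.

Lemma le_Ck k k' U f : (k <= k')%N -> Ck k' U f -> Ck k U f.
Proof.
move=> kk [df cf]; split=> [s i x sk|s x sk]; first exact/df/(leq_trans sk).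
exact/cf/(leq_trans sk).
Qed.

(** The definition of [Ck] differentiates from the outside; induction on
  the order rather peels off the innermost derivative. *)
Lemma CkS k U f : Ck k.+1 U f <->
  [/\ forall i x, U x -> derivable f x (e_ i),
      forall x, U x -> {for x, continuous f} &
      forall i, Ck k U (pderiv i f)].
Proof.
split=> [[df cf]|[df cf Cf]].
  split=> [i x Ux|x Ux|i]; [exact: (df [::])|exact: (cf [::])|].
  split=> [s j x sk Ux|s x sk Ux]; rewrite -pderivs_rcons;
    by [apply: df => //; rewrite size_rcons|apply: cf => //; rewrite size_rcons].
split=> [s i x|s x]; case/lastP: s => [|s j]; rewrite ?size_rcons ?pderivs_rcons.
- by move=> _; exact: df.
- by move=> sk; exact: (Cf j).1.
- by move=> _; exact: cf.
- by move=> sk; exact: (Cf j).2.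
Qed.

Lemma Ck0P U f : Ck 0 U f <-> forall x, U x -> {for x, continuous f}.
Proof.
split=> [[_ cf] x Ux|cf]; first exact: (cf [::]).
by split=> [[|j s] i x|[|j s] x] //= _; exact: cf.
Qed.

Lemma Ck_cst k U (a : R) : open U -> Ck k U (cst a).
Proof.
elim: k a => [|k IH] a oU; first by apply/Ck0P => x _; exact: cst_continuous.
apply/CkS; split=> [i x _|x _|i]; [exact: derivable_cst|exact: cst_continuous|].
by apply: eq_Ck (IH 0 oU) => // x _; rewrite /pderiv derive_cst.
Qed.

Lemma CkD k U f g : open U -> Ck k U f -> Ck k U g -> Ck k U (f + g).
Proof.
move=> oU; elim: k f g => [|k IH] f g.
  by move=> /Ck0P cf /Ck0P cg; apply/Ck0P => x Ux; apply: continuousD; [exact: cf|exact: cg].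
move=> /CkS[df cf Cf] /CkS[dg cg Cg]; apply/CkS; split=> [i x Ux|x Ux|i].
- by apply: derivableD; [exact: df|exact: dg].
- by apply: continuousD; [exact: cf|exact: cg].
- apply: eq_Ck (IH _ _ (Cf i) (Cg i)) => // x Ux.
  by rewrite /pderiv deriveD//; [exact: df|exact: dg].
Qed.

Lemma CkM k U f g : open U -> Ck k U f -> Ck k U g -> Ck k U (f * g).
Proof.
move=> oU; elim: k f g => [|k IH] f g.
  by move=> /Ck0P cf /Ck0P cg; apply/Ck0P => x Ux; apply: continuousM; [exact: cf|exact: cg].
move=> Cf' Cg'; have [df cf Cf] := (CkS _ _ _).1 Cf'; have [dg cg Cg] := (CkS _ _ _).1 Cg'.
apply/CkS; split=> [i x Ux|x Ux|i].
- by apply: derivableM; [exact: df|exact: dg].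
- by apply: continuousM; [exact: cf|exact: cg].
- have Cf0 := le_Ck (leqnSn k) Cf'; have Cg0 := le_Ck (leqnSn k) Cg'.
  apply: eq_Ck (CkD oU (IH _ _ Cf0 (Cg i)) (IH _ _ Cg0 (Cf i))) => // x Ux.
  by rewrite /pderiv deriveM//; [exact: df|exact: dg].
Qed.

Lemma CkZ k U (a : R) f : open U -> Ck k U f -> Ck k U (a *: f).
Proof. by move=> oU Cf; apply: eq_Ck (CkM oU (Ck_cst k a oU) Cf). Qed.

Lemma CkN k U f : open U -> Ck k U f -> Ck k U (- f).
Proof. by move=> oU Cf; rewrite -scaleN1r; exact: CkZ. Qed.

Lemma CkB k U f g : open U -> Ck k U f -> Ck k U g -> Ck k U (f - g).
Proof. by move=> oU Cf Cg; apply: CkD => //; exact: CkN. Qed.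

Lemma Ck_sum (I : Type) (r : seq I) (P : pred I) k U (F : I -> 'rV[R]_n -> R) :
  open U -> (forall a : I, P a -> Ck k U (F a)) -> Ck k U (\sum_(a <- r | P a) F a).
Proof.
move=> oU CF; elim/big_ind : _ => //; first exact: (Ck_cst k 0 oU).
by move=> ? ?; exact: CkD.
Qed.

Lemma CkD_pderivs s U f g : open U -> Ck (size s) U f -> Ck (size s) U g ->
  forall x, U x -> pderivs s (f + g) x = pderivs s f x + pderivs s g x.
Proof.
move=> oU; elim/last_ind: s f g => //= s i IH f g; rewrite size_rcons !pderivs_rcons.
move=> /CkS[df cf Cf] /CkS[dg cg Cg] x Ux; rewrite -IH//.
apply: (eq_pderivs oU _ Ux) => y Uy.
by rewrite /pderiv deriveD//; [exact: df|exact: dg].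
Qed.

Lemma CkZ_pderivs s U (a : R) f : open U -> Ck (size s) U f ->
  forall x, U x -> pderivs s (a *: f) x = a * pderivs s f x.
Proof.
move=> oU; elim/last_ind: s f => //= s i IH f; rewrite size_rcons !pderivs_rcons.
move=> /CkS[df cf Cf] x Ux; rewrite -IH//.
apply: (eq_pderivs oU _ Ux) => y Uy.
by rewrite /pderiv deriveZ//; exact: df.
Qed.

Lemma CkB_pderivs s U f g : open U -> Ck (size s) U f -> Ck (size s) U g ->
  forall x, U x -> pderivs s (f - g) x = pderivs s f x - pderivs s g x.
Proof.
move=> oU Cf Cg x Ux; rewrite (CkD_pderivs oU)//; last exact: CkN.
by rewrite -scaleN1r (CkZ_pderivs _ oU)// mulN1r.
Qed.

Lemma Ck_sum_pderivs (I : Type) (r : seq I) s U (F : I -> 'rV[R]_n -> R) :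
  open U -> (forall a : I, Ck (size s) U (F a)) ->
  forall x, U x -> pderivs s (\sum_(a <- r) F a) x = \sum_(a <- r) pderivs s (F a) x.
Proof.
move=> oU CF x Ux; elim: r => [|a r IH].
  rewrite !big_nil; rewrite -(scale0r (0 : 'rV[R]_n -> R)) (CkZ_pderivs _ oU) ?mul0r//.
  exact: (Ck_cst _ 0 oU).
rewrite !big_cons (CkD_pderivs oU) ?IH//; exact: Ck_sum.
Qed.

Lemma leibniz1 i U f g : open U -> Ck 1 U f -> Ck 1 U g ->
  forall x, U x -> pderiv i (f * g) x = f x * pderiv i g x + g x * pderiv i f x.
Proof.
move=> oU /CkS[df _ _] /CkS[dg _ _] x Ux.
by rewrite /pderiv deriveM//; [exact: df|exact: dg].
Qed.

Lemma is_derive_line f i x (t : R) : derivable f (t *: e_ i + x) (e_ i) ->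
  is_derive t 1 (fun s : R => f (s *: e_ i + x)) (pderiv i f (t *: e_ i + x)).
Proof.
move=> df; set y := t *: e_ i + x in df *.
have E : (fun h : R => h^-1 *: (((fun s : R => f (s *: e_ i + x)) \o shift t) (h *: 1) - f y)) =
         (fun h : R => h^-1 *: ((f \o shift y) (h *: e_ i) - f y)).
  by apply/funext => h /=; rewrite [h *: 1]mulr1 /y scalerDl addrA.
by split; rewrite /derivable /pderiv /derive E.
Qed.

(** The mean value theorem, for increments of either sign. *)
Lemma MVT_line U f i x (t : R) :
  (forall s : R, `|s| <= `|t| -> U (s *: e_ i + x)) ->
  (forall y, U y -> derivable f y (e_ i)) ->
  exists2 c, `|c| <= `|t| & f (t *: e_ i + x) - f x = t * pderiv i f (c *: e_ i + x).
Proof.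
move=> Us df.
pose g (s : R) := f (s *: e_ i + x); pose dg (s : R) := pderiv i f (s *: e_ i + x).
have isd (s : R) : `|s| <= `|t| -> is_derive s 1 g (dg s).
  by move=> st; apply: is_derive_line; apply: df; exact: Us.
have cg (a b : R) : (forall s, a <= s <= b -> `|s| <= `|t|) -> {within `[a, b], continuous g}.
  move=> ab; apply: derivable_within_continuous => s; rewrite in_itv/= => /ab st.
  by have [] := isd _ st.
have [t0|t0] := leP 0 t.
  have H (s : R) : 0 <= s <= t -> `|s| <= `|t| by move=> /andP[? ?]; rewrite !ger0_norm.
  have [||c] := @MVT_segment R g dg 0 t t0.
  - by move=> s; rewrite in_itv/= => /andP[/ltW ? /ltW ?]; apply: isd; apply: H; apply/andP.
  - exact: cg.
  rewrite in_itv/= => /H ct; rewrite /g scale0r add0r subr0 => E.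
  by exists c => //; rewrite E mulrC.
have H (s : R) : t <= s <= 0 -> `|s| <= `|t|.
  by move=> /andP[? ?]; rewrite ler0_norm// ltr0_norm// lerN2.
have [||c] := @MVT_segment R g dg t 0 (ltW t0).
- by move=> s; rewrite in_itv/= => /andP[/ltW ? /ltW ?]; apply: isd; apply: H; apply/andP.
- exact: cg.
rewrite in_itv/= => /H ct; rewrite /g scale0r add0r sub0r => E.
by exists c => //; rewrite -opprB E mulrN opprK mulrC.
Qed.

(** Change the coordinates of [x] into those of [y] one at a time. *)
Lemma lipschitz_pderiv f (M : R) :
  (forall i x, derivable f x (e_ i)) -> (forall i x, `|pderiv i f x| <= M) ->
  forall x y, `|f x - f y| <= n%:R * M * `|x - y|.
Proof.
move=> df dM x y.
pose z k : 'rV[R]_n := \row_i if (i < k)%N then y 0 i else x 0 i.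
suff H k : (k <= n)%N -> `|f x - f (z k)| <= k%:R * M * `|x - y|.
  have := H n (leqnn n); rewrite (_ : z n = y)//.
  by apply/rowP => i; rewrite mxE ltn_ord.
elim: k => [_|k IH kn].
  rewrite (_ : z 0%N = x); last by apply/rowP => i; rewrite mxE.
  by rewrite subrr normr0 !mul0r.
pose i := Ordinal kn.
have M0 : 0 <= M by exact: le_trans (dM i x).
have -> : z k.+1 = (y 0 i - x 0 i) *: e_ i + z k.
  apply/rowP => j; rewrite !mxE eqxx /= ltnS leq_eqVlt.
  rewrite (_ : (val j == k) = (j == i)) //.
  case: eqVneq => /= [->|_]; last by rewrite mulr0 add0r.
  by rewrite ltnn mulr1 subrK.
have [//|c _] := @MVT_line setT f i (z k) (y 0 i - x 0 i) _ (fun y _ => df i y).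
set w := f _ => E.
rewrite -natr1 2!mulrDl mul1r (_ : f x - w = f x - f (z k) - (w - f (z k))); last by ring.
apply: (le_trans (ler_normB _ _)); apply: lerD; first exact/IH/ltnW.
rewrite E normrM mulrC; apply: ler_pM => //.
by rewrite distrC; have := normr_coord (x - y) i; rewrite !mxE.
Qed.

(** Symmetry of second derivatives, by writing the mixed second difference as a
  second derivative at an intermediate point in both orders. *)
Lemma second_difference U f i j x (r s : R) : Ck 2 U f ->
  0 < r -> ball x r `<=` U -> 0 <= s -> s + s < r ->
  exists2 z, `|x - z| <= s + s &
  f (s *: e_ i + (s *: e_ j + x)) - f (s *: e_ j + x) - (f (s *: e_ i + x) - f x) =
  s * (s * pderivs [:: j; i] f z).
Proof.
move=> Cf r0 xU s0 sr.
have [df cf Cf1] := (CkS _ _ _).1 Cf.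
have e1 (k : 'I_n) (a : R) : `|a| <= s -> `|a *: (e_ k)| <= s.
  move=> a_s; rewrite normrZ; apply: le_trans a_s.
  rewrite ler_piMr// [leLHS]/Num.norm/= mx_normrE.
  apply: bigmax_le => // -[p q] _ /=; rewrite mxE.
  by case: (_ && _); rewrite ?normr1 ?normr0.
have inU (a b : R) : `|a| <= s -> `|b| <= s -> U (a *: e_ i + (b *: e_ j + x)).
  move=> as_ bs; apply: xU; rewrite -ball_normE /=.
  rewrite addrA [_ + x]addrC opprD addrA subrr add0r normrN.
  by apply: le_lt_trans (ler_normD _ _) _; apply: le_lt_trans sr; apply: lerD; exact: e1.
have s_s : `|s| <= s by rewrite ger0_norm.
pose phi y := f (s *: e_ j + y) - f y.
pose V := [set y | U y /\ U (s *: e_ j + y)].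
have dphi y : V y -> is_derive y (e_ i) phi (pderiv i f (s *: e_ j + y) - pderiv i f y).
  move=> [Uy Usy].
  have D1 : is_derive y (e_ i) f (pderiv i f y) by split=> //; exact: df.
  have D2 : is_derive y (e_ i) (fun y => f (s *: e_ j + y)) (pderiv i f (s *: e_ j + y)).
    have E : (fun h : R => h^-1 *: (((fun y => f (s *: e_ j + y)) \o shift y) (h *: e_ i) - f (s *: e_ j + y))) =
       (fun h : R => h^-1 *: ((f \o shift (s *: e_ j + y)) (h *: e_ i) - f (s *: e_ j + y))).
      by apply/funext => h /=; rewrite addrCA.
    have := df i _ Usy.
    by split; rewrite /derivable /pderiv /derive E.
  exact: is_deriveB.
have [|y Vy|c cs E] := @MVT_line V phi i x s.
- move=> a; rewrite (ger0_norm s0) => as_; split.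
    by have := inU a 0 as_ ltac:(by rewrite normr0); rewrite scale0r add0r.
  by rewrite addrCA; exact: inU.
- by have [] := dphi y Vy.
rewrite (ger0_norm s0) in cs.
have Vc : V (c *: e_ i + x).
  split; last by rewrite addrCA; exact: inU.
  by have := inU c 0 cs ltac:(by rewrite normr0); rewrite scale0r add0r.
have [_ dE] := dphi _ Vc; rewrite -/(pderiv i phi _) in dE.
have [|y Uy|e es E2] := @MVT_line U (pderiv i f) j (c *: e_ i + x) s.
- move=> a; rewrite (ger0_norm s0) => as_.
  by rewrite addrCA; exact: inU.
- by have [dd _ _] := (CkS _ _ _).1 (Cf1 i); exact: dd.
rewrite (ger0_norm s0) in es.
exists (e *: e_ j + (c *: e_ i + x)).
  rewrite addrA [_ + x]addrC opprD addrA subrr add0r normrN.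
  by apply: le_trans (ler_normD _ _) _; apply: lerD; exact: e1.
move: E; rewrite dE E2 /phi => <-.
rewrite (addrCA (s *: e_ i)).
move: (f (s *: e_ j + (s *: e_ i + x))) (f (s *: e_ j + x)) (f (s *: e_ i + x)) (f x) => *.
ring.
Qed.

Lemma schwarz U f i j x : open U -> Ck 2 U f -> U x ->
  pderivs [:: i; j] f x = pderivs [:: j; i] f x.
Proof.
move=> oU Cf Ux; apply/eqP; rewrite -subr_eq0 -normr_le0; apply/ler_addgt0Pr => e e0.
rewrite add0r.
have tri (a b c : R) : `|a - c| <= e / 2 -> `|b - c| <= e / 2 -> `|a - b| <= e.
  move=> ac bc; rewrite [e]splitr -(subrKA c) (le_trans (ler_normD _ _))//.
  by apply: lerD => //; rewrite distrC.
have e20 : 0 < e / 2 by rewrite divr_gt0.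
have /nbhs_ballP[r0 /= r00 r0U] : nbhs x U by exact: open_nbhs_nbhs.
have c1 := Cf.2 [:: i; j] x isT Ux; have c2 := Cf.2 [:: j; i] x isT Ux.
move: c1 => /cvgrPdist_le/(_ _ e20)/nbhs_ballP[r1 /= r10 r1P].
move: c2 => /cvgrPdist_le/(_ _ e20)/nbhs_ballP[r2 /= r20 r2P].
have [s s0 [sr0 sr1 sr2]] : exists2 s : R, 0 < s & [/\ s + s < r0, s + s < r1 & s + s < r2].
  pose r := Num.min r0 (Num.min r1 r2).
  have : 0 < r by rewrite !lt_min r00 r10 r20.
  have [rr0 [rr1 rr2]] : r <= r0 /\ r <= r1 /\ r <= r2 by rewrite !ge_min !lexx !orbT.
  by move=> rp; exists (r / 4); [lra|split; lra].
have [z1 xz1 E1] := @second_difference U f i j x r0 s Cf r00 r0U (ltW s0) sr0.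
have [z2 xz2 E2] := @second_difference U f j i x r0 s Cf r00 r0U (ltW s0) sr0.
have E : pderivs [:: j; i] f z1 = pderivs [:: i; j] f z2.
  have : s * (s * pderivs [:: j; i] f z1) = s * (s * pderivs [:: i; j] f z2).
    apply: etrans (esym E1) _; apply: etrans _ E2.
    have -> : s *: e_ j + (s *: e_ i + x) = s *: e_ i + (s *: e_ j + x) by exact: addrCA.
    move: (f (s *: e_ i + (s *: e_ j + x))) (f (s *: e_ j + x)) (f (s *: e_ i + x)) (f x) => *.
    ring.
  by move=> /(mulfI (lt0r_neq0 s0))/(mulfI (lt0r_neq0 s0)).
have b1 : ball x r2 z1.
  by rewrite -ball_normE /=; exact: le_lt_trans xz1 sr2.
have b2 : ball x r1 z2.
  by rewrite -ball_normE /=; exact: le_lt_trans xz2 sr1.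
have H1 : `|pderivs [:: j; i] f x - pderivs [:: i; j] f z2| <= e / 2 by rewrite -E; exact: r2P.
have H2 : `|pderivs [:: i; j] f x - pderivs [:: i; j] f z2| <= e / 2 by exact: r1P.
exact: tri H2 H1.
Qed.

End Ck_theory.
Arguments eq_pderivs {R n U s f g} _ _ {x} _.

(** * A smooth mollifier *)
Section flat.
Context (R : realType).
Implicit Types (P : {poly R}) (x y : R).

(** The family is closed under differentiation, hence made of smooth functions:
  exp (-1/x) and all its derivatives are of this form. *)
Definition flat P x : R := if 0 < x then P.[x^-1] * expR (- x^-1) else 0.

Definition flat_der P : {poly R} := 'X^2 * (P - P^`()).

(** Each monomial is bounded by the corresponding term of the exponential
  series. *)
Lemma poly_le_expR P : exists2 C : R, 0 <= C & forall y, 0 <= y -> `|P.[y]| <= C * expR y.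
Proof.
exists (\sum_(i < size P) `|P`_i| * i`!%:R).
  by apply: sumr_ge0 => i _; rewrite mulr_ge0.
move=> y y0; rewrite horner_coef mulr_suml; apply: le_trans (ler_norm_sum _ _ _) _.
apply: ler_sum => i _; rewrite normrM -mulrA ler_wpM2l// normrX ger0_norm//.
rewrite -ler_pdivrMl ?ltr0n ?fact_gt0// mulrC.
case: (val i) => [|k]; first by rewrite expr0 fact0 divr1 -expR0 ler_expR.
by have := expR_ge1Dxn k y0; apply: le_trans; rewrite lerDr.
Qed.

Lemma is_derive_flat P x : is_derive x 1 (flat P) (flat (flat_der P) x).
Proof.
have [x0|x0|<-] := ltgtP 0 x.
- have xN0 : x != 0 by rewrite gt_eqF.
  have D : is_derive x 1 (fun x => P.[x^-1] * expR (- x^-1)) (flat (flat_der P) x).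
    have DV : is_derive x (1 : R) (fun y => y^-1) (- (x ^- 2) *: 1).
      exact: (@is_deriveV R id).
    have DP := @is_derive1_comp R (horner P) (fun y => y^-1) x _ _ (is_derive_poly P x^-1) DV.
    have DN : is_derive x (1 : R) (fun y => - y^-1) (- (- (x ^- 2) *: 1)) by exact: is_deriveN.
    have DE := @is_derive1_comp R expR (fun y => - y^-1) x _ _ (is_derive_expR _) DN.
    refine (is_derive_eq (is_deriveM DP DE) _).
    rewrite /flat x0 /flat_der /GRing.scale/= !mulr1 !hornerE /=.
    rewrite -exprVn; move: (x^-1) => y.
    by move: (P.[y]) (P^`().[y]) (expR _) => *; ring.
  apply: near_eq_is_derive D; near=> y.
  rewrite /flat ifT//; near: y.
  by apply: open_nbhs_nbhs; split=> //; exact: open_gt.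
- rewrite {2}/flat ifF; last by rewrite ltNge (ltW x0).
  have D : is_derive x (1 : R) (cst 0 : R -> R) 0 by exact: is_derive_cst.
  apply: near_eq_is_derive D.
  near=> y; rewrite /flat ifF//; apply/negbTE; rewrite -leNgt ltW//; near: y.
  by apply: open_nbhs_nbhs; split=> //; exact: open_lt.
- rewrite {2}/flat ltxx.
  (* At 0 the quotient P(1/h) exp(-1/h) / h is at most C h, because
     (1/h)^2 |P(1/h)| <= C exp(1/h). *)
  have [C C0 CP] := poly_le_expR ('X^2 * P).
  suff H : (fun h : R => h^-1 *: ((flat P \o shift 0) (h *: 1) - flat P 0)) @ 0^' --> (0 : R).
    by split; [apply/cvg_ex; exists 0|exact/cvg_lim].
  apply/cvgrPdist_le => e e0.
  have C1 : 0 < C + 1 by rewrite ltr_pwDr.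
  have eC : 0 < e / (C + 1) by rewrite divr_gt0.
  near=> h.
  rewrite sub0r normrN /= addr0 [h *: 1]mulr1 {2}/flat ltxx subr0 /flat.
  case: ifPn => [h0|_]; last by rewrite scaler0 normr0 ltW.
  have hN0 : h != 0 by rewrite gt_eqF.
  apply: (@le_trans _ _ (C * h)); last first.
    have : `|h| <= e / (C + 1) by near: h; exact: dnbhs0_le.
    rewrite (gtr0_norm h0) ler_pdivlMr// => He.
    by apply: le_trans He; rewrite mulrDr mulr1 mulrC lerDl ltW.
  have := CP h^-1; rewrite invr_ge0 => /(_ (ltW h0)).
  rewrite !hornerE /= normrM normrX (ger0_norm (ltW _)) ?invr_gt0// => H.
  rewrite /GRing.scale/= !normrM (gtr0_norm (expR_gt0 _)) expRN.
  have hV : 0 <= h^-1 by rewrite invr_ge0 ltW.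
  rewrite (ger0_norm hV) [leLHS]mulrA; rewrite ler_pdivrMr ?expR_gt0//.
  rewrite -(ler_pM2l (_ : 0 < h^-1)) ?invr_gt0// mulrA -expr2.
  apply: (le_trans H).
  have -> : h^-1 * (C * h * expR h^-1) = (h^-1 * h) * (C * expR h^-1).
    by move: (expR h^-1) (h^-1) => a b; ring.
  by rewrite mulVf// mul1r.
Unshelve. all: by end_near. Qed.

Lemma flat_ge0 x : 0 <= flat 1 x.
Proof. by rewrite /flat hornerC mul1r; case: ifP => // _; exact: expR_ge0. Qed.

End flat.

Section radial_bump.
Context (R : realType) (n : nat).
Implicit Types (x y z v : 'rV[R]_n) (f g : 'rV[R]_n -> R) (P : {poly R}).

Notation e_ i := (delta_mx 0 i : 'rV[R]_n).

Lemma is_derive_lineP f x v (df : R) :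
  is_derive x v f df <-> is_derive (0 : R) 1 (fun h : R => f (h *: v + x)) df.
Proof.
have E : (fun h : R => h^-1 *: (((fun s : R => f (s *: v + x)) \o shift 0) (h *: 1)
    - f (0 *: v + x))) = (fun h : R => h^-1 *: ((f \o shift x) (h *: v) - f x)).
  by apply/funext => h /=; rewrite addr0 [h *: 1]mulr1 scale0r add0r.
by split=> -[d1 d2]; split; move: d1 d2; rewrite /derivable /derive E.
Qed.

Lemma is_derive_comp_rV f (phi : R -> R) x v (df dphi : R) :
  is_derive x v f df -> is_derive (f x) 1 phi dphi ->
  is_derive x v (phi \o f) (dphi * df).
Proof.
move=> /is_derive_lineP Df Dphi; apply/is_derive_lineP.
by apply: (is_derive1_comp (f := phi)); rewrite scale0r add0r.
Qed.

Definition sqn z : R := \sum_(i < n) z 0 i ^+ 2.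

Lemma is_derive_coord z v (j : 'I_n) : is_derive z v (fun y : 'rV[R]_n => y 0 j) (v 0 j).
Proof.
apply/is_derive_lineP; under eq_fun do rewrite !mxE.
have -> : (fun h : R => h * v 0 j + z 0 j) = (id * cst (v 0 j)) + cst (z 0 j) by apply/funext.
apply: is_derive_eq; rewrite /cst scaler0 add0r addr0.
by rewrite /GRing.scale/= mulr1.
Qed.

Lemma Ck_coord k (j : 'I_n) : Ck k setT (fun y : 'rV[R]_n => y 0 j).
Proof.
case: k => [|k]; first by apply/Ck0P => x _; exact: coord_continuous.
apply/CkS; split=> [i x _|x _|i].
- by have [] := is_derive_coord x (e_ i) j.
- exact: coord_continuous.
- apply: eq_Ck (Ck_cst k ((e_ i) 0 j) openT) => [|x _]; first exact: openT.
  by have [_] := is_derive_coord x (e_ i) j.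
Qed.

Lemma sqnE : sqn = \sum_(j < n) (fun y : 'rV[R]_n => y 0 j) * (fun y : 'rV[R]_n => y 0 j).
Proof. by apply/funext => y; rewrite /sqn fct_sumE; apply: eq_bigr => j _; rewrite expr2. Qed.

Lemma is_derive_sqn z i : is_derive z (e_ i) sqn (2 * z 0 i).
Proof.
rewrite sqnE.
have D (j : 'I_n) := is_deriveM (is_derive_coord z (e_ i) j) (is_derive_coord z (e_ i) j).
apply: (is_derive_eq (is_derive_sum D)).
rewrite (bigD1 i)//= big1 ?addr0 => [|j ji]; rewrite !mxE ?eqxx /=.
  by rewrite /GRing.scale/= mulr1 mulr2n mulrDl mul1r.
by rewrite (negbTE ji) scaler0 addr0.
Qed.

(** For [P = 1] this is exp (-1 / (1 - |z|^2)) on the Euclidean unit ball; other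
  polynomials occur in its derivatives. *)
Definition bump P z : R := flat P (1 - sqn z).

Lemma is_derive_bump P z i :
  is_derive z (e_ i) (bump P) (-2 * z 0 i * bump (flat_der P) z).
Proof.
have D : is_derive z (e_ i) (cst 1 - sqn) (0 - 2 * z 0 i).
  by apply: is_deriveB; exact: is_derive_sqn.
apply: (is_derive_eq (is_derive_comp_rV D (is_derive_flat P _))).
by rewrite sub0r mulrC mulNr.
Qed.

Lemma continuous_sqn : continuous sqn.
Proof.
have oT : open [set: 'rV[R]_n] by exact: openT.
have : Ck 0 setT sqn.
  by rewrite sqnE; apply: Ck_sum => // j _; apply: CkM => //; exact: Ck_coord.
by move=> /Ck0P + z => /(_ z Logic.I).
Qed.

Lemma continuous_bump P : continuous (bump P).
Proof.
move=> z; apply: (@continuous_comp _ _ _ (fun y => 1 - sqn y) (flat P)).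
  by apply: continuousB; [exact: cst_continuous|exact: continuous_sqn].
apply/differentiable_continuous/derivable1_diffP.
by have [] := is_derive_flat P (1 - sqn z).
Qed.

Lemma Ck_bump k P : Ck k setT (bump P).
Proof.
elim: k P => [|k IH] P; first by apply/Ck0P => x _; exact: continuous_bump.
apply/CkS; split=> [i x _|x _|i].
- by have [] := is_derive_bump P x i.
- exact: continuous_bump.
- have oT : open [set: 'rV[R]_n] by exact: openT.
  apply: (eq_Ck oT _ (CkM oT (CkZ (-2) oT (Ck_coord k i)) (IH (flat_der P)))) => x _.
  by have [_] := is_derive_bump P x i.
Qed.

Lemma bump_ge0 z : 0 <= bump 1 z. Proof. exact: flat_ge0. Qed.

Lemma bumpN P z : bump P (- z) = bump P z.
Proof.
by congr flat; congr (_ - _); apply: eq_bigr => i _; rewrite mxE sqrrN.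
Qed.

Lemma norm_sqn z : `|z| ^+ 2 <= sqn z.
Proof.
have [->|z0] := eqVneq z 0.
  by rewrite normr0 expr0n/= sumr_ge0// => i _; exact: sqr_ge0.
have [[p q] zE] : exists i, `|z| = `|z i.1 i.2| by apply: mx_norm_neq0; apply: contra z0 => /eqP /mx_norm_eq0 ->.
rewrite zE /= ord1 real_normK ?num_real// /sqn (bigD1 q)//= lerDl.
by apply: sumr_ge0 => i _; exact: sqr_ge0.
Qed.

Lemma bump_out P z : 1 <= `|z| -> bump P z = 0.
Proof.
move=> z1; rewrite /bump /flat ifF//; apply/negbTE; rewrite -leNgt subr_le0.
by apply: le_trans (norm_sqn z); rewrite expr_ge1.
Qed.

(** If all coordinates of [z] are at most 1 / (2 (n + 1)), then the sum of their
  squares is at most 1/4, and the bump is at least exp (-1 / (3/4)). *)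
Definition bump_floor : R := expR (- (4 / 3)).

Lemma bump_in z : `|z| <= (2 * n.+1%:R)^-1 -> bump_floor <= bump 1 z.
Proof.
move=> zr.
have zS : sqn z <= 4^-1.
  apply: (@le_trans _ _ (\sum_(i < n) (2 * n.+1%:R)^-1 ^+ 2)).
    apply: ler_sum => i _; rewrite -[leLHS]real_normK ?num_real//.
    by rewrite ler_pXn2r ?nnegrE// (le_trans (normr_coord _ _)).
  rewrite sumr_const card_ord -[leLHS]mulr_natr exprVn exprMn invfM -mulrA.
  have -> : (2%:R ^+ 2 : R)^-1 = 4^-1 by rewrite -natrX.
  rewrite ler_piMr// expr2 invfM -mulrA mulr_ile1//.
  - by rewrite invf_le1// ler1n.
  - by rewrite mulrC ler_pdivrMr// mul1r ler_nat.
rewrite /bump /flat ifT; last by rewrite subr_gt0 (le_lt_trans zS)// invf_lt1// ltr1n.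
rewrite hornerC mul1r ler_expR lerN2 -[leRHS]invrK lef_pV2 ?posrE//; first lra.
by rewrite subr_gt0; lra.
Qed.

End radial_bump.

Section mollifier.
Context (R : realType) (n : nat).
Implicit Types (x y z v : 'rV[R]_n) (f g : 'rV[R]_n -> R) (e r : R).

Notation e_ i := (delta_mx 0 i : 'rV[R]_n).
Notation leb := (leb R n).

Lemma pderivs_zero (s : seq 'I_n) : pderivs s (cst 0 : 'rV[R]_n -> R) = cst 0.
Proof. by elim: s => //= i s ->; apply/funext => x; rewrite /pderiv derive_cst. Qed.

Lemma open_norm_gt r : open [set z : 'rV[R]_n | r < `|z|].
Proof.
rewrite (_ : [set z | _] = (fun z : 'rV[R]_n => `|z|) @^-1` [set t | r < t])//.
by apply: open_comp => [z _|]; [exact: norm_continuous|exact: open_gt].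
Qed.

Lemma pderivs_out s f r : (forall z, r < `|z| -> f z = 0) ->
  forall z, r < `|z| -> pderivs s f z = 0.
Proof.
move=> f0 z rz; have -> : pderivs s f z = pderivs s (cst 0) z.
  exact: (@eq_pderivs R n [set y : 'rV[R]_n | r < `|y|] s f (cst 0) (@open_norm_gt r) f0 z rz).
by rewrite pderivs_zero.
Qed.

Lemma bounded_compact_support f r : continuous f -> (forall z, r < `|z| -> f z = 0) ->
  exists2 M : R, 0 <= M & forall z, `|f z| <= M.
Proof.
move=> cf f0.
have cK : compact [set z : 'rV[R]_n | `|z| <= r].
  apply: bounded_closed_compact.
    by exists r; split; [exact: num_real|move=> M rM z /= /le_trans; apply; exact: ltW].
  rewrite (_ : [set z | _] = ~` [set z | r < `|z|]); last first.
    by apply/seteqP; split=> z /=; [move=> zr; rewrite ltNge zr|move/negP; rewrite -leNgt].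
  by rewrite closedC; exact: open_norm_gt.
have /compact_bounded [M [_ HM]] := continuous_compact (continuous_subspaceT cf) cK.
exists (`|M| + 1) => [|z]; first by rewrite addr_ge0.
have [zr|/f0 ->] := leP `|z| r; last by rewrite normr0 addr_ge0.
by apply: HM; [rewrite (le_lt_trans (ler_norm _))// ltrDl|exists z].
Qed.

Lemma is_derive_scale f a z v (df : R) : is_derive (a *: z) v f df ->
  is_derive z v (fun y => f (a *: y)) (a * df).
Proof.
move=> /is_derive_lineP D; apply/is_derive_lineP.
have -> : (fun h : R => f (a *: (h *: v + z))) =
    (fun k : R => f (k *: v + a *: z)) \o (fun h : R => a * h).
  by apply/funext => h /=; rewrite scalerDr scalerA.
have Dm : is_derive (0 : R) (1 : R) (fun h : R => a * h) a.
  have -> : (fun h : R => a * h) = a \*: (id : R -> R) by apply/funext.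
  by apply: is_derive_eq; rewrite /GRing.scale/= mulr1.
rewrite mulrC; apply: (is_derive1_comp (f := fun k : R => f (k *: v + a *: z))).
by rewrite mulr0.
Qed.

Lemma continuous_scale f a : continuous f -> continuous (fun y : 'rV[R]_n => f (a *: y)).
Proof.
move=> cf z; apply: (@continuous_comp _ _ _ (fun y : 'rV[R]_n => a *: y) f); last exact: cf.
exact: scaler_continuous.
Qed.

Lemma pderiv_scale f a i : (forall x, derivable f x (e_ i)) ->
  pderiv i (fun y => f (a *: y)) = a *: (fun y => pderiv i f (a *: y)).
Proof.
move=> df; apply/funext => z.
have D : is_derive (a *: z) (e_ i) f (pderiv i f (a *: z)) by split.
by have [_] := is_derive_scale D.
Qed.

Lemma Ck_scale k f a : Ck k setT f -> Ck k setT (fun y => f (a *: y)).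
Proof.
elim: k f => [|k IH] f.
  move=> /Ck0P cf; apply/Ck0P => z _; apply: (@continuous_scale f a) => y; exact: cf.
move=> /CkS[df cf Cf]; apply/CkS; split=> [i x _|x _|i].
- have D : is_derive (a *: x) (e_ i) f (pderiv i f (a *: x)) by split=> //; exact: df.
  by have [] := is_derive_scale D.
- by apply: (@continuous_scale f a) => y; exact: cf.
- rewrite pderiv_scale; last by move=> x; exact: df.
  by apply: CkZ; [exact: openT|apply: IH; exact: Cf].
Qed.

Lemma pderivs_scale s f a : Ck (size s) setT f ->
  forall z, pderivs s (fun y => f (a *: y)) z = a ^+ size s * pderivs s f (a *: z).
Proof.
have oT : open [set: 'rV[R]_n] by exact: openT.
elim/last_ind: s f => [|s i IH] f; first by move=> _ z; rewrite expr0 mul1r.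
rewrite size_rcons !pderivs_rcons => /CkS[df cf Cf] z.
rewrite pderiv_scale; last by move=> x; exact: df.
rewrite (CkZ_pderivs a oT)//; last by apply: Ck_scale; exact: Cf.
by rewrite IH// exprS mulrA.
Qed.

Definition smooth f := forall k, Ck k setT f.

Lemma smooth_continuous f s : smooth f -> continuous (pderivs s f).
Proof. by move=> sf z; exact: (sf (size s)).2. Qed.

Lemma smooth_measurable f s : smooth f -> measurable_fun setT (pderivs s f).
Proof. by move=> sf; apply: continuous_measurable_fun_rV; exact: smooth_continuous. Qed.

Lemma measurable_bump_scaled e :
  measurable_fun setT (fun z : 'rV[R]_n => bump 1 (e^-1 *: z)).
Proof.
apply: continuous_measurable_fun_rV; apply: continuous_scale.
exact: continuous_bump.
Qed.

Lemma integral_bounded_support f r t (M : R) : measurable_fun setT f ->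
  (forall z, `|f z| <= M) -> (forall z, r < `|z| -> f z = 0) -> 0 < t -> r < t ->
  (\int[leb]_z `|(f z)%:E| <= (M * (t *+ 2) ^+ n)%:E)%E.
Proof.
move=> mf fM f0 t0 rt.
have M0 : 0 <= M by exact: le_trans (fM 0).
have mb : measurable (ball (0 : 'rV[R]_n) t) by apply: open_measurable_rV; exact: ball_open.
have -> : (M * (t *+ 2) ^+ n)%:E = (\int[leb]_(z in ball (0%R : 'rV[R]_n) t) (cst M%:E) z)%E.
  rewrite integral_cst// EFinM; congr (_ * _)%E; apply/esym; exact: leb_ball.
rewrite [leRHS]integral_mkcond; apply: ge0_le_integral => //.
- by apply: measurableT_comp => //; exact/measurable_EFinP.
- by apply/(measurable_restrictT _ _).1.
- move=> z _; rewrite patchE; case: ifPn => [_|]; first by rewrite lee_fin.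
  rewrite notin_setE -ball_normE /= sub0r normrN => /negP; rewrite -leNgt => tz.
  by rewrite f0 ?normr0// (lt_le_trans rt).
Qed.

Lemma integrable_bounded_support f r (M : R) : measurable_fun setT f ->
  (forall z, `|f z| <= M) -> (forall z, r < `|z| -> f z = 0) ->
  leb.-integrable setT (EFin \o f).
Proof.
move=> mf fM f0; apply/integrableP; split; first exact/measurable_EFinP.
apply: le_lt_trans (integral_bounded_support mf fM f0 (t := `|r| + 1) _ _) _.
- by rewrite ltr_pwDr.
- by rewrite (le_lt_trans (ler_norm _))// ltrDl.
- by rewrite ltry.
Qed.

Definition bump_mass e : R := \int[leb]_z bump 1 (e^-1 *: z).

Definition moll e z : R := (bump_mass e)^-1 * bump 1 (e^-1 *: z).

Lemma bump_scaled_out e z : 0 < e -> e <= `|z| -> bump 1 (e^-1 *: z) = 0.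
Proof.
move=> e0 ez; apply: bump_out; rewrite normrZ gtr0_norm ?invr_gt0//.
by rewrite ler_pdivlMl// mulr1.
Qed.

Lemma bump_bounded s : exists2 M : R, 0 <= M & forall z, `|pderivs s (bump (n := n) 1) z| <= M.
Proof.
apply: (@bounded_compact_support _ 1); first by apply: smooth_continuous => k; exact: Ck_bump.
by apply: pderivs_out => z z1; rewrite bump_out// ltW.
Qed.

Lemma integrable_bump e : 0 < e ->
  leb.-integrable setT (EFin \o (fun z => bump 1 (e^-1 *: z))).
Proof.
move=> e0; have [M M0 MP] := bump_bounded [::].
apply: (@integrable_bounded_support _ e M); first exact: measurable_bump_scaled.
  by move=> z; exact: MP.
by move=> z /ltW ez; exact: bump_scaled_out.
Qed.

(** Only the cube where the scaled bump exceeds [bump_floor] is counted; what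
  matters is that the mass is of order [e ^+ n]. *)
Lemma bump_mass_ge e : 0 < e ->
  bump_floor R * ((e / (2 * n.+1%:R)) *+ 2) ^+ n <= bump_mass e.
Proof.
move=> e0; set t := e / _.
have t0 : 0 < t by rewrite divr_gt0// mulr_gt0.
have mb : measurable (ball (0 : 'rV[R]_n) t) by apply: open_measurable_rV; exact: ball_open.
have c0 : 0 <= bump_floor R by exact: expR_ge0.
rewrite -lee_fin /bump_mass fineK; last first.
  by apply: integrable_fin_num => //; exact: integrable_bump.
have -> : (bump_floor R * (t *+ 2) ^+ n)%:E =
    (\int[leb]_(z in ball (0%R : 'rV[R]_n) t) (cst (bump_floor R)%:E) z)%E.
  rewrite integral_cst// EFinM; congr (_ * _)%E; apply/esym; exact: leb_ball.
rewrite [leLHS]integral_mkcond; apply: ge0_le_integral => //.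
- by move=> z _; rewrite patchE; case: ifP => // _; rewrite lee_fin.
- by apply/(measurable_restrictT _ _).1.
- by apply/measurable_EFinP; exact: measurable_bump_scaled.
- move=> z _; rewrite patchE; case: ifPn => [|_]; last by rewrite lee_fin bump_ge0.
  rewrite inE -ball_normE /= sub0r normrN => zt; rewrite lee_fin bump_in//.
  by rewrite normrZ gtr0_norm ?invr_gt0// ler_pdivrMl// ltW.
Qed.

Lemma bump_mass_gt0 e : 0 < e -> 0 < bump_mass e.
Proof.
move=> e0; apply: lt_le_trans (bump_mass_ge e0).
by rewrite mulr_gt0 ?expR_gt0// exprn_gt0// mulrn_wgt0// divr_gt0// mulr_gt0.
Qed.

Lemma moll_smooth e : smooth (moll e).
Proof.
move=> k; apply: (@CkZ R n k setT (bump_mass e)^-1); first exact: openT.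
exact/Ck_scale/Ck_bump.
Qed.

Lemma pderivs_moll s e z :
  pderivs s (moll e) z = (bump_mass e)^-1 * (e^-1 ^+ size s * pderivs s (bump 1) (e^-1 *: z)).
Proof.
rewrite -pderivs_scale; last exact: Ck_bump.
rewrite -(@CkZ_pderivs R n s setT)//; first exact: openT.
exact/Ck_scale/Ck_bump.
Qed.

Lemma moll_out s e z : 0 < e -> e < `|z| -> pderivs s (moll e) z = 0.
Proof.
move=> e0; apply: pderivs_out => {}z /ltW ez.
by rewrite /moll bump_scaled_out ?mulr0.
Qed.

Lemma moll0_out e z : 0 < e -> e <= `|z| -> moll e z = 0.
Proof. by move=> e0 ez; rewrite /moll bump_scaled_out ?mulr0. Qed.

Lemma moll_ge0 e z : 0 < e -> 0 <= moll e z.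
Proof. by move=> e0; rewrite mulr_ge0 ?bump_ge0// invr_ge0 ltW// bump_mass_gt0. Qed.

Lemma mollN e z : moll e (- z) = moll e z.
Proof. by rewrite /moll scalerN bumpN. Qed.

Lemma moll_bounded s e : 0 < e -> exists2 M : R, 0 <= M & forall z, `|pderivs s (moll e) z| <= M.
Proof.
move=> e0; apply: (@bounded_compact_support _ e).
  by apply: smooth_continuous; exact: moll_smooth.
by move=> z; exact: moll_out.
Qed.

Lemma integral_moll e : 0 < e -> (\int[leb]_z (moll e z)%:E = 1)%E.
Proof.
move=> e0; rewrite /moll; under eq_integral do rewrite EFinM.
rewrite integralZl//; last exact: integrable_bump.
rewrite -[X in (_ * X)%E]fineK; last first.
  by apply: integrable_fin_num => //; exact: integrable_bump.
by rewrite -EFinM mulVf// gt_eqF// bump_mass_gt0.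
Qed.

(** Each derivative costs a factor [e^-1], whereas the volume of the support and
  the mass by which the bump is normalized are both of order [e ^+ n]. *)
Lemma integral_pderivs_moll s : exists2 C : R, 0 <= C &
  forall e, 0 < e -> (\int[leb]_z `|(pderivs s (moll e) z)%:E| <= (C * e^-1 ^+ size s)%:E)%E.
Proof.
have [M M0 MP] := bump_bounded s.
pose D : R := M * (4 * n.+1%:R) ^+ n / bump_floor R.
have c0 : 0 < bump_floor R by exact: expR_gt0.
exists D => [|e e0]; first by rewrite divr_ge0 ?(ltW c0)// mulr_ge0.
pose N : R := (bump_mass e)^-1 * (e^-1 ^+ size s * M).
have I0 := bump_mass_gt0 e0.
have le_N z : `|pderivs s (moll e) z| <= N.
  rewrite pderivs_moll !normrM gtr0_norm ?invr_gt0// ler_pM2l ?invr_gt0//.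
  by rewrite normrX gtr0_norm ?invr_gt0// ler_pM2l// exprn_gt0// invr_gt0.
apply: le_trans (integral_bounded_support _ le_N (fun z => @moll_out s e z e0) (t := e *+ 2) _ _) _.
- by apply: smooth_measurable; exact: moll_smooth.
- by rewrite mulrn_wgt0.
- by rewrite mulr2n ltrDl.
rewrite lee_fin /N /D -!mulrA mulrC.
rewrite [leRHS](_ : _ = e^-1 ^+ size s * M * ((4 * n.+1%:R) ^+ n / bump_floor R)); last by ring.
rewrite [leLHS](_ : _ = e^-1 ^+ size s * M * ((e *+ 2 *+ 2) ^+ n / bump_mass e)); last by ring.
rewrite ler_wpM2l// ?mulr_ge0// ?exprn_ge0// ?invr_ge0 ?(ltW e0)//.
rewrite ler_pdivrMr// mulrAC ler_pdivlMr//.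
apply: le_trans (ler_wpM2l _ (bump_mass_ge e0)); last by rewrite exprn_ge0.
rewrite mulrCA -exprMn [leLHS]mulrC ler_pM2l//.
rewrite le_eqVlt; apply/orP; left; apply/eqP; congr (_ ^+ _).
by field.
Qed.

End mollifier.

(** * Convolution with a smooth kernel *)
Section convolution.
Context (R : realType) (n : nat).
Implicit Types (x y z v : 'rV[R]_n) (f g K u : 'rV[R]_n -> R) (e r : R).

Notation e_ i := (delta_mx 0 i : 'rV[R]_n).
Notation leb := (leb R n).

Definition conv K u x : R := \int[leb]_y (K (x - y) * u y).

(** Bounds on all derivatives suffice to differentiate under the integral, and
  the class is stable under differentiation. *)
Definition bsmooth K := smooth K /\
  forall s, exists2 M : R, 0 <= M & forall z, `|pderivs s K z| <= M.

Lemma bsmooth_moll e : 0 < e -> bsmooth (moll e).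
Proof. by move=> e0; split=> [|s]; [exact: moll_smooth|exact: moll_bounded]. Qed.

Lemma bsmooth_pderiv i K : bsmooth K -> bsmooth (pderiv i K).
Proof.
move=> [sK bK]; split=> [k|s]; first by have [_ _] := (CkS _ _ _).1 (sK k.+1).
by rewrite -pderivs_rcons; exact: bK.
Qed.

Lemma bsmooth_pderivs s K : bsmooth K -> bsmooth (pderivs s K).
Proof. by move=> bK; elim: s => //= i s IH; exact: bsmooth_pderiv. Qed.

Lemma bsmooth_derivable K i x : bsmooth K -> derivable K x (e_ i).
Proof. by move=> [sK _]; have [dK _ _] := (CkS _ _ _).1 (sK 1%N); exact: dK. Qed.

Lemma bsmooth_lipschitz K : bsmooth K ->
  exists2 M : R, 0 <= M & forall x y, `|K x - K y| <= M * `|x - y|.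
Proof.
move=> bK.
have [M HM] := choice (fun i : 'I_n => let: ex_intro2 M M0 MP := bK.2 [:: i] in
  ex_intro (fun M : R => 0 <= M /\ forall z, `|pderivs [:: i] K z| <= M) M (conj M0 MP)).
pose N := \sum_i M i.
have MN i : M i <= N.
  by rewrite /N (bigD1 i)//= lerDl sumr_ge0// => j _; have [] := HM j.
have N0 : 0 <= N by apply: sumr_ge0 => j _; have [] := HM j.
exists (n%:R * N) => [|x y]; first by rewrite mulr_ge0.
apply: lipschitz_pderiv => [i z|i z]; first exact: bsmooth_derivable.
by have [_ /(_ z) h] := HM i; exact: le_trans h (MN i).
Qed.

Lemma measurable_reflect K x : continuous K -> measurable_fun setT (fun y => K (x - y)).
Proof.
move=> cK; apply: continuous_measurable_fun_rV => y.
apply: (@continuous_comp _ _ _ (fun y => x - y) K); last exact: cK.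
by apply: continuousB; [exact: cst_continuous|].
Qed.

Lemma conv_integrable K u x : continuous K -> (exists M : R, forall z, `|K z| <= M) ->
  leb.-integrable setT (EFin \o u) ->
  leb.-integrable setT (EFin \o (fun y => K (x - y) * u y)).
Proof.
move=> cK [M KM] iu; have mu_ : measurable_fun setT u.
  by apply/measurable_EFinP; case/integrableP: iu.
apply: (@le_integrable _ _ _ _ _ _ _ (fun y => (M * u y)%:E)) => //.
- by apply/measurable_EFinP; apply: measurable_funM => //; exact: measurable_reflect.
- move=> y _; rewrite lee_fin !normrM ler_wpM2r//.
  exact: le_trans (KM _) (ler_norm _).
- exact: integrable_realZ.
Qed.

Lemma bsmooth_conv_integrable K u x : bsmooth K ->
  leb.-integrable setT (EFin \o u) ->
  leb.-integrable setT (EFin \o (fun y => K (x - y) * u y)).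
Proof.
move=> [sK bK] iu; apply: conv_integrable => //; first exact: (@smooth_continuous _ _ K [::]).
by have [M _ MP] := bK [::]; exists M.
Qed.

Lemma le_int_bound (h u : 'rV[R]_n -> R) (M : R) : leb.-integrable setT (EFin \o u) ->
  leb.-integrable setT (EFin \o h) -> (forall y, `|h y| <= M * `|u y|) ->
  `|\int[leb]_y h y| <= M * \int[leb]_y `|u y|.
Proof.
move=> iu ih hM; have iau := integrable_norm iu.
rewrite -RintegralZl//; apply: le_trans (le_normr_Rintegral _ ih) _ => //.
apply: le_Rintegral => //; first exact: integrable_norm.
exact: integrable_realZ.
Qed.

Lemma lipschitz_continuous_rV f (M : R) : 0 <= M ->
  (forall x y, `|f x - f y| <= M * `|x - y|) -> continuous f.
Proof.
move=> M0 lip x; suff : f @ nbhs (x : 'rV[R]_n) --> f x by [].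
apply/cvgrPdist_le => e e0.
have M1 : 0 < M + 1 by rewrite ltr_pwDr.
apply/nbhs_ballP; exists (e / (M + 1)) => [|y]; first by rewrite /= divr_gt0.
rewrite -ball_normE /= ltr_pdivlMr// => /ltW h.
apply: le_trans (lip x y) _; apply: le_trans h.
by rewrite mulrC ler_wpM2l// lerDl.
Qed.

Lemma continuous_conv K u : bsmooth K -> leb.-integrable setT (EFin \o u) ->
  continuous (conv K u).
Proof.
move=> bK iu; have [M M0 MP] := bsmooth_lipschitz bK.
pose I := \int[leb]_y `|u y|.
have I0 : 0 <= I by apply: Rintegral_ge0.
have lip x y : `|conv K u x - conv K u y| <= M * I * `|x - y|.
  rewrite /conv -RintegralB//; [|exact: bsmooth_conv_integrable..].
  rewrite mulrAC; apply: le_int_bound => //.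
    apply: integrable_realB => //; exact: bsmooth_conv_integrable.
  move=> z; rewrite -mulrBl normrM ler_wpM2r//.
  by apply: le_trans (MP _ _) _; rewrite opprB addrA subrK.
exact: (lipschitz_continuous_rV (mulr_ge0 M0 I0) lip).
Qed.

(** By the mean value theorem, the difference quotient of the kernel in the
  direction [i] is uniformly close to the derivative, which is Lipschitz. *)
Lemma is_derive_conv K u i x : bsmooth K -> leb.-integrable setT (EFin \o u) ->
  is_derive x (e_ i) (conv K u) (conv (pderiv i K) u x).
Proof.
move=> bK iu; have [M M0 MP] := bsmooth_lipschitz (bsmooth_pderiv i bK).
pose I := \int[leb]_y `|u y|.
have I0 : 0 <= I by apply: Rintegral_ge0.
have bdK := bsmooth_pderiv i bK.
have E (t : R) : t != 0 ->
    `|conv (pderiv i K) u x - t^-1 *: (conv K u (t *: e_ i + x) - conv K u x)| <= M * I * `|t|.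
  move=> t0; rewrite /conv -RintegralB//; [|exact: bsmooth_conv_integrable..].
  have iD : leb.-integrable setT (EFin \o (fun y => K (t *: e_ i + x - y) * u y - K (x - y) * u y)).
    by apply: integrable_realB => //; exact: bsmooth_conv_integrable.
  have iDt : leb.-integrable setT (EFin \o (fun y => t^-1 * (K (t *: e_ i + x - y) * u y - K (x - y) * u y))).
    exact: integrable_realZ.
  rewrite [X in _ - X](_ : _ = \int[leb]_y (t^-1 * (K (t *: e_ i + x - y) * u y - K (x - y) * u y))); last first.
    by rewrite RintegralZl.
  rewrite -RintegralB//; last exact: bsmooth_conv_integrable.
  rewrite mulrAC; apply: le_int_bound => //.
    by apply: integrable_realB => //; exact: bsmooth_conv_integrable.
  move=> y; set z := x - y.
  have -> : t *: e_ i + x - y = t *: e_ i + z by rewrite addrA.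
  have [//|w _|c ct cE] := @MVT_line _ _ setT K i z t.
    exact: bsmooth_derivable.
  rewrite -mulrBl cE mulrA mulrA mulVf// mul1r -mulrBl normrM ler_wpM2r//.
  apply: le_trans (MP _ _) _; rewrite ler_wpM2l// opprD addrCA subrr addr0 normrN normrZ.
  apply: le_trans ct; rewrite ler_piMr// [leLHS]/Num.norm/= mx_normrE.
  apply: bigmax_le => // -[p q] _ /=; rewrite mxE.
  by case: (_ && _); rewrite ?normr1 ?normr0.
suff H : (fun h : R => h^-1 *: ((conv K u \o shift x) (h *: e_ i) - conv K u x)) @ 0^'
    --> conv (pderiv i K) u x.
  by split; [apply/cvg_ex; eexists; exact: H|exact/cvg_lim].
apply/cvgrPdist_le => e e0.
have MI1 : 0 < M * I + 1 by rewrite ltr_pwDr// mulr_ge0.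
have eC : 0 < e / (M * I + 1) by rewrite divr_gt0.
near=> t.
have t0 : t != 0 by near: t; exact: nbhs_dnbhs_neq.
apply: le_trans (E t t0) _.
have : `|t| <= e / (M * I + 1) by near: t; exact: dnbhs0_le.
rewrite ler_pdivlMr// => h; apply: le_trans h.
by rewrite mulrC ler_wpM2l// lerDl.
Unshelve. all: by end_near. Qed.

Lemma pderiv_conv K u i : bsmooth K -> leb.-integrable setT (EFin \o u) ->
  pderiv i (conv K u) = conv (pderiv i K) u.
Proof.
by move=> bK iu; apply/funext => x; have [_] := is_derive_conv i x bK iu.
Qed.

Lemma pderivs_conv s K u : bsmooth K -> leb.-integrable setT (EFin \o u) ->
  pderivs s (conv K u) = conv (pderivs s K) u.
Proof.
move=> bK iu; elim/last_ind: s K bK => // s i IH K bK.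
by rewrite !pderivs_rcons pderiv_conv// IH//; exact: bsmooth_pderiv.
Qed.

Lemma smooth_conv K u : bsmooth K -> leb.-integrable setT (EFin \o u) ->
  smooth (conv K u).
Proof.
move=> bK iu k; elim: k K bK => [|k IH] K bK.
  by apply/Ck0P => x _; exact: continuous_conv.
apply/CkS; split=> [i x _|x _|i].
- by have [] := is_derive_conv i x bK iu.
- exact: continuous_conv.
- by rewrite pderiv_conv//; apply: IH; exact: bsmooth_pderiv.
Qed.

End convolution.

(** * Density in L^2, and points far from the boundary *)
Section l2_density.
Context d (T : measurableType d) (R : realType) (mu : {measure set T -> \bar R}).
Implicit Types (u v : T -> R) (A : set T).

Lemma l2n_dct (u_ : (T -> R)^nat) u v : (forall k, measurable_fun setT (u_ k)) ->
  measurable_fun setT u -> sqint mu v -> (forall k x, `|u_ k x - u x| <= `|v x|) ->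
  (forall x, u_ ^~ x @ \oo --> u x) ->
  forall e : R, 0 < e -> exists N, forall k, (N <= k)%N -> l2n mu (u_ k - u) <= e.
Proof.
move=> mu_ mu0 sv uv cu e e0.
have sd k : sqint mu (u_ k - u).
  apply: (sqint_le _ sv _).1; first exact: measurable_funB.
  by apply: nearW => x; exact: uv.
have [|||||_ _ H] := @dominated_convergence _ _ _ mu _ measurableT
  (fun k x => ((u_ k x - u x) ^+ 2)%:E) (cst 0%E) (fun x => (v x ^+ 2)%:E).
- move=> k; apply/measurable_EFinP; apply: measurable_funX.
  exact: measurable_funB.
- exact: measurable_cst.
- apply: nearW => x _; apply/cvg_EFin; first exact: nearW.
  have c0 : (fun k => u_ k x - u x) @ \oo --> 0.
    by rewrite -(subrr (u x)); apply: cvgB; [exact: cu|exact: cvg_cst].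
  have := cvgM c0 c0; rewrite mul0r.
  rewrite (_ : _ \* _ = fine \o (fun k => ((u_ k x - u x) ^+ 2)%:E))//; exact.
- exact: sqint_integrable.
- apply: nearW => x k _; rewrite lee_fin ger0_norm ?sqr_ge0//.
  by rewrite -ler_sqrt ?sqr_ge0// !sqrtr_sqr.
have e2 : (0 < e ^+ 2)%R by rewrite exprn_gt0.
move: H; rewrite integral0_eq// => /fine_cvgP[_].
move=> /cvgrPdist_le/(_ _ e2)[N _ HN]; exists N => k /HN /=.
rewrite sub0r normrN.
rewrite (_ : fine _ = l2n mu (u_ k - u) ^+ 2); last by rewrite l2n_sqr.
rewrite ger0_norm ?sqr_ge0//.
by rewrite ler_pXn2r ?nnegrE// ltW.
Qed.

Lemma indic_sqint A : measurable A -> (mu A < +oo)%E -> sqint mu \1_A.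
Proof.
move=> mA fA; apply: sqint_intro; first exact: measurable_indic.
rewrite (_ : (fun x => _) = EFin \o \1_A); last first.
  by apply/funext => x /=; rewrite indicE; case: (_ \in _); rewrite ?expr1n ?expr0n.
by rewrite integral_indic// setIT.
Qed.

Lemma l2n_indic A : measurable A -> (mu A < +oo)%E -> (l2n mu \1_A ^+ 2)%:E = mu A.
Proof.
move=> mA fA; rewrite -sqint_ge0_fin; last exact: indic_sqint.
rewrite (_ : (fun x => _) = EFin \o \1_A); last first.
  by apply/funext => x /=; rewrite indicE; case: (_ \in _); rewrite ?expr1n ?expr0n.
by rewrite integral_indic// setIT.
Qed.

Import HBNNSimple.

(** Induction principle for L^2: indicator functions, then simple functions, then
  limits of increasing sequences of simple functions. *)
Lemma sqint_ind (D : set T) (P : (T -> R) -> Prop) :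
  (forall (a : R) u, P u -> P (a *: u)) -> (forall u v, P u -> P v -> P (u + v)) ->
  (forall u, sqint mu u -> (forall x, ~ D x -> u x = 0) ->
     (forall e : R, 0 < e -> exists v, [/\ P v, sqint mu v & l2n mu (u - v) <= e]) -> P u) ->
  (forall A, measurable A -> A `<=` D -> P \1_A) -> (mu D < +oo)%E -> measurable D ->
  forall u, sqint mu u -> (forall x, ~ D x -> u x = 0) -> P u.
Proof.
move=> PZ PD Plim Pind muD mD.
have P0 : P 0 by rewrite -(scale0r (\1_set0 : T -> R)); apply: PZ; apply: Pind.
suff pos u : sqint mu u -> (forall x, ~ D x -> u x = 0) -> (forall x, 0 <= u x) -> P u.
  move=> u su uD.
  have mu0 := sqint_measurable su.
  have -> : u = u^\+ + -1 *: u^\-.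
    by apply/funext => x; rewrite -[in LHS](funrposBneg u) scaleN1r.
  apply: PD; last apply: PZ; apply: pos.
  - apply: (sqint_le (measurable_funrpos mu0) su _).1; apply: nearW => x.
    rewrite (ger0_norm (funrpos_ge0 _ _)) -[leRHS]/((Num.norm \o u) x) -funrposDneg.
    by rewrite lerDl funrneg_ge0.
  - by move=> x /uD ux; rewrite /funrpos ux maxxx.
  - exact: funrpos_ge0.
  - apply: (sqint_le (measurable_funrneg mu0) su _).1; apply: nearW => x.
    rewrite (ger0_norm (funrneg_ge0 _ _)) -[leRHS]/((Num.norm \o u) x) -funrposDneg.
    by rewrite lerDr funrpos_ge0.
  - by move=> x /uD ux; rewrite /funrneg ux oppr0 maxxx.
  - exact: funrneg_ge0.
move=> su uD u0.
have mu0 : measurable_fun setT (EFin \o u) by apply/measurable_EFinP; exact: sqint_measurable su.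
pose g k := nnsfun_approx measurableT mu0 k.
have g_le k x : g k x <= u x.
  rewrite -lee_fin /g nnsfun_approxE; apply: (@le_approx _ _ _ setT (EFin \o u)) => //.
  by move=> y _; rewrite lee_fin.
have g_cvg x : (fun k => g k x) @ \oo --> u x.
  have : EFin \o (fun k => g k x) @ \oo --> (EFin \o u) x.
    by apply: cvg_nnsfun_approx => // y _; rewrite lee_fin.
  by move/fine_cvgP => [].
have g0 k x : 0 <= g k x by [].
have gD k x : ~ D x -> g k x = 0.
  by move=> /uD ux; apply/eqP; rewrite eq_le g0 andbT -ux.
have sg k : sqint mu (g k).
  by apply: (sqint_le _ su _).1 => //; apply: nearW => x; rewrite !ger0_norm.
have Pg k : P (g k).
  have [m [a gE]] : exists m (a : 'I_m -> R), forall x,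
      g k x = \sum_(i < m) a i * \1_(g k @^-1` [set a i]) x.
    by eexists; eexists; exact: fimfunEord.
  have -> : (g k : T -> R) = \sum_(i < m) (a i *: \1_(g k @^-1` [set a i]) : T -> R).
    by apply/funext => x; rewrite gE fct_sumE.
  elim/big_ind : _ => // i _.
  have [->|a0] := eqVneq (a i) 0; first by rewrite scale0r.
  apply: PZ; apply: Pind => // x /= gxa; apply: contrapT => /(gD k).
  by move/eqP; rewrite gxa (negbTE a0).
apply: Plim => // e e0.
have [||||N HN] := @l2n_dct g u u _ _ su _ _ e e0.
- by [].
- exact: sqint_measurable su.
- move=> k x; rewrite distrC !ger0_norm// ?subr_ge0//.
  by rewrite lerBlDr lerDl.
- exact: g_cvg.
exists (g N); split=> //.
by rewrite -l2nN opprB; exact: HN.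
Qed.

End l2_density.

Section mollification.
Context (R : realType) (n : nat).
Implicit Types (x y z v : 'rV[R]_n) (f g K u : 'rV[R]_n -> R) (e r : R).
Implicit Types (U Omega : set 'rV[R]_n).

Notation leb := (leb R n).

Lemma leb_bounded_lty U : bounded_set U -> measurable U -> (leb U < +oo)%E.
Proof.
move=> [M [_ HM]] mU.
have r0 : 0 < `|M| + 2 by rewrite ltr_wpDl.
apply: (@le_lt_trans _ _ (leb (ball (0%R : 'rV[R]_n) (`|M| + 2)))).
  apply: le_measure; rewrite ?inE//; first by apply: open_measurable_rV; exact: ball_open.
  move=> x Ux; rewrite -ball_normE /= sub0r normrN.
  apply: le_lt_trans (HM (`|M| + 1) _ x Ux) _; last by rewrite ltrD2l ltr1n.
  by rewrite (le_lt_trans (ler_norm _))// ltrDl.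
rewrite [X in (X < _)%E](_ : _ = (((`|M| + 2) *+ 2) ^+ n)%:E) ?ltry//.
exact: leb_ball.
Qed.

Lemma sqint_integrable1 U u : measurable U -> (leb U < +oo)%E ->
  sqint leb u -> (forall x, ~ U x -> u x = 0) -> leb.-integrable setT (EFin \o u).
Proof.
move=> mU fU su uU.
have iU : leb.-integrable setT (EFin \o \1_U).
  have := sqint_integrable (indic_sqint (mu := leb) mU fU).
  rewrite (_ : (fun x => \1_U x ^+ 2) = \1_U :> (_ -> R))//.
  by apply/funext => x; rewrite indicE; case: (_ \in _); rewrite ?expr1n ?expr0n.
have i2 := sqint_integrable su.
apply: (@le_integrable _ _ _ _ _ _ _ (EFin \o (fun x => \1_U x + u x ^+ 2))) => //.
- by apply/measurable_EFinP; exact: sqint_measurable su.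
- move=> x _; rewrite lee_fin (@ger0_norm _ (_ + _)); last by rewrite addr_ge0 ?sqr_ge0.
  rewrite indicE; have [Ux|nUx] := pselect (U x); last first.
    by rewrite uU// normr0 addr_ge0 ?sqr_ge0.
  rewrite mem_set// -[X in _ + X]real_normK ?num_real//.
  have [h|/ltW h] := leP `|u x| 1; first by rewrite (le_trans h)// lerDl sqr_ge0.
  by rewrite ler_wpDl// expr2 ler_peMr.
- exact: integrable_realD.
Qed.

(** The points at distance at least [r] from the complement, for the sup norm. *)
Definition inner U r : set 'rV[R]_n := [set x | ball x r `<=` U].

Lemma closed_inner U r : closed (inner U r).
Proof.
rewrite -(setCK (inner U r)); apply: open_closedC.
rewrite (_ : ~` _ = \bigcup_(y in ~` U) ball y r); last first.
  apply/seteqP; split=> x /=.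
    by move=> /existsNP[y] /not_implyP[xy nUy]; exists y => //; exact: ball_sym.
  by move=> [y nUy xy] /(_ _ (ball_sym xy)).
by apply: bigcup_open => y _; exact: ball_open.
Qed.

Lemma measurable_inner U r : measurable (inner U r).
Proof. by apply: closed_measurable_rV; exact: closed_inner. Qed.

Lemma inner_sub U r : 0 < r -> inner U r `<=` U.
Proof. by move=> r0 x; apply; exact: ballxx. Qed.

Lemma le_inner U r s : r <= s -> inner U s `<=` inner U r.
Proof. by move=> rs x xs y xy; apply: xs; exact: le_ball xy. Qed.

Lemma inner_exhaust U : open U -> \bigcup_k inner U k.+1%:R^-1 = U.
Proof.
move=> oU; apply/seteqP; split=> [x [k _]|x Ux].
  by apply: inner_sub; rewrite invr_gt0.
have /nbhs_ballP[e /= e0 xe] : nbhs x U by exact: open_nbhs_nbhs.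
exists (Num.truncn e^-1) => // y xy; apply: xe; apply: le_ball xy.
rewrite -[leRHS]invrK lef_pV2 ?posrE ?invr_gt0//.
exact/ltW/Num.Theory.truncnS_gt.
Qed.

Lemma leb_inner_cvg U : open U -> leb \o (fun k => inner U k.+1%:R^-1) @ \oo --> leb U.
Proof.
move=> oU; rewrite -{2}(inner_exhaust oU); apply: nondecreasing_cvg_mu.
- by move=> k; exact: measurable_inner.
- by rewrite inner_exhaust//; exact: open_measurable_rV.
- move=> k m km; apply/subsetPset; apply: le_inner.
  by rewrite lef_pV2 ?posrE// ler_nat.
Qed.

(** The sets [inner U r] exhaust the open set [U], which has finite measure. *)
Lemma leb_strip U (eps : R) : open U -> (leb U < +oo)%E -> 0 < eps ->
  exists2 r, 0 < r & (leb (U `\` inner U r) <= eps%:E)%E.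
Proof.
move=> oU fU e0; have := leb_inner_cvg oU.
have fin k : (leb (inner U k.+1%:R^-1) \is a fin_num)%E.
  rewrite ge0_fin_numE//; apply: le_lt_trans fU; apply: le_measure; rewrite ?inE.
  - exact: measurable_inner.
  - exact: open_measurable_rV.
  - by apply: inner_sub; rewrite invr_gt0.
have fUn : (leb U \is a fin_num)%E by rewrite ge0_fin_numE.
rewrite -(fineK fUn) => /fine_cvgP[_] /cvgrPdist_le/(_ _ e0)[N _ /(_ N (leqnn N))] /= h.
exists N.+1%:R^-1; first by rewrite invr_gt0.
rewrite measureD//=; last 2 first.
- exact: open_measurable_rV.
- exact: measurable_inner.
rewrite setIidr; last by apply: inner_sub; rewrite invr_gt0.
rewrite -(fineK (fin N)) -(fineK fUn) -EFinB lee_fin.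
exact: le_trans (ler_norm _) h.
Qed.

End mollification.

(** * Mollification in L^2 *)
Section mollification_l2.
Context (R : realType) (n : nat).
Implicit Types (x y z : 'rV[R]_n) (f g K u v : 'rV[R]_n -> R) (e r : R).
Implicit Types (U Omega : set 'rV[R]_n).

Notation leb := (leb R n).

Lemma moll_continuous e : continuous (moll (n := n) e).
Proof. exact: (@smooth_continuous _ _ _ [::] (@moll_smooth R n e)). Qed.

Lemma integral_moll_reflect e x : 0 < e -> (\int[leb]_y (moll e (x - y))%:E = 1)%E.
Proof.
move=> e0; rewrite -[RHS](integral_moll n e0).
rewrite -[RHS](@integral_leb_shift _ _ (- x) (fun y => (moll e y)%:E)).
  by apply: eq_integral => y _; rewrite /shift_rV -mollN opprB.
by apply/measurable_EFinP; apply: continuous_measurable_fun_rV; exact: moll_continuous.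
Qed.

Lemma integral_moll_shift e y : 0 < e -> (\int[leb]_x (moll e (x - y))%:E = 1)%E.
Proof.
move=> e0; rewrite -[RHS](integral_moll n e0).
rewrite -[RHS](@integral_leb_shift _ _ (- y) (fun y => (moll e y)%:E))//.
by apply/measurable_EFinP; apply: continuous_measurable_fun_rV; exact: moll_continuous.
Qed.

Lemma integrable_moll_reflect e x : 0 < e ->
  leb.-integrable setT (EFin \o (fun y => moll e (x - y))).
Proof.
move=> e0; apply/integrableP; split.
  by apply/measurable_EFinP; apply: measurable_reflect; exact: moll_continuous.
under eq_integral do rewrite /= ger0_norm ?moll_ge0//.
by rewrite integral_moll_reflect// ltry.
Qed.

(** Jensen's inequality for the probability density [y |-> moll e (x - y)]: expand
  the integral of [(u y - conv (moll e) u x) ^+ 2] against it. *)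
Lemma conv_sqr_le e u x : 0 < e -> leb.-integrable setT (EFin \o u) ->
  leb.-integrable setT (EFin \o (fun y => u y ^+ 2)) ->
  conv (moll e) u x ^+ 2 <= conv (moll e) (fun y => u y ^+ 2) x.
Proof.
move=> e0 iu iu2; set a := conv (moll e) u x.
have b0 := bsmooth_moll n e0.
have i1 := bsmooth_conv_integrable x b0 iu.
have i2 := bsmooth_conv_integrable x b0 iu2.
have i3 := integrable_moll_reflect x e0.
have : 0 <= \int[leb]_y (moll e (x - y) * u y ^+ 2 - (2 * a * (moll e (x - y) * u y) - a ^+ 2 * moll e (x - y))).
  apply: Rintegral_ge0 => y _.
  have -> : moll e (x - y) * u y ^+ 2 - (2 * a * (moll e (x - y) * u y) - a ^+ 2 * moll e (x - y)) =
     moll e (x - y) * (u y - a) ^+ 2 by move: (moll _ _) (u y) => *; ring.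
  by rewrite mulr_ge0 ?moll_ge0 ?sqr_ge0.
rewrite RintegralB//; last by apply: integrable_realB => //; exact: integrable_realZ.
rewrite RintegralB//; [|exact: integrable_realZ..].
rewrite (@RintegralZl _ _ _ leb setT (fun y => moll e (x - y) * u y))//.
rewrite (@RintegralZl _ _ _ leb setT (fun y => moll e (x - y)))//.
rewrite -/(conv (moll e) (fun y => u y ^+ 2) x) -/(conv (moll e) u x) -/a.
have -> : \int[leb]_y moll e (x - y) = 1.
  by rewrite /Rintegral integral_moll_reflect.
by rewrite mulr1 -mulrA -expr2 subr_ge0 mulr2n mulrDl mul1r addrK.
Qed.

Lemma measurable_sub_rV : measurable_fun [set: 'rV[R]_n * 'rV[R]_n] (fun p => p.1 - p.2).
Proof.
apply: measurable_fun_rVP => i; under eq_fun do rewrite !mxE.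
apply: measurable_funB.
  exact: (measurableT_comp (measurable_rV_coord i) measurable_fst).
exact: (measurableT_comp (measurable_rV_coord i) measurable_snd).
Qed.

(** Integrate the previous inequality in [x] and exchange the integrals. *)
Lemma conv_l2 e u : 0 < e -> leb.-integrable setT (EFin \o u) -> sqint leb u ->
  sqint leb (conv (moll e) u) /\ l2n leb (conv (moll e) u) <= l2n leb u.
Proof.
move=> e0 iu su; have b0 := bsmooth_moll n e0.
have iu2 := sqint_integrable su.
have mu0 := sqint_measurable su.
have mc : measurable_fun setT (conv (moll e) u).
  by apply: continuous_measurable_fun_rV; exact: continuous_conv.
have mm : measurable_fun setT (moll (n := n) e).
  by apply: continuous_measurable_fun_rV; exact: moll_continuous.
pose F (p : 'rV[R]_n * 'rV[R]_n) := (moll e (p.1 - p.2) * u p.2 ^+ 2)%:E.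
have mF : measurable_fun setT F.
  apply/measurable_EFinP; apply: measurable_funM.
    exact: (measurableT_comp mm measurable_sub_rV).
  by apply: measurable_funX; exact: measurableT_comp.
have F0 p : (0 <= F p)%E by rewrite lee_fin mulr_ge0 ?moll_ge0 ?sqr_ge0.
have le : (\int[leb]_x (conv (moll e) u x ^+ 2)%:E <= \int[leb]_x (u x ^+ 2)%:E)%E.
  apply: (@le_trans _ _ (\int[leb]_x \int[leb]_y F (x, y))%E).
    apply: ge0_le_integral => //.
    - by move=> x _; rewrite lee_fin sqr_ge0.
    - by apply/measurable_EFinP; exact: measurable_funX.
    - exact: (measurable_fun_fubini_tonelli_F (m2 := leb) F mF F0).
    - move=> x _; have := conv_sqr_le x e0 iu iu2; rewrite -lee_fin => /le_trans; apply.
      rewrite /conv fineK//; apply: integrable_fin_num => //.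
      exact: bsmooth_conv_integrable.
  rewrite (fubini_tonelli (m1 := leb) (m2 := leb) F mF F0); apply: ge0_le_integral => //.
  - by move=> x _; apply: integral_ge0.
  - exact: (measurable_fun_fubini_tonelli_G (m1 := leb) F mF F0).
  - by apply/measurable_EFinP; exact: measurable_funX.
  - move=> y _; rewrite /fubini_G /F/=; under eq_integral do rewrite EFinM.
    rewrite ge0_integralZr//; last 3 first.
    + apply/measurable_EFinP; apply: continuous_measurable_fun_rV => x.
      apply: (@continuous_comp _ _ _ (fun x => x - y) (moll e)); last exact: moll_continuous.
      by apply: continuousB => //; exact: cst_continuous.
    + by move=> x _; rewrite lee_fin moll_ge0.
    + by rewrite lee_fin sqr_ge0.
    by rewrite integral_moll_shift// mul1e.
have sc : sqint leb (conv (moll e) u).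
  by apply: sqint_intro => //; apply: le_lt_trans le _; rewrite sqint_ge0_fin// ltry.
split=> //; move: le; rewrite !sqint_ge0_fin// lee_fin.
by rewrite ler_pXn2r// nnegrE.
Qed.

Lemma convB K u v : bsmooth K -> leb.-integrable setT (EFin \o u) ->
  leb.-integrable setT (EFin \o v) -> conv K (u - v) = conv K u - conv K v.
Proof.
move=> bK iu iv; apply/funext => x; rewrite [RHS]/GRing.add/= /GRing.opp/= /conv.
rewrite -RintegralB//; [|exact: bsmooth_conv_integrable..].
by apply: eq_Rintegral => y _; rewrite -mulrBr.
Qed.

Lemma convD K u v : bsmooth K -> leb.-integrable setT (EFin \o u) ->
  leb.-integrable setT (EFin \o v) -> conv K (u + v) = conv K u + conv K v.
Proof.
move=> bK iu iv; apply/funext => x; rewrite [RHS]/GRing.add/= /conv.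
rewrite -RintegralD//; [|exact: bsmooth_conv_integrable..].
by apply: eq_Rintegral => y _; rewrite -mulrDr.
Qed.

Lemma convZ K (a : R) u : bsmooth K -> leb.-integrable setT (EFin \o u) ->
  conv K (a *: u) = a *: conv K u.
Proof.
move=> bK iu; apply/funext => x; rewrite [RHS]/GRing.scale/= /conv.
transitivity (\int[leb]_y (a * (K (x - y) * u y))).
  by apply: eq_Rintegral => y _; rewrite mulrCA.
by rewrite RintegralZl//; exact: bsmooth_conv_integrable.
Qed.

Definition moll_approx u := forall eta : R, 0 < eta -> exists2 r, 0 < r &
  forall e, 0 < e <= r -> l2n leb (conv (moll e) u - u) <= eta.

Section approx.
Context (Omega : set 'rV[R]_n) (oOmega : open Omega) (fOmega : (leb Omega < +oo)%E).

Let mOmega : measurable Omega. Proof. exact: open_measurable_rV. Qed.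

Let P u := [/\ sqint leb u, forall x, ~ Omega x -> u x = 0 & moll_approx u].

Let Pint u : P u -> leb.-integrable setT (EFin \o u).
Proof. by move=> [su uO _]; exact: (sqint_integrable1 mOmega fOmega). Qed.

Let PZ (a : R) u : P u -> P (a *: u).
Proof.
move=> Pu; have iu := Pint Pu; have [su uO au] := Pu; split; first exact: sqintZ.
  by move=> x /uO ux; rewrite fscaleE ux mulr0.
move=> eta eta0.
have a1 : 0 < `|a| + 1 by rewrite ltr_wpDl.
have [r r0 rP] := au (eta / (`|a| + 1)) (divr_gt0 eta0 a1).
exists r => // e /andP[e0 er].
have b0 := bsmooth_moll n e0.
rewrite convZ// -scalerBr l2nZ; last first.
  by apply: sqintB => //; have [] := conv_l2 e0 iu su.
have := rP e; rewrite e0 er => /(_ isT); rewrite ler_pdivlMr// => h.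
by apply: le_trans h; rewrite mulrDr mulr1 mulrC lerDl.
Qed.

Let PD u v : P u -> P v -> P (u + v).
Proof.
move=> Pu Pv; have iu := Pint Pu; have iv := Pint Pv.
have [su uO au] := Pu; have [sv vO av] := Pv; split; first exact: sqintD.
  by move=> x Ox; rewrite faddE uO// vO// addr0.
move=> eta eta0; have eta2 : 0 < eta / 2 by rewrite divr_gt0.
have [r r0 rP] := au _ eta2; have [s s0 sP] := av _ eta2.
exists (Num.min r s) => [|e]; first by rewrite lt_min r0.
rewrite le_min => /and3P[e0 er es]; have b0 := bsmooth_moll n e0.
have [scu _] := conv_l2 e0 iu su; have [scv _] := conv_l2 e0 iv sv.
rewrite convD// opprD addrACA [eta]splitr.
apply: le_trans (l2nD _ _) _; [exact: sqintB|exact: sqintB|].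
by apply: lerD; [apply: rP|apply: sP]; apply/andP.
Qed.

(** Mollification is a contraction, so the property passes to limits. *)
Let Plim u : sqint leb u -> (forall x, ~ Omega x -> u x = 0) ->
  (forall e : R, 0 < e -> exists v, [/\ P v, sqint leb v & l2n leb (u - v) <= e]) -> P u.
Proof.
move=> su uO lu; split=> // eta eta0.
have eta3 : 0 < eta / 3 by rewrite divr_gt0.
have [v [Pv sv uv]] := lu _ eta3.
have iv := Pint Pv; have [_ vO av] := Pv.
have iu := sqint_integrable1 mOmega fOmega su uO.
have [r r0 rP] := av _ eta3.
exists r => // e er; have /andP[e0 _] := er; have b0 := bsmooth_moll n e0.
have suv : sqint leb (u - v) by exact: sqintB.
have iuv : leb.-integrable setT (EFin \o (u - v)) by exact: integrable_realB.
have [scu _] := conv_l2 e0 iu su; have [scv _] := conv_l2 e0 iv sv.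
have [scuv luv] := conv_l2 e0 iuv suv.
have -> : conv (moll e) u - u = conv (moll e) (u - v) + (conv (moll e) v - v) - (u - v).
  by rewrite convB// subrKA opprB subrKA.
have -> : eta = eta / 3 + eta / 3 + eta / 3 by field.
apply: le_trans (l2nB _ _) _ => //; first by apply: sqintD => //; exact: sqintB.
apply: lerD => //; apply: le_trans (l2nD _ _) _ => //; first exact: sqintB.
by apply: lerD; [exact: le_trans luv uv|exact: rP].
Qed.

(** Let [v] be the mollification of [\1_U]. Its norm is at most that of [\1_U], and
  it is 1 on [inner U r], whence
  |v - 1_U|^2 = |v|^2 + |1_U|^2 - 2 <v, 1_U> <= 2 leb (U minus inner U r). *)
Let Popen U : open U -> U `<=` Omega -> P \1_U.
Proof.
move=> oU UO; have mU := open_measurable_rV oU.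
have fU : (leb U < +oo)%E by apply: le_lt_trans fOmega; apply: le_measure; rewrite ?inE.
have sU := indic_sqint mU fU.
have UO0 x : ~ Omega x -> \1_U x = 0 :> R.
  by move=> Ox; rewrite indicE memNset// => /UO.
have iU := sqint_integrable1 mOmega fOmega sU UO0.
split=> // eta eta0.
have eta2 : 0 < eta ^+ 2 / 2 by rewrite divr_gt0// exprn_gt0.
have [r r0 rP] := leb_strip oU fU eta2.
exists r => // e /andP[e0 er]; have b0 := bsmooth_moll n e0.
have [sc lc] := conv_l2 e0 iU sU.
have mI := measurable_inner (R := R) (n := n) U r.
have fI : (leb (inner U r) < +oo)%E.
  by apply: le_lt_trans fU; apply: le_measure; rewrite ?inE//; exact: inner_sub.
rewrite -(@ler_pXn2r _ 2)// ?nnegrE ?(ltW eta0)// l2n_sqrB//.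
have cI : l2n leb \1_(inner U r) ^+ 2 <= \int[leb]_x (conv (moll e) \1_U x * \1_U x).
  rewrite l2n_sqr; apply: le_Rintegral => //.
  - exact/sqint_integrable/indic_sqint.
  - exact: sqintM_integrable.
  move=> x _; rewrite indicE; case: (boolP (x \in _)) => [|_]; last first.
    rewrite expr0n /=; apply: mulr_ge0; last by rewrite indicE.
    by apply: Rintegral_ge0 => y _; rewrite mulr_ge0 ?moll_ge0.
  rewrite inE => xr; rewrite expr1n indicE mem_set; last exact: inner_sub xr.
  rewrite mulr1 /conv (_ : \int[leb]_y _ = 1)// /Rintegral.
  rewrite -[RHS]/(fine 1%E) -(integral_moll_reflect x e0); congr fine.
  apply: eq_integral => y _; rewrite indicE.
  have [xy|xy] := leP e `|x - y|; first by rewrite moll0_out// mul0r.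
  rewrite mem_set ?mulr1//; apply: xr; rewrite -ball_normE /=.
  exact: lt_le_trans er.
have lc2 : l2n leb (conv (moll e) \1_U) ^+ 2 <= l2n leb \1_U ^+ 2.
  by rewrite ler_pXn2r// nnegrE.
have st : l2n leb \1_U ^+ 2 - l2n leb \1_(inner U r) ^+ 2 <= eta ^+ 2 / 2.
  rewrite -lee_fin EFinB !l2n_indic//; apply: le_trans rP.
  rewrite measureD// setIidr//; exact: inner_sub.
lra.
Qed.

Let measurable_open : @measurable _ 'rV[R]_n `<=` <<s @open 'rV[R]_n >>.
Proof.
suff : @rV_sigma_algebra R n `<=` <<s @open 'rV[R]_n >> by exact.
apply: smallest_sub; first exact: smallest_sigma_algebra.
move=> C; rewrite -bigcup_seq/= => -[i _ [D mD <-]]; rewrite setTI.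
have : measurable_fun [set: g_sigma_algebraType (@open 'rV[R]_n)]
    (fun x : g_sigma_algebraType (@open 'rV[R]_n) => (x : 'rV[R]_n) 0 i).
  apply: (measurability _ (RGenOInfty.measurableE R)).
  move=> _ [_ [a ->] <-]; rewrite setTI; apply: sub_sigma_algebra.
  have : open ((fun x : 'rV[R]_n => x 0 i) @^-1` `]a, +oo[).
    by apply: open_comp => // x _; exact: coord_continuous.
  exact.
by move=> /(_ measurableT D mD); rewrite setTI.
Qed.

(** Open sets are stable under intersection and generate the sigma-algebra, and
  the sets with the property form a Dynkin system. *)
Let Pmeas A : measurable A -> P \1_(A `&` Omega).
Proof.
move=> /measurable_open mA.
pose H := [set E : set 'rV[R]_n | measurable E /\ P \1_(E `&` Omega)].
suff : H A by case.
have dH : dynkin H.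
  split.
  - by split=> //; rewrite setTI; exact: Popen.
  - move=> E [mE PE]; split; first exact: measurableC.
    have -> : \1_(~` E `&` Omega) = \1_Omega + -1 *: \1_(E `&` Omega) :> ('rV[R]_n -> R).
      apply/funext => x; rewrite scaleN1r fsubE !indicE !in_setI in_setC.
      by case: (_ \in E); case: (_ \in Omega); rewrite /= ?subrr ?subr0.
    by apply: PD; [exact: Popen|exact: PZ].
  - move=> F tF HF; have mF k : measurable (F k) by have [] := HF k.
    split; first exact: bigcup_measurable.
    have mUF : measurable (\bigcup_k F k `&` Omega).
      by apply: measurableI => //; exact: bigcup_measurable.
    have fin_sub E : measurable E -> (leb (E `&` Omega) < +oo)%E.
      move=> mE; apply: le_lt_trans fOmega; apply: le_measure; rewrite ?inE//.
      exact: measurableI.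
    pose v N : 'rV[R]_n -> R := \sum_(k < N) \1_(F k `&` Omega).
    have vE N x : v N x = \sum_(k < N) \1_(F k `&` Omega) x by rewrite /v fct_sumE.
    have Pv N : P (v N).
      rewrite /v; elim/big_ind : _ => //; last by move=> k _; have [] := HF k.
      by have := Popen open0 (sub0set Omega); rewrite indic0.
    have vE1 N x : v N x = \1_(\big[setU/set0]_(k < N) F k `&` Omega) x.
      rewrite vE indicE in_setI; elim: N => [|N IH]; first by rewrite !big_ord0 in_set0.
      rewrite !big_ord_recr /= IH in_setU indicE in_setI.
      case: (boolP (x \in Omega)) => xO; rewrite ?andbF ?andbT ?addr0//.
      case: (boolP (x \in F N)) => xN; rewrite ?orbF ?orbT ?addr0//.
      rewrite (_ : (x \in _) = false) ?add0r//.
      apply/negbTE; rewrite notin_setE -bigcup_mkord => -[k /= kN Fk].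
      have kN' : k != N by rewrite ltn_eqF.
      move/trivIsetP : tF => /(_ k N Logic.I Logic.I kN') FkN.
      have : (F k `&` F N) x by split => //; exact: set_mem.
      by rewrite FkN.
    apply: Plim; first by apply: indic_sqint => //; apply: fin_sub; exact: bigcup_measurable.
      by move=> x Ox; rewrite indicE memNset// => -[].
    move=> e e0.
    have [|||||N HN] := @l2n_dct _ _ _ leb v \1_(\bigcup_k F k `&` Omega) \1_Omega _ _ _ _ _ e e0.
    + by move=> N; have [sN _ _] := Pv N; exact: sqint_measurable sN.
    + exact: measurable_indic.
    + exact: indic_sqint.
    + move=> N x; rewrite vE1 !indicE !in_setI.
      case: (boolP (x \in Omega)) => xO; rewrite ?andbF ?subrr ?normr0// !andbT.
      by case: (_ \in _); case: (_ \in _); rewrite ?subrr ?subr0 ?sub0r ?normrN ?normr0 ?normr1.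
    + move=> x; have [[[k _ Fk] xO]|nx] := pselect ((\bigcup_k F k `&` Omega) x).
        rewrite indicE mem_set; last by split=> //; exists k.
        apply: cvg_near_cst; exists k.+1 => // N /= kN.
        rewrite vE1 indicE mem_set//; split=> //.
        by rewrite -bigcup_mkord; exists k.
      rewrite indicE memNset//; apply: cvg_near_cst; apply: nearW => N.
      rewrite vE1 indicE memNset// => -[+ xO]; rewrite -bigcup_mkord => -[k _ Fk].
      by apply: nx; split=> //; exists k.
    exists (v N); split=> //; first by have [] := Pv N.
    by rewrite -l2nN opprB; exact: HN.
have /dynkin_lambda_system lH := dH.
apply: (lambda_system_subset _ lH _ _ mA) => //.
- by move=> U V; exact: openI.
- move=> U oU; split; first exact: open_measurable_rV.
  by apply: Popen; [exact: openI|exact: subIsetr].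
Qed.

Lemma moll_approx_sqint u : sqint leb u -> (forall x, ~ Omega x -> u x = 0) -> moll_approx u.
Proof.
move=> su uO; suff [] : P u by [].
apply: (sqint_ind PZ PD Plim _ fOmega mOmega su uO) => A mA AO.
by rewrite -(setIidl AO); exact: Pmeas.
Qed.

End approx.
End mollification_l2.

(** * Cutoffs and integration by parts *)
Section cutoff.
Context (R : realType) (n : nat).
Implicit Types (x y z : 'rV[R]_n) (f g F K u v phi : 'rV[R]_n -> R) (e r : R).
Implicit Types (U : set 'rV[R]_n) (l : seq 'I_n).

Notation e_ i := (delta_mx 0 i : 'rV[R]_n).
Notation leb := (leb R n).

Lemma pderivs_shift l f x :
  pderivs l (fun y => f (y + x)) = (fun y => pderivs l f (y + x)).
Proof.
elim: l => //= i l ->; apply/funext => y; rewrite /pderiv /derive.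
suff -> : (fun h : R => h^-1 *: (((fun y => pderivs l f (y + x)) \o shift y) (h *: e_ i) - pderivs l f (y + x))) =
  (fun h : R => h^-1 *: ((pderivs l f \o shift (y + x)) (h *: e_ i) - pderivs l f (y + x))) by [].
by apply/funext => h /=; rewrite addrA.
Qed.

Lemma derivable_shift_rV f x y (v : 'rV[R]_n) :
  derivable (fun y => f (y + x)) y v <-> derivable f (y + x) v.
Proof.
rewrite /derivable.
suff -> : (fun h : R => h^-1 *: (((fun y => f (y + x)) \o shift y) (h *: v) - f (y + x))) =
  (fun h : R => h^-1 *: ((f \o shift (y + x)) (h *: v) - f (y + x))) by [].
by apply/funext => h /=; rewrite addrA.
Qed.

Lemma smooth_shift f x : smooth f -> smooth (fun y => f (y + x)).
Proof.
move=> sf k; split=> [l i y lk _|l y lk _]; rewrite pderivs_shift.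
  by apply/derivable_shift_rV; exact: (sf k).1.
apply: (@continuous_comp _ _ _ (fun y => y + x) (pderivs l f)).
  by apply: continuousD => //; exact: cst_continuous.
exact: (sf k).2.
Qed.

Lemma smooth_reflect f x : smooth f -> smooth (fun y => f (x - y)).
Proof.
move=> sf k; have := @Ck_scale _ _ k _ (-1) (smooth_shift x sf k).
by congr Ck; apply/funext => y; rewrite scaleN1r addrC.
Qed.

Lemma pderivs_reflect l f x y : smooth f ->
  pderivs l (fun y => f (x - y)) y = (-1) ^+ size l * pderivs l f (x - y).
Proof.
move=> sf; have -> : (fun y => f (x - y)) = (fun y => (fun z => f (z + x)) (-1 *: y)).
  by apply/funext => z; rewrite scaleN1r addrC.
rewrite (pderivs_scale _ (smooth_shift x sf (size l))) pderivs_shift.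
by rewrite scaleN1r addrC.
Qed.

Definition smooth_on U f := forall k, Ck k U f.

Context (Omega : set 'rV[R]_n) (oOmega : open Omega) (bOmega : bounded_set Omega).

Let mOmega : measurable Omega. Proof. exact: open_measurable_rV. Qed.

Let fOmega : (leb Omega < +oo)%E. Proof. exact: leb_bounded_lty. Qed.

Lemma compact_inner r : 0 < r -> compact (inner Omega r).
Proof.
move=> r0; apply: bounded_closed_compact; last exact: closed_inner.
by case: bOmega => M [Mr HM]; exists M; split=> // t /HM h x /(inner_sub r0); exact: h.
Qed.

(** Mollifying at scale [r] the indicator of the points at distance [2 r] from the
  complement gives a function that is 1 at distance [3 r] and 0 below distance
  [r]. *)
Definition cutoff r : 'rV[R]_n -> R := conv (moll r) \1_(inner Omega (r *+ 2)).

Let sq_inner r : 0 < r -> sqint leb \1_(inner Omega r).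
Proof.
move=> r0; apply: indic_sqint; first exact: measurable_inner.
apply: le_lt_trans fOmega; apply: le_measure; rewrite ?inE//; last exact: inner_sub.
exact: measurable_inner.
Qed.

Let int_inner r : 0 < r -> leb.-integrable setT (EFin \o \1_(inner Omega r)).
Proof.
move=> r0; apply: (sqint_integrable1 mOmega fOmega (sq_inner r0)) => x nOx.
by rewrite indicE memNset// => /(inner_sub r0).
Qed.

Lemma cutoff_smooth r : 0 < r -> smooth (cutoff r).
Proof.
move=> r0; apply: smooth_conv; first exact: bsmooth_moll.
by apply: int_inner; rewrite mulrn_wgt0.
Qed.

(** The derivatives fall on the mollifier, whose L^1 norms are known. *)
Lemma cutoff_bound l : exists2 C : R, 0 <= C &
  forall r x, 0 < r -> `|pderivs l (cutoff r) x| <= C * r^-1 ^+ size l.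
Proof.
have [C C0 HC] := @integral_pderivs_moll R n l.
exists C => // r x r0.
have r20 : 0 < r *+ 2 by rewrite mulrn_wgt0.
have iI := int_inner r20.
have bm := bsmooth_moll n r0.
rewrite pderivs_conv// -lee_fin.
have b' := bsmooth_pderivs l bm.
have parity z : `|pderivs l (moll r) (- z)| = `|pderivs l (moll r) z|.
  have := @pderivs_reflect l (moll r) 0 z (@moll_smooth R n r).
  rewrite (_ : (fun y => _) = moll r); last first.
    by apply/funext => y; rewrite sub0r mollN.
  by rewrite sub0r => ->; rewrite normrM normrX normrN1 expr1n mul1r.
have mabs : measurable_fun setT (fun z : 'rV[R]_n => `|(pderivs l (moll r) z)%:E|%E).
  apply: measurableT_comp => //; apply/measurable_EFinP.
  by apply: smooth_measurable; exact: moll_smooth.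
have E : (\int[leb]_y `|(pderivs l (moll r) (x - y))%:E| =
    \int[leb]_y `|(pderivs l (moll r) y)%:E|)%E.
  rewrite -(@integral_leb_shift _ _ (- x) _ mabs).
  by apply: eq_integral => y _; rewrite /shift_rV /= -[in RHS]parity opprB.
apply: le_trans (HC r r0); rewrite -E.
have i1 := bsmooth_conv_integrable x b' iI.
rewrite /conv EFin_normr_Rintegral//; apply: le_trans (le_abse_integral _ _ _) _ => //.
  by case/integrableP: i1.
apply: ge0_le_integral => //.
- by apply: measurableT_comp => //; case/integrableP: i1.
- apply: measurableT_comp => //; apply/measurable_EFinP.
  by apply: measurable_reflect; apply: smooth_continuous; exact: moll_smooth.
- move=> y _; rewrite lee_fin normrM ler_piMr// indicE.
  by case: (_ \in _); rewrite ?normr1 ?normr0.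
Qed.

Lemma cutoff1 r x : 0 < r -> inner Omega (r *+ 3) x -> cutoff r x = 1.
Proof.
move=> r0 xr; rewrite /cutoff /conv /Rintegral -[RHS]/(fine 1%E).
rewrite -(integral_moll_reflect x r0); congr fine; apply: eq_integral => y _.
rewrite indicE; have [xy|xy] := leP r `|x - y|; first by rewrite moll0_out// mul0r.
rewrite mem_set ?mulr1// => z yz; apply: xr.
have xy' : ball x r y by rewrite -ball_normE.
by have := ball_triangle xy' yz; rewrite -mulrS.
Qed.

Lemma cutoff0 r x : 0 < r -> ~ inner Omega r x -> cutoff r x = 0.
Proof.
move=> r0 xr; rewrite /cutoff /conv.
transitivity (\int[leb]_y (0 : R)); last by rewrite Rintegral_cst ?mul0r.
apply: eq_Rintegral => y _ /=.
have [xy|xy] := leP r `|x - y|; first by rewrite moll0_out// mul0r.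
rewrite indicE memNset ?mulr0// => yr; apply: xr => z xz; apply: yr.
have yx' : ball y r x by rewrite -ball_normE /= distrC.
by have := ball_triangle yx' xz; rewrite mulr2n.
Qed.

Lemma cutoff_bnd1 r x : 0 < r -> 0 <= cutoff r x <= 1.
Proof.
move=> r0; apply/andP; split.
  by apply: Rintegral_ge0 => y _; rewrite mulr_ge0 ?moll_ge0.
have -> : 1 = \int[leb]_y moll r (x - y).
  by rewrite /Rintegral integral_moll_reflect.
apply: le_Rintegral => //.
- apply: bsmooth_conv_integrable; first exact: bsmooth_moll.
  by apply: int_inner; rewrite mulrn_wgt0.
- exact: integrable_moll_reflect.
- by move=> y _; rewrite ler_piMr ?moll_ge0// indicE; case: (_ \in _).
Qed.

(** The first factor vanishes near the boundary, where the second may be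
  singular. *)
Lemma test_fun_mul (chi : 'rV[R]_n -> R) F : test_fun Omega chi -> smooth_on Omega F ->
  test_fun Omega (chi * F).
Proof.
move=> [schi [K [cK KO K0]]] sF; split; last first.
  by exists K; split=> // x /K0 chi0; rewrite fmulE chi0 mul0r.
move=> k; apply: Ck_local => x _; have [Ox|nOx] := pselect (Omega x).
  exists Omega, (chi * F); split=> //; apply: CkM => //.
  by apply: sub_Ck (schi k).
have oK : open (~` K) by apply: closed_openC; apply: compact_closed.
exists (~` K), (cst 0); split=> //; first by move=> /KO.
  exact: Ck_cst.
by move=> y nKy; rewrite fmulE K0// mul0r.
Qed.

Lemma test_fun_cutoff r : 0 < r -> test_fun Omega (cutoff r).
Proof.
move=> r0; split; first exact: cutoff_smooth.
exists (inner Omega r); split; [exact: compact_inner|exact: inner_sub|].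
by move=> x; exact: cutoff0.
Qed.

Lemma test_fun_moll e r x : 0 < e -> e < r -> inner Omega r x ->
  test_fun Omega (fun y => moll e (x - y)).
Proof.
move=> e0 er xr; split; first by apply: smooth_reflect; exact: moll_smooth.
exists (closed_ball x e); split.
- apply: bounded_closed_compact; last exact: closed_ball_closed.
  exists (`|x| + e); split; first exact: num_real.
  move=> t xt y; rewrite closed_ballE// /closed_ball_ /= => xy.
  apply: (le_trans _ (ltW xt)); rewrite -(subrK x y).
  by rewrite (le_trans (ler_normD _ _))// addrC lerD2l distrC.
- move=> y; rewrite closed_ballE// /closed_ball_ /= => xy; apply: xr.
  by rewrite -ball_normE; exact: le_lt_trans xy er.
- move=> y; rewrite closed_ballE// /closed_ball_ /= => /negP; rewrite -ltNge => /ltW xy.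
  exact: moll0_out.
Qed.

Lemma test_fun_bounded_out phi : test_fun Omega phi ->
  exists2 r, 0 < r & forall z, r < `|z| -> phi z = 0.
Proof.
move=> [_ [K [_ KO K0]]]; have [M [_ HM]] := bOmega.
exists (`|M| + 1) => [|z zM]; first by rewrite ltr_wpDl.
apply: K0 => /KO Oz; have := HM (`|M| + 1) _ z Oz.
rewrite (le_lt_trans (ler_norm _)) ?ltrDl// => /(_ isT) /=.
by rewrite leNgt zM.
Qed.

Lemma Rintegral_dom (D : set 'rV[R]_n) f : (forall x, ~ D x -> f x = 0) ->
  \int[leb]_(x in D) f x = \int[leb]_x f x.
Proof.
move=> f0; rewrite Rintegral_mkcond; apply: eq_Rintegral => x _.
rewrite patchE; case: ifPn => //; rewrite notin_setE => nD.
by rewrite f0.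
Qed.

(** The difference quotients of a compactly supported function have integral
  zero by translation invariance, and dominated convergence applies. *)
Lemma integral_pderiv0 i F r : Ck 1 setT F -> (forall z, r < `|z| -> F z = 0) ->
  \int[leb]_x pderiv i F x = 0.
Proof.
move=> CF F0; have [dF cF CF1] := (CkS _ _ _).1 CF.
have cF' : continuous F by move=> x; exact: cF.
have cdF : continuous (pderiv i F) by move=> x; exact: ((Ck0P _ _).1 (CF1 i)).
have dF0 := @pderivs_out R n [:: i] F r F0.
have [M M0 HM] := bounded_compact_support cdF dF0.
have [N N0 HN] := bounded_compact_support cF' F0.
have mF := continuous_measurable_fun_rV cF'.
have mdF := continuous_measurable_fun_rV cdF.
have iF : leb.-integrable setT (EFin \o F) by exact: integrable_bounded_support mF HN F0.
pose t k : R := k.+1%:R^-1.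
have t0 k : 0 < t k by rewrite invr_gt0.
have t1 k : `|t k| <= 1 by rewrite gtr0_norm// invf_le1// ler1n.
pose D k x := (t k)^-1 * (F (t k *: e_ i + x) - F x).
have shE k x : t k *: e_ i + x = shift_rV (t k *: e_ i) x by rewrite /shift_rV addrC.
have iD k : leb.-integrable setT (EFin \o D k).
  apply: integrable_realZ => //; apply: integrable_realB => //.
  under eq_fun do rewrite shE.
  exact: (integrable_leb_shift (t k *: e_ i) iF).
have D0 k : (\int[leb]_x (D k x)%:E = 0)%E.
  rewrite -[LHS]fineK; last by apply: integrable_fin_num => //; exact: iD.
  congr EFin; rewrite -[LHS]/(\int[leb]_x D k x) /D RintegralZl//; last first.
    apply: integrable_realB => //; under eq_fun do rewrite shE.
    exact: (integrable_leb_shift (t k *: e_ i) iF).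
  rewrite RintegralB//; last first.
    under eq_fun do rewrite shE; exact: (integrable_leb_shift (t k *: e_ i) iF).
  rewrite (_ : \int[leb]_x F (t k *: e_ i + x) = \int[leb]_x F x) ?subrr ?mulr0//.
  rewrite /Rintegral -[in RHS](@integral_leb_shift _ _ (t k *: e_ i) (EFin \o F)); last exact/measurable_EFinP.
  by congr fine; apply: eq_integral => x _; rewrite shE.
have DM k x : `|D k x| <= M /\ (`|r| + 1 < `|x| -> D k x = 0).
  have [//|y _|c ct E] := @MVT_line _ _ setT F i x (t k); first exact: dF.
  have DE : D k x = pderiv i F (c *: e_ i + x) by rewrite /D E mulrA mulVf ?mul1r// gt_eqF.
  rewrite DE; split=> [|xr]; first exact: HM.
  apply: dF0; apply: le_lt_trans (ler_norm r) _; rewrite -(ltrD2r 1) (lt_le_trans xr)//.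
  rewrite -[in leLHS](addKr (c *: e_ i) x); apply: le_trans (ler_normD _ _) _.
  rewrite addrC lerD2l normrN normrZ; apply: le_trans (_ : `|t k| <= _) => //.
  apply: le_trans ct; rewrite ler_piMr// [leLHS]/Num.norm/= mx_normrE.
  apply: bigmax_le => // -[p q] _ /=; rewrite mxE.
  by case: (_ && _); rewrite ?normr1 ?normr0.
have cD x : D ^~ x @ \oo --> pderiv i F x.
  have dFx := dF i x Logic.I.
  have ct : t @ \oo --> (0 : R)^'.
    move=> A A0; have := @cvg_harmonic R _ A0.
    move=> [N' _ HN']; exists N' => // k /HN'; apply.
    by rewrite gt_eqF.
  exact: (cvg_comp _ _ ct dFx).
pose G x : R := M * \1_(ball (0 : 'rV[R]_n) (`|r| + 2)) x.
have iG : leb.-integrable setT (EFin \o G).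
  apply: integrable_realZ => //.
  apply: (@integrable_bounded_support _ _ _ (`|r| + 2) 1).
  - by apply: measurable_indic; apply: open_measurable_rV; exact: ball_open.
  - by move=> z; rewrite indicE; case: (_ \in _); rewrite ?normr1 ?normr0.
  - move=> z zr; rewrite indicE memNset// -ball_normE /= sub0r normrN.
    by apply/negP; rewrite -leNgt ltW.
have [|||||_ _ H] := @dominated_convergence _ _ _ leb _ measurableT
  (fun k x => (D k x)%:E) (fun x => (pderiv i F x)%:E) (EFin \o G).
- by move=> k; case/integrableP: (iD k).
- exact/measurable_EFinP.
- by apply: nearW => x _; apply: cvg_EFin; [exact: nearW|exact: cD].
- exact: iG.
- apply: nearW => x k _; rewrite lee_fin; have [h1 h2] := DM k x; rewrite /G indicE.
  case: (boolP (x \in _)) => [_|]; first by rewrite mulr1.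
  rewrite notin_setE -ball_normE /= sub0r normrN => /negP; rewrite -leNgt => rx.
  rewrite h2 ?normr0 ?mulr0//; apply: lt_le_trans rx.
  by rewrite ltrD2l ltr1n.
move: H; under eq_fun do rewrite D0.
by move=> /cvg_lim; rewrite /Rintegral => <-//; rewrite lim_cst.
Qed.

Lemma Ck_mul_test k phi F : test_fun Omega phi -> Ck k Omega F -> Ck k setT (phi * F).
Proof.
move=> [sphi [K [cK KO K0]]] CF; apply: Ck_local => x _.
have [Ox|nOx] := pselect (Omega x).
  exists Omega, (phi * F); split=> //; apply: CkM => //.
  by apply: sub_Ck (sphi k).
have oK : open (~` K) by apply: closed_openC; apply: compact_closed.
exists (~` K), (cst 0); split=> //; first by move=> /KO.
  exact: Ck_cst.
by move=> y nKy; rewrite fmulE K0// mul0r.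
Qed.

Lemma test_fun_out phi x : test_fun Omega phi -> ~ Omega x -> phi x = 0.
Proof. by move=> [_ [K [_ KO K0]]] nOx; apply: K0 => /KO. Qed.

Lemma test_fun_pderivs l phi : test_fun Omega phi -> test_fun Omega (pderivs l phi).
Proof.
move=> [sphi [K [cK KO K0]]]; split.
  elim: l => // i l IH k; have [_ _] := (CkS k setT (pderivs l phi)).1 (IH k.+1); exact.
exists K; split=> // x nKx.
have oK : open (~` K) by apply: closed_openC; apply: compact_closed.
have -> : pderivs l phi x = pderivs l (cst 0) x.
  by apply: (@eq_pderivs R n (~` K) l phi (cst 0) oK _ x nKx) => y; exact: K0.
by rewrite pderivs_zero.
Qed.

Lemma integrable_test_mul phi F : test_fun Omega phi -> Ck 0 Omega F ->
  leb.-integrable setT (EFin \o (phi * F)).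
Proof.
move=> tphi CF; have C := Ck_mul_test tphi CF.
have c : continuous (phi * F) by move=> x; exact: ((Ck0P _ _).1 C).
have [r r0 phi0] := test_fun_bounded_out tphi.
have out z : r < `|z| -> (phi * F) z = 0 by move=> /phi0 h; rewrite fmulE h mul0r.
have [M M0 HM] := bounded_compact_support c out.
exact: integrable_bounded_support (continuous_measurable_fun_rV c) HM out.
Qed.

(** The product has compact support, so the integral of its derivative is 0. *)
Lemma by_parts1 i F phi : Ck 1 Omega F -> test_fun Omega phi ->
  \int[leb]_(x in Omega) (F x * pderiv i phi x) =
  - \int[leb]_(x in Omega) (pderiv i F x * phi x).
Proof.
move=> CF tphi; have [_ _ CF1] := (CkS _ _ _).1 CF.
have tdphi : test_fun Omega (pderiv i phi) := test_fun_pderivs [:: i] tphi.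
rewrite (@Rintegral_dom Omega (fun x => F x * pderiv i phi x)); last first.
  by move=> x nO; rewrite (test_fun_out tdphi nO) mulr0.
rewrite (@Rintegral_dom Omega (fun x => pderiv i F x * phi x)); last first.
  by move=> x nO; rewrite (test_fun_out tphi nO) mulr0.
have [r r0 phi0] := test_fun_bounded_out tphi.
have := @integral_pderiv0 i (phi * F) r (Ck_mul_test tphi CF) _.
move=> /(_ _)/wrap[z /phi0 h|]; first by rewrite fmulE h mul0r.
have -> : \int[leb]_x pderiv i (phi * F) x = \int[leb]_x (pderiv i F x * phi x + F x * pderiv i phi x).
  apply: eq_Rintegral => x _; have [Ox|nOx] := pselect (Omega x).
    rewrite (leibniz1 i oOmega)//; first by rewrite mulrC.
    by apply: sub_Ck (tphi.1 1%N).
  rewrite (test_fun_out tphi nOx) (test_fun_out tdphi nOx) !mulr0 addr0.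
  have [_ [K [cK KO K0]]] := tphi.
  have oK : open (~` K) by apply: closed_openC; apply: compact_closed.
  have : pderivs [:: i] (phi * F) x = pderivs [:: i] (cst 0) x.
    apply: (@eq_pderivs R n (~` K) [:: i] (phi * F) (cst 0) oK _ x) => [y nKy|/KO//].
    by rewrite fmulE K0// mul0r.
  by rewrite pderivs_zero.
rewrite RintegralD//.
- by move/eqP; rewrite addrC addr_eq0 => /eqP.
- rewrite (_ : (fun x => _) = phi * pderiv i F); first exact: integrable_test_mul.
  by apply/funext => x; rewrite fmulE mulrC.
- rewrite (_ : (fun x => _) = pderiv i phi * F).
    by apply: integrable_test_mul => //; exact: le_Ck (leq0n 1) CF.
  by apply/funext => x; rewrite fmulE mulrC.
Qed.

(** Moving the derivatives one at a time from [phi] to [F] reverses their order. *)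
Lemma by_parts l F phi : Ck (size l) Omega F -> test_fun Omega phi ->
  \int[leb]_(x in Omega) (F x * pderivs l phi x) =
  (-1) ^+ size l * \int[leb]_(x in Omega) (pderivs (rev l) F x * phi x).
Proof.
elim: l F => [|i l IH] F CF tphi; first by rewrite expr0 mul1r.
have [_ _ CF1] := (CkS _ _ _).1 CF.
rewrite [LHS]by_parts1; [|exact: le_Ck CF|exact: test_fun_pderivs].
by rewrite IH// rev_cons pderivs_rcons exprS mulN1r mulNr.
Qed.

Lemma cutoff_cvg x : Omega x -> exists N, forall k, (N <= k)%N -> cutoff k.+1%:R^-1 x = 1.
Proof.
move=> Ox; have := Ox; rewrite -{1}(inner_exhaust oOmega) => -[N _ xN].
exists (3 * N.+1)%N => k kN; apply: cutoff1; first by rewrite invr_gt0.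
apply: (le_inner _ xN); rewrite -[leLHS]mulr_natr ler_pdivrMl// ler_pdivlMr//.
by rewrite -natrM ler_nat (leq_trans kN).
Qed.

(** The fundamental lemma of the calculus of variations: mollifying
  [cutoff r * w] tests [w] against admissible functions. *)
Lemma test_fun_separating w : sqint leb w -> (forall x, ~ Omega x -> w x = 0) ->
  (forall phi, test_fun Omega phi -> \int[leb]_(x in Omega) (w x * phi x) = 0) ->
  l2n leb w = 0.
Proof.
move=> sw wO tw.
have mw := sqint_measurable sw.
pose u k : 'rV[R]_n -> R := fun x => cutoff k.+1%:R^-1 x * w x.
have rk k : 0 < k.+1%:R^-1 :> R by rewrite invr_gt0.
have mc k : measurable_fun setT (cutoff k.+1%:R^-1).
  by apply: (@smooth_measurable _ _ _ [::]); exact: cutoff_smooth.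
have c1 k x : `|cutoff k.+1%:R^-1 x| <= 1.
  by have /andP[? ?] := cutoff_bnd1 x (rk k); rewrite ger0_norm.
have su k : sqint leb (u k) := (sqintM_bounded (mc k) (c1 k) sw).1.
have uO k x : ~ Omega x -> u k x = 0 by move=> /wO h; rewrite /u h mulr0.
have u0 k : l2n leb (u k) = 0.
  apply/eqP; rewrite eq_le l2n_ge0 andbT; apply/ler_addgt0Pr => eta eta0; rewrite add0r.
  have [r r0 H] := moll_approx_sqint oOmega fOmega (su k) (uO k) eta0.
  pose e := Num.min r (k.+1%:R^-1 / 2).
  have e0 : 0 < e by rewrite lt_min r0 divr_gt0.
  have ek : e < k.+1%:R^-1 by rewrite gt_min ltr_pdivrMr// ltr_pMr// ltr1n orbT.
  have cv0 : conv (moll e) (u k) = 0.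
    apply/funext => x; rewrite /conv.
    have t1 : test_fun Omega (fun y => cutoff k.+1%:R^-1 y * moll e (x - y)).
      apply: (test_fun_mul (test_fun_cutoff (rk k))) => m.
      by apply: sub_Ck (smooth_reflect x (@moll_smooth R n e) m).
    rewrite -[RHS](tw _ t1) (@Rintegral_dom Omega); last by move=> y /wO ->; rewrite mul0r.
    by apply: eq_Rintegral => y _; rewrite /u mulrCA mulrA [_ * w y]mulrC mulrA.
  have := H e; rewrite e0 ge_min lexx /= => /(_ isT).
  by rewrite cv0 sub0r l2nN.
apply/eqP; rewrite eq_le l2n_ge0 andbT; apply/ler_addgt0Pr => eta eta0; rewrite add0r.
have [|||||N HN] := @l2n_dct _ _ _ leb u w w _ _ _ _ _ eta eta0.
- by move=> k; exact: sqint_measurable (su k).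
- by [].
- by [].
- move=> k x; rewrite /u -{2}[w x]mul1r -mulrBl normrM ler_piMl//.
  by have /andP[? ?] := cutoff_bnd1 x (rk k); rewrite distrC ger0_norm ?subr_ge0// gerBl.
- move=> x; apply: cvg_near_cst; have [Ox|/wO wx] := pselect (Omega x).
    by have [N HN] := cutoff_cvg Ox; exists N => // k /HN h; rewrite /u h mul1r.
  by apply: nearW => k; rewrite /u wx mulr0.
apply: le_trans (HN N (leqnn N)).
have := l2n_triB sw (su N); rewrite u0 subr0 ger0_norm// => /le_trans; apply.
by rewrite -l2nN opprB.
Qed.

End cutoff.

(** * Weak derivatives and the Sobolev norm *)
Lemma perm_eq_le2 (T : eqType) (l l' : seq T) : (size l <= 2)%N -> perm_eq l l' ->
  l' = l \/ exists i j, l = [:: i; j] /\ l' = [:: j; i].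
Proof.
case: l => [|i [|j [|//]]] _ pl.
- by left; apply/nilP; rewrite /nilp -(perm_size pl).
- by left; apply: perm_small_eq => //; rewrite perm_sym.
have : size l' = 2%N by rewrite -(perm_size pl).
case: l' pl => [|i' [|j' [|//]]] // pl _.
have : i' \in [:: i; j] by rewrite (perm_mem pl) mem_head.
rewrite !inE => /orP[/eqP i'i|/eqP i'j].
  left; move: pl; rewrite i'i perm_cons => pl; congr cons.
  by apply: perm_small_eq => //; rewrite perm_sym.
have : perm_eq [:: j; i] [:: i'; j'] by rewrite (perm_trans _ pl)// (perm_catC [:: j] [:: i]).
rewrite i'j perm_cons => pl'; right; exists i, j; split=> //; congr cons.
by apply: perm_small_eq => //; rewrite perm_sym.
Qed.

Section density.
Context (R : realType) (n : nat) (Omega : set 'rV[R]_n).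
Context (mu : {measure set 'rV[R]_n -> \bar R}).
Context (oOmega : open Omega) (bOmega : bounded_set Omega).
Context (muD : good_density Omega mu).
Implicit Types (u v : 'rV[R]_n -> R).

Notation leb := (leb R n).

Let mOmega : measurable Omega. Proof. exact: open_measurable_rV. Qed.

Let fOmega : (leb Omega < +oo)%E. Proof. exact: leb_bounded_lty. Qed.

(** Through this comparison, the theory of Lebesgue measure serves for [mu]. *)
Lemma density_bounds : exists m M : R, 0 < m /\ forall E, measurable E ->
  (m%:E * leb (E `&` Omega) <= mu E <= M%:E * leb (E `&` Omega))%E.
Proof.
have [rho [crho [m [M [m0 mM]]] muE]] := muD.
exists m, M; split=> // E mE; have mEO : measurable (E `&` Omega) by exact: measurableI.
have mrho : measurable_fun Omega (EFin \o rho).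
  apply/measurable_EFinP; apply: open_continuous_measurable_fun_rV => // x Ox.
  by move: crho; rewrite continuous_open_subspace// => /(_ x); apply; rewrite inE.
have mrho' : measurable_fun (E `&` Omega) (EFin \o rho).
  exact: measurable_funS mrho.
rewrite muE//; apply/andP; split.
  rewrite -integral_cst//; apply: ge0_le_integral => //.
  - by move=> x _; rewrite lee_fin ltW.
  - by move=> x [_ /mM /andP[h _]]; rewrite lee_fin.
rewrite -integral_cst//; apply: ge0_le_integral => //.
- by move=> x [_ /mM /andP[h _]]; rewrite lee_fin (le_trans _ h)// ltW.
- by move=> x [_ /mM /andP[_ h]]; rewrite lee_fin.
Qed.

Lemma mu_setC_Omega : mu (~` Omega) = 0%E.
Proof.
have [m [M [m0 H]]] := density_bounds.
have /andP[_] := H _ (measurableC mOmega).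
rewrite setICl measure0 mule0 => le0; apply/eqP; rewrite eq_le le0 /=.
exact: measure_ge0.
Qed.

Lemma mu_finite : (mu setT < +oo)%E.
Proof.
have [m [M [m0 H]]] := density_bounds.
have /andP[_] := H _ measurableT; rewrite setTI => /le_lt_trans; apply.
rewrite -[X in (_ * X)%E]fineK ?ge0_fin_numE//.
by rewrite -EFinM ltry.
Qed.

Lemma mu_ae_Omega : {ae mu, forall x, Omega x}.
Proof.
exists (~` Omega); split; [exact: measurableC|exact: mu_setC_Omega|].
by move=> x /=.
Qed.

(** Integrals against [mu] can therefore be taken over the whole space. *)
Lemma Rintegral_mu_Omega (f : 'rV[R]_n -> R) : measurable_fun setT f ->
  \int[mu]_(x in Omega) f x = \int[mu]_x f x.
Proof.
move=> mf; rewrite Rintegral_mkcond /Rintegral; congr fine.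
apply: ae_eq_integral => //.
- apply/measurable_EFinP; exact/(measurable_restrictT _ _).1/measurable_funTS.
- exact/measurable_EFinP.
- by apply: filterS mu_ae_Omega => x Ox _; rewrite patchE mem_set.
Qed.

(** Extension by zero turns functions on the domain into functions on the whole
  space, where convolutions are defined. *)
Definition res v : 'rV[R]_n -> R := fun x => \1_Omega x * v x.

Lemma resE v x : res v x = \1_Omega x * v x. Proof. by []. Qed.

Lemma res_out v x : ~ Omega x -> res v x = 0.
Proof. by move=> nOx; rewrite /res indicE memNset// mul0r. Qed.

Lemma res_in v x : Omega x -> res v x = v x.
Proof. by move=> Ox; rewrite /res indicE mem_set// mul1r. Qed.

Lemma measurable_res v : measurable_fun Omega v -> measurable_fun setT (res v).
Proof.
move=> mv; rewrite (_ : res v = v \_ Omega).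
  exact/(measurable_restrictT _ _).1.
by apply/funext => x; rewrite patchE /res indicE; case: ifP; rewrite ?mul1r ?mul0r.
Qed.

Lemma integral_res v : (\int[leb]_x (res v x ^+ 2)%:E = \int[leb]_(x in Omega) (v x ^+ 2)%:E)%E.
Proof.
rewrite [RHS]integral_mkcond; apply: eq_integral => x _; rewrite patchE /res indicE.
by case: ifP; rewrite ?mul1r// mul0r expr0n.
Qed.

Lemma sqint_res : exists2 A : R, 0 < A & forall v, sqint mu v ->
  sqint leb (res v) /\ l2n leb (res v) <= A * l2n mu v.
Proof.
have [m [M [m0 H]]] := density_bounds.
exists (Num.sqrt m^-1) => [|v sv]; first by rewrite sqrtr_gt0 invr_gt0.
have mv := sqint_measurable sv.
have mv2 : measurable_fun setT (fun x => (v x ^+ 2)%:E).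
  by apply/measurable_EFinP; exact: measurable_funX.
have v20 x : (0 <= (v x ^+ 2)%:E)%E by rewrite lee_fin sqr_ge0.
pose m' := NngNum (ltW m0).
pose nu : {measure set 'rV[R]_n -> \bar R} := mscale m' (mrestr leb mOmega).
have le1 : (m%:E * \int[leb]_(x in Omega) (v x ^+ 2)%:E <= \int[mu]_x (v x ^+ 2)%:E)%E.
  apply: (@le_trans _ _ (\int[nu]_x (v x ^+ 2)%:E)%E).
    rewrite ge0_integral_mscale//=; apply: lee_pmul => //.
    - by rewrite lee_fin ltW.
    - exact: integral_ge0.
    - rewrite (_ : (\int[leb]_(x in Omega) _)%E = (\int[mrestr leb mOmega]_(x in Omega) (v x ^+ 2)%:E)%E).
        by apply: ge0_subset_integral.
      by apply: eq_measure_integral => A mA AO; rewrite /= /mrestr setIidl.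
  apply: ge0_le_measure_integral => // S mS.
  by have /andP[+ _] := H S mS.
rewrite -integral_res in le1.
have mr := measurable_res (measurable_funTS mv).
have fi : (\int[leb]_x (res v x ^+ 2)%:E < +oo)%E.
  rewrite -(@lte_pmul2l _ m%:E) ?lte_fin//; apply: le_lt_trans le1 _.
  by rewrite sqint_ge0_fin// mulry gtr0_sg// mul1e ltry.
have sr : sqint leb (res v) by exact: sqint_intro.
split=> //; move: le1; rewrite !sqint_ge0_fin// -EFinM lee_fin => le1.
rewrite -(@ler_pXn2r _ 2)// ?nnegrE ?mulr_ge0 ?sqrtr_ge0//.
have s2 : Num.sqrt m^-1 ^+ 2 = m^-1 by rewrite sqr_sqrtr// invr_ge0 ltW.
by rewrite exprMn s2 mulrC ler_pdivlMr// mulrC.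
Qed.

Lemma sqint_unres : exists2 A : R, 0 < A & forall v, measurable_fun setT v ->
  sqint leb (res v) -> sqint mu v /\ l2n mu v <= A * l2n leb (res v).
Proof.
have [m [M [m0 H]]] := density_bounds.
pose N := `|M| + 1; have N0 : 0 < N by rewrite ltr_wpDl.
exists (Num.sqrt N) => [|v mv sr]; first by rewrite sqrtr_gt0.
have mv2 : measurable_fun setT (fun x => (v x ^+ 2)%:E).
  by apply/measurable_EFinP; exact: measurable_funX.
have v20 x : (0 <= (v x ^+ 2)%:E)%E by rewrite lee_fin sqr_ge0.
pose m' := NngNum (ltW N0).
pose nu : {measure set 'rV[R]_n -> \bar R} := mscale m' leb.
have le1 : (\int[mu]_x (v x ^+ 2)%:E <= N%:E * \int[leb]_(x in Omega) (v x ^+ 2)%:E)%E.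
  rewrite (_ : (\int[mu]_x _ = \int[mu]_(x in Omega) (v x ^+ 2)%:E)%E); last first.
    rewrite [RHS]integral_mkcond; apply: ae_eq_integral => //.
      exact/(measurable_restrictT _ _).1/measurable_funTS.
    by apply: filterS mu_ae_Omega => x Ox _; rewrite patchE mem_set.
  rewrite (_ : (N%:E * _)%E = \int[nu]_(x in Omega) (v x ^+ 2)%:E)%E; last first.
    by rewrite ge0_integral_mscale//; exact: measurable_funTS.
  apply: ge0_le_measure_integral => // S mS.
  have /andP[_ h] := H S mS; apply: le_trans h _; rewrite /nu /mscale/=.
  apply: (@le_trans _ _ (N%:E * leb (S `&` Omega))%E).
    by apply: lee_wpmul2r => //; rewrite lee_fin (le_trans (ler_norm _))// lerDl.
  apply: lee_wpmul2l; first by rewrite lee_fin ltW.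
  by apply: le_measure; rewrite ?inE//; exact: measurableI.
rewrite -integral_res in le1.
have sv : sqint mu v.
  apply: sqint_intro => //; apply: le_lt_trans le1 _.
  by rewrite sqint_ge0_fin// -EFinM ltry.
split=> //; move: le1; rewrite !sqint_ge0_fin// -EFinM lee_fin => le1.
rewrite -(@ler_pXn2r _ 2)// ?nnegrE ?mulr_ge0 ?sqrtr_ge0//.
have s2 : Num.sqrt N ^+ 2 = N by rewrite sqr_sqrtr// ltW.
by rewrite exprMn s2.
Qed.

Section weak_lists.
Implicit Types (f g h phi F : 'rV[R]_n -> R) (l : seq 'I_n).

(** Lists of directions, rather than multi-indices, match the iterated classical
  derivatives, so that integration by parts and the Leibniz rule are inductions
  over the list. *)
Definition weak_list l g v := forall phi, test_fun Omega phi ->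
  \int[leb]_(x in Omega) (g x * pderivs l phi x) =
  (-1) ^+ size l * \int[leb]_(x in Omega) (v x * phi x).

Lemma integrable_res v : sqint mu v -> leb.-integrable setT (EFin \o res v).
Proof.
move=> sv; have [A _ HA] := sqint_res.
exact: (sqint_integrable1 mOmega fOmega (HA v sv).1 (res_out v)).
Qed.

Lemma test_int_res v phi : test_fun Omega phi ->
  \int[leb]_(x in Omega) (v x * phi x) = \int[leb]_x (res v x * phi x).
Proof.
move=> tphi; rewrite (@Rintegral_dom _ _ Omega (fun x => v x * phi x)); last first.
  by move=> x nO; rewrite (test_fun_out tphi nO) mulr0.
apply: eq_Rintegral => x _; have [Ox|nO] := pselect (Omega x).
  by rewrite res_in.
by rewrite (test_fun_out tphi nO) !mulr0.
Qed.

Lemma integrable_test_res v phi : test_fun Omega phi -> sqint mu v ->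
  leb.-integrable setT (EFin \o (fun x => res v x * phi x)).
Proof.
move=> tphi sv; have iv := integrable_res sv.
have c : continuous phi by move=> x; exact: (@smooth_continuous _ _ _ [::] tphi.1).
have [r r0 out] := test_fun_bounded_out bOmega tphi.
have [M M0 HM] := bounded_compact_support c out.
apply: (@le_integrable _ _ _ _ _ _ _ (EFin \o (fun x => M * res v x))) => //.
- apply/measurable_EFinP; apply: measurable_funM; last exact: continuous_measurable_fun_rV.
  by apply/measurable_EFinP; case/integrableP: iv.
- move=> x _; rewrite lee_fin !normrM mulrC ler_wpM2r//.
  exact: le_trans (HM x) (ler_norm _).
- exact: integrable_realZ.
Qed.

Lemma weak_listE l g v : weak_list l g v <-> forall phi, test_fun Omega phi ->
  \int[leb]_x (res g x * pderivs l phi x) =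
  (-1) ^+ size l * \int[leb]_x (res v x * phi x).
Proof.
by split=> H phi tphi; have := H phi tphi; rewrite !test_int_res//;
  exact: test_fun_pderivs.
Qed.

Lemma weak_listD l g h v w : sqint mu g -> sqint mu h -> sqint mu v -> sqint mu w ->
  weak_list l g v -> weak_list l h w -> weak_list l (g + h) (v + w).
Proof.
move=> sg sh sv sw /weak_listE Hg /weak_listE Hh; apply/weak_listE => phi tphi.
have tl := test_fun_pderivs l tphi.
have D u1 u2 psi : test_fun Omega psi -> sqint mu u1 -> sqint mu u2 ->
    \int[leb]_x (res (u1 + u2) x * psi x) =
    \int[leb]_x (res u1 x * psi x) + \int[leb]_x (res u2 x * psi x).
  move=> tpsi s1 s2; rewrite -RintegralD//; [|exact: integrable_test_res..].
  by apply: eq_Rintegral => x _; rewrite /res faddE mulrDr mulrDl.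
by rewrite !D// Hg// Hh// mulrDr.
Qed.

Lemma weak_listZ l (a : R) g v : sqint mu g -> sqint mu v ->
  weak_list l g v -> weak_list l (a *: g) (a *: v).
Proof.
move=> sg sv /weak_listE Hg; apply/weak_listE => phi tphi.
have tl := test_fun_pderivs l tphi.
have Z u1 psi : test_fun Omega psi -> sqint mu u1 ->
    \int[leb]_x (res (a *: u1) x * psi x) = a * \int[leb]_x (res u1 x * psi x).
  move=> tpsi s1; rewrite -RintegralZl//; last exact: integrable_test_res.
  apply: eq_Rintegral => x _; rewrite /res fscaleE.
  by move: (\1_Omega x) (u1 x) (psi x) => b c d; ring.
by rewrite !Z// Hg// mulrCA.
Qed.

Lemma weak_listB l g h v w : sqint mu g -> sqint mu h -> sqint mu v -> sqint mu w ->
  weak_list l g v -> weak_list l h w -> weak_list l (g - h) (v - w).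
Proof.
move=> sg sh sv sw Hg Hh; rewrite -(scaleN1r h) -(scaleN1r w).
by apply: weak_listD => //; [exact: sqintZ|exact: sqintZ|exact: weak_listZ].
Qed.

Lemma weak_list0_eq0 l v : sqint mu v -> weak_list l 0 v -> l2n mu v = 0.
Proof.
move=> sv /weak_listE H.
have [A A0 HA] := sqint_res; have [sr lr] := HA v sv.
have [B B0 HB] := sqint_unres.
have z : l2n leb (res v) = 0.
  apply: (test_fun_separating oOmega bOmega sr (res_out v)) => phi tphi.
  rewrite (@Rintegral_dom _ _ Omega (fun x => res v x * phi x)); last first.
    by move=> x nO; rewrite res_out// mul0r.
  have := H phi tphi; rewrite (_ : \int[leb]_x (res 0 x * _) = 0).
    by move/eqP; rewrite eq_sym mulf_eq0 signr_eq0 => /eqP.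
  transitivity (\int[leb]_x (0 : R)); last by rewrite Rintegral_cst// mul0r.
  by apply: eq_Rintegral => x _; rewrite /res mulr0 mul0r.
have [_] := HB v (sqint_measurable sv) sr.
by rewrite z mulr0 => le0; apply/eqP; rewrite eq_le le0 l2n_ge0.
Qed.

(** Makes the Sobolev norm independent of the representatives that [wD] picks. *)
Lemma weak_list_uniq l g v w : sqint mu g -> sqint mu v -> sqint mu w ->
  weak_list l g v -> weak_list l g w -> l2n mu v = l2n mu w.
Proof.
move=> sg sv sw Hv Hw.
have : l2n mu (v - w) = 0.
  apply: (@weak_list0_eq0 l); first exact: sqintB.
  by rewrite -(subrr g); apply: weak_listB.
move=> vw; have := l2n_triB sv sw.
by rewrite vw normr_le0 subr_eq0 => /eqP.
Qed.

Lemma weak_list_smooth l F : Ck (size l) Omega F -> weak_list l F (pderivs (rev l) F).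
Proof. by move=> CF phi tphi; exact: by_parts. Qed.

(** The order of two derivatives of a test function is irrelevant. *)
Lemma weak_list_perm2 l l' g v : (size l <= 2)%N -> perm_eq l l' ->
  weak_list l g v -> weak_list l' g v.
Proof.
move=> l2 pl Hl phi tphi; rewrite -(perm_size pl) -Hl//.
apply: eq_Rintegral => x _; congr (_ * _).
have [->//|[i [j [-> ->]]]] := perm_eq_le2 l2 pl.
exact: (@schwarz R n setT phi j i x openT (tphi.1 2%N) Logic.I).
Qed.

End weak_lists.
End density.

(** * The second-order Sobolev norm *)
Definition multi_list n (a : 'I_n -> nat) : seq 'I_n :=
  flatten [seq nseq (a i) i | i <- enum 'I_n].

Lemma size_multi_list n (a : 'I_n -> nat) : size (multi_list a) = mabs a.
Proof.
rewrite /multi_list size_flatten /shape -map_comp sumnE big_map enumT /mabs.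
by apply: eq_bigr => i _; rewrite /= size_nseq.
Qed.

Lemma count_multi_list n (a : 'I_n -> nat) i : count_mem i (multi_list a) = a i.
Proof.
rewrite /multi_list count_flatten -map_comp sumnE big_map enumT (bigD1 i)//=.
rewrite count_nseq/= eqxx mul1n big1 ?addn0// => j ji.
by rewrite count_nseq/= (negbTE ji).
Qed.

Lemma multi_list_count n (l : seq 'I_n) :
  perm_eq (multi_list (fun i => count_mem i l)) l.
Proof. by apply/allP => i _; rewrite /= count_multi_list. Qed.

Section sobolev_norm.
Context (R : realType) (n : nat) (Omega : set 'rV[R]_n).
Context (mu : {measure set 'rV[R]_n -> \bar R}).
Context (oOmega : open Omega) (bOmega : bounded_set Omega).
Context (muD : good_density Omega mu).
Implicit Types (g h v : 'rV[R]_n -> R).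

Notation leb := (leb R n).
Notation weak_list := (weak_list Omega).

Lemma weak_derivE a g v : weak_deriv Omega a g v <-> weak_list (multi_list a) g v.
Proof. by split=> H phi tphi; have := H phi tphi; rewrite size_multi_list. Qed.

Definition h2n g : R := fine (Hnorm Omega mu 2 g).

Definition h2const : R := #|{ffun 'I_n -> 'I_3}|%:R.

(** Up to length 2 the order of a list of directions is irrelevant, so lists can
  replace multi-indices. *)
Lemma Hp2P g : Hp Omega mu 2 g <->
  sqint mu g /\ forall l, (size l <= 2)%N -> exists v, sqint mu v /\ weak_list l g v.
Proof.
split=> -[sg H]; (split; first by []); [move=> l l2|move=> a a2].
  have pl := multi_list_count l.
  have [|v [sv wv]] := H (fun i => count_mem i l).
    by rewrite -size_multi_list (perm_size pl).
  exists v; split=> //; apply: (weak_list_perm2 _ (multi_list_count l)); last exact/weak_derivE.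
  by rewrite (perm_size (multi_list_count l)).
have [|v [sv wv]] := H (multi_list a); first by rewrite size_multi_list.
by exists v; split=> //; apply/weak_derivE.
Qed.

Lemma Hp_sqint p g : Hp Omega mu p g -> sqint mu g. Proof. by case. Qed.

Lemma wDP p g a : Hp Omega mu p g -> (mabs a <= p)%N ->
  sqint mu (wD Omega mu a g) /\ weak_list (multi_list a) g (wD Omega mu a g).
Proof.
move=> [_ /(_ a) H] /H ex; rewrite /wD.
have [v [sv wv]] := ex.
have [] := @xgetPex _ (cst 0) [set v | L2 mu v /\ weak_deriv Omega a g v] ex.
by split=> //; apply/weak_derivE.
Qed.

Lemma Hnorm_fin p g : Hp Omega mu p g ->
  Hnorm Omega mu p g = (\sum_(a : {ffun 'I_n -> 'I_p.+1} | (mabs (fun i => a i) <= p)%N)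
    l2n mu (wD Omega mu (fun i => a i) g))%:E.
Proof.
move=> Hg; rewrite /Hnorm -sumEFin; apply: eq_bigr => a a2.
by rewrite /L2norm Lnorm_l2n//; exact: (wDP Hg a2).1.
Qed.

Lemma Hnorm2E g : Hp Omega mu 2 g -> Hnorm Omega mu 2 g = (h2n g)%:E.
Proof. by move=> Hg; rewrite /h2n Hnorm_fin. Qed.

Lemma h2n_ge0 g : Hp Omega mu 2 g -> 0 <= h2n g.
Proof.
by move=> Hg; rewrite /h2n Hnorm_fin//= sumr_ge0// => a _; exact: l2n_ge0.
Qed.

Lemma h2n_ge l g v : Hp Omega mu 2 g -> (size l <= 2)%N -> sqint mu v ->
  weak_list l g v -> l2n mu v <= h2n g.
Proof.
move=> Hg l2 sv wv; have pl := multi_list_count l.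
have cl i : (count_mem i l < 3)%N by rewrite ltnS (leq_trans (count_size _ _)).
pose a : {ffun 'I_n -> 'I_3} := [ffun i => Ordinal (cl i)].
have aE : (fun i => a i : nat) = (fun i => count_mem i l).
  by apply/funext => i; rewrite ffunE.
have a2 : (mabs (fun i => a i) <= 2)%N by rewrite aE -size_multi_list (perm_size pl).
rewrite /h2n Hnorm_fin//= (bigD1 a)//= -[leLHS]addr0 lerD//; last first.
  by apply: sumr_ge0 => *; exact: l2n_ge0.
have [sw ww] := wDP Hg a2.
rewrite (weak_list_uniq oOmega bOmega muD (Hp_sqint Hg) sv sw wv)//.
apply: weak_list_perm2 ww; rewrite ?size_multi_list// aE//.
Qed.

Lemma l2n_h2n g : Hp Omega mu 2 g -> l2n mu g <= h2n g.
Proof.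
move=> Hg; apply: (@h2n_ge [::]) => //; first exact: Hp_sqint Hg.
by move=> phi tphi /=; rewrite expr0 mul1r.
Qed.

(** With [h2n_ge], the norm is equivalent to the largest L^2 norm of a weak
  derivative; [h2const] bounds the number of multi-indices. Knowing the norm up to
  constants is enough, and spares computing with the derivatives that [wD]
  picks. *)
Lemma h2n_le g (e : R) : Hp Omega mu 2 g -> 0 <= e ->
  (forall l, (size l <= 2)%N -> exists v, [/\ sqint mu v, weak_list l g v & l2n mu v <= e]) ->
  h2n g <= h2const * e.
Proof.
move=> Hg e0 H; rewrite /h2n Hnorm_fin//=.
apply: (@le_trans _ _ (\sum_(a : {ffun 'I_n -> 'I_3}) e)); last first.
  by rewrite sumr_const cardE -cardE mulr_natl.
rewrite big_mkcond/=; apply: ler_sum => a _; case: ifP => // a2.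
have [sw ww] := wDP Hg a2.
have [|v [sv wv ve]] := H (multi_list (fun i => a i)); first by rewrite size_multi_list.
by rewrite (weak_list_uniq oOmega bOmega muD (Hp_sqint Hg) sw sv ww).
Qed.

Lemma Hp2D g h : Hp Omega mu 2 g -> Hp Omega mu 2 h -> Hp Omega mu 2 (g + h).
Proof.
move=> /Hp2P[sg Hg] /Hp2P[sh Hh]; apply/Hp2P; split; first exact: sqintD.
move=> l l2; have [v [sv wv]] := Hg l l2; have [w [sw ww]] := Hh l l2.
by exists (v + w); split; [exact: sqintD|exact: (weak_listD oOmega bOmega muD)].
Qed.

Lemma Hp2Z (a : R) g : Hp Omega mu 2 g -> Hp Omega mu 2 (a *: g).
Proof.
move=> /Hp2P[sg Hg]; apply/Hp2P; split; first exact: sqintZ.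
move=> l l2; have [v [sv wv]] := Hg l l2.
by exists (a *: v); split; [exact: sqintZ|exact: (weak_listZ oOmega bOmega muD)].
Qed.

Lemma Hp2B g h : Hp Omega mu 2 g -> Hp Omega mu 2 h -> Hp Omega mu 2 (g - h).
Proof. by move=> Hg Hh; rewrite -scaleN1r; apply: Hp2D => //; exact: Hp2Z. Qed.

Lemma h2nD g h : Hp Omega mu 2 g -> Hp Omega mu 2 h ->
  h2n (g + h) <= h2const * (h2n g + h2n h).
Proof.
move=> Hg Hh; apply: h2n_le; first exact: Hp2D.
  by rewrite addr_ge0// h2n_ge0.
move=> l l2; have [sg /(_ l l2)[v [sv wv]]] := (Hp2P _).1 Hg.
have [sh /(_ l l2)[w [sw ww]]] := (Hp2P _).1 Hh.
exists (v + w); split; [exact: sqintD|exact: (weak_listD oOmega bOmega muD)|].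
by rewrite (le_trans (l2nD sv sw))// lerD//; [exact: h2n_ge wv|exact: h2n_ge ww].
Qed.

Lemma h2nZ (a : R) g : Hp Omega mu 2 g -> h2n (a *: g) <= h2const * (`|a| * h2n g).
Proof.
move=> Hg; apply: h2n_le; first exact: Hp2Z.
  by rewrite mulr_ge0// h2n_ge0.
move=> l l2; have [sg /(_ l l2)[v [sv wv]]] := (Hp2P _).1 Hg.
exists (a *: v); split; [exact: sqintZ|exact: (weak_listZ oOmega bOmega muD)|].
by rewrite l2nZ// ler_wpM2l//; exact: h2n_ge wv.
Qed.

Lemma sqint_bounded v (M : R) : measurable_fun setT v -> (forall x, `|v x| <= M) -> sqint mu v.
Proof.
move=> mv vM; have sM : sqint mu (cst M).
  apply: sqint_intro => //; rewrite (_ : (fun x => _) = cst (M ^+ 2)%:E)//.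
  rewrite integral_cst// lte_mul_pinfty ?lee_fin ?sqr_ge0//.
  exact: (mu_finite oOmega bOmega muD).
apply: (sqint_le mv sM _).1; apply: aeW => x; exact: le_trans (vM x) (ler_norm _).
Qed.

Lemma test_fun_Hp p phi : test_fun Omega phi -> Hp Omega mu p phi.
Proof.
move=> tphi.
have sP l : sqint mu (pderivs l phi).
  have t := test_fun_pderivs l tphi.
  have c : continuous (pderivs l phi) by move=> x; exact: (@smooth_continuous _ _ _ [::] t.1).
  have [r r0 out] := test_fun_bounded_out bOmega t.
  have [M M0 HM] := bounded_compact_support c out.
  apply: (sqint_bounded (M := M)) => //; exact: continuous_measurable_fun_rV.
split; first exact: (sP [::]).
move=> a _; exists (pderivs (rev (multi_list a)) phi); split; first exact: sP.
apply/weak_derivE; apply: weak_list_smooth => //.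
exact: (sub_Ck (@subsetT _ _) (tphi.1 _)).
Qed.

(** The constant sequence approximates a test function in H^1. *)
Lemma test_fun_H20 phi : test_fun Omega phi -> H20 Omega mu phi.
Proof.
move=> tphi; split; first exact: test_fun_Hp.
split; first exact: test_fun_Hp.
move=> e e0; exists phi; split=> //; rewrite subrr.
rewrite (_ : Hnorm _ _ _ _ = 0%E) ?lte_fin//.
have s0 : sqint mu 0 by exact: sqint0.
have H0 : Hp Omega mu 1 0.
  split=> // a _; exists 0; split=> //; apply/weak_derivE => psi _.
  have z (f : 'rV[R]_n -> R) : \int[leb]_(x in Omega) ((0 : 'rV[R]_n -> R) x * f x) = 0.
    rewrite /Rintegral integral0_eq// => x _; by rewrite mul0r.
  by rewrite !z mulr0.
rewrite Hnorm_fin//; congr EFin; apply: big1 => a a1.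
have [sw ww] := wDP H0 a1.
exact: (weak_list0_eq0 oOmega bOmega muD sw ww).
Qed.

End sobolev_norm.

(** * The Leibniz rule *)
(** The ways to distribute a list of directions between two factors. *)
Fixpoint splits (T : Type) (l : seq T) : seq (seq T * seq T) :=
  if l is i :: l' then
    [seq (i :: p.1, p.2) | p <- splits l'] ++ [seq (p.1, i :: p.2) | p <- splits l']
  else [:: ([::], [::])].

Lemma size_splits (T : eqType) (l : seq T) p : p \in splits l ->
  (size p.1 <= size l)%N /\ (size p.2 <= size l)%N.
Proof.
elim: l p => [|i l IH] p /=; first by rewrite inE => /eqP ->.
rewrite mem_cat => /orP[] /mapP[q /IH[h1 h2] ->] /=; split=> //; exact: leqW.
Qed.

Section leibniz.
Context (R : realType) (n : nat).
Implicit Types (f g psi : 'rV[R]_n -> R) (l : seq 'I_n) (v : seq 'I_n -> 'rV[R]_n -> R).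

(** The Leibniz expansion of the derivative along [l] of a product [psi * g],
  where the derivatives of [g] are replaced by given functions [v]. *)
Definition leib l psi v x : R :=
  \sum_(p <- splits l) pderivs p.1 psi x * v p.2 x.

Lemma leib_cons i l psi v x :
  leib (i :: l) psi v x =
  \sum_(p <- splits l) pderivs (i :: p.1) psi x * v p.2 x +
  \sum_(p <- splits l) pderivs p.1 psi x * v (i :: p.2) x.
Proof. by rewrite /leib /= big_cat !big_map. Qed.

Lemma eq_leib l psi v v' x : (forall b, (size b <= size l)%N -> v b x = v' b x) ->
  leib l psi v x = leib l psi v' x.
Proof.
move=> vv'; rewrite /leib big_seq [RHS]big_seq; apply: eq_bigr => p /size_splits[_ p2].
by rewrite vv'.
Qed.

Lemma leibB l psi v v' x :
  leib l psi (fun b => v b - v' b) x = leib l psi v x - leib l psi v' x.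
Proof. by rewrite /leib -sumrB; apply: eq_bigr => p _; rewrite fsubE mulrBr. Qed.

(** Only the split that differentiates nothing on the left survives when the
  first factor is locally 1. *)
Lemma leib1 l psi v x :
  (forall a, (size a <= size l)%N -> pderivs a psi x = (a == [::])%:R) -> leib l psi v x = v l x.
Proof.
elim: l v => [|i l IH] v H; first by rewrite /leib /= big_seq1 H// mul1r.
rewrite leib_cons big_seq big1 => [|p /size_splits[p1 _]]; last first.
  by rewrite H// mul0r.
by rewrite add0r -/(leib l psi (fun b => v (i :: b)) x) IH// => a al; apply: H; exact: leqW.
Qed.

Lemma leibniz l U f g : open U -> Ck (size l) U f -> Ck (size l) U g ->
  forall x, U x -> pderivs l (f * g) x = leib l f (fun b => pderivs b g) x.
Proof.
move=> oU; elim: l => [|i l IH] Cf Cg x Ux; first by rewrite /leib /= big_seq1.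
have -> : pderivs (i :: l) (f * g) x = pderiv i (leib l f (fun b => pderivs b g)) x.
  apply: (@eq_pderivs _ _ U [:: i] _ _ oU _ x Ux) => y Uy.
  by apply: IH => //; [exact: le_Ck Cf|exact: le_Ck Cg].
have dr p : p \in splits l -> derivable (pderivs p.1 f) x (delta_mx 0 i) /\
    derivable (pderivs p.2 g) x (delta_mx 0 i).
  by move=> /size_splits[h1 h2]; split; [exact: Cf.1|exact: Cg.1].
rewrite leib_cons -big_split /=.
have -> : leib l f (fun b => pderivs b g) =
    \sum_(p <- splits l) (pderivs p.1 f * pderivs p.2 g).
  by apply/funext => y; rewrite /leib fct_sumE.
move: dr; elim: (splits l) => [|p r IHr] dr.
  by rewrite !big_nil /pderiv derive_cst.
have [d1 d2] := dr p (mem_head _ _).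
have dr' q : q \in r -> derivable (pderivs q.1 f) x (delta_mx 0 i) /\
    derivable (pderivs q.2 g) x (delta_mx 0 i).
  by move=> qr; apply: dr; rewrite inE qr orbT.
rewrite !big_cons -IHr// /pderiv deriveD; last 2 first.
- exact: derivableM.
- elim: r dr' {IHr dr} => [|q r IHr] dr'; first by rewrite big_nil; exact: derivable_cst.
  have [q1 q2] := dr' q (mem_head _ _).
  rewrite big_cons; apply: derivableD; first exact: derivableM.
  by apply: IHr => q' q'r; apply: dr'; rewrite inE q'r orbT.
congr (_ + _); rewrite deriveM//= addrC; congr (_ + _); by rewrite /GRing.scale/= mulrC.
Qed.

(** There are finitely many lists of length at most [k]. *)
Lemma near_lists (F : set_system R) (FF : Filter F) (P : seq 'I_n -> R -> Prop) k :
  (forall l, (size l <= k)%N -> \forall e \near F, P l e) ->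
  \forall e \near F, forall l, (size l <= k)%N -> P l e.
Proof.
elim: k P => [|k IH] P H.
  by apply: filterS (H [::] isT) => e Pe l; rewrite leqn0 => /nilP ->.
have Hi (i : 'I_n) : \forall e \near F, forall l, (size l <= k)%N -> P (i :: l) e.
  by apply: (IH (fun l => P (i :: l))) => l lk; exact: H.
have := filter_forall FF Hi; apply: filterS2 (H [::] isT) => e P0 Pi [|i l]//= lk.
exact: Pi.
Qed.

End leibniz.

Section fatou.
Context d (T : measurableType d) (R : realType) (mu : {measure set T -> \bar R}).

(** Fatou's lemma for the squares. *)
Lemma l2n_fatou (u_ : (T -> R)^nat) u (e : R) : (forall k, sqint mu (u_ k)) ->
  (forall x, u_ ^~ x @ \oo --> u x) -> (forall k, l2n mu (u_ k) <= e) ->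
  sqint mu u /\ l2n mu u <= e.
Proof.
move=> su cu ue; have e0 : 0 <= e := le_trans (l2n_ge0 _ _) (ue 0%N).
have m_ k := sqint_measurable (su k).
have mu0 : measurable_fun setT u.
  by apply: (measurable_fun_cvg m_) => x _; exact: cu.
have le : (\int[mu]_x (u x ^+ 2)%:E <= (e ^+ 2)%:E)%E.
  have -> : (\int[mu]_x (u x ^+ 2)%:E = \int[mu]_x limn_einf (fun k => (u_ k x ^+ 2)%:E))%E.
    apply: eq_integral => x _.
    have c : (u_ k x ^+ 2)%:E @[k --> \oo] --> (u x ^+ 2)%:E.
      by apply: cvg_EFin; [exact: nearW|apply: cvgM; exact: cu].
    by rewrite (cvg_limn_einf_sup c).1.
  apply: le_trans (fatou _ _ _ _) _ => //.
  - by move=> k; apply/measurable_EFinP; exact: measurable_funX.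
  - by move=> k x _; rewrite lee_fin sqr_ge0.
  - rewrite limn_einf_lim; apply: lime_le; first exact: is_cvg_einfs.
    apply: nearW => k; apply: (@le_trans _ _ (\int[mu]_x (u_ k x ^+ 2)%:E)%E).
      by apply: ereal_inf_lbound; exists k => /=.
    rewrite sqint_ge0_fin// lee_fin.
    by rewrite ler_pXn2r ?nnegrE ?l2n_ge0.
have su0 : sqint mu u by apply: sqint_intro => //; apply: le_lt_trans le (ltry _).
split=> //; move: le; rewrite sqint_ge0_fin// lee_fin.
by rewrite ler_pXn2r ?nnegrE ?l2n_ge0.
Qed.

End fatou.

(** * The Meyers-Serrin theorem *)
Lemma size_splits_gt0 (T : Type) (l : seq T) : (0 < size (splits l))%N.
Proof. by elim: l => //= i l IH; rewrite size_cat !size_map addn_gt0 IH. Qed.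

Lemma pderivs_cst (R : realType) n (a : seq 'I_n) (c : R) : a != [::] ->
  pderivs a (cst c : 'rV[R]_n -> R) = cst 0.
Proof.
elim/last_ind: a => // a i _ _; rewrite pderivs_rcons.
rewrite (_ : pderiv i (cst c) = cst 0) ?pderivs_zero//.
by apply/funext => x; rewrite /pderiv derive_cst.
Qed.

Section meyers_serrin.
Context (R : realType) (n : nat) (Omega : set 'rV[R]_n).
Context (mu : {measure set 'rV[R]_n -> \bar R}).
Context (oOmega : open Omega) (bOmega : bounded_set Omega).
Context (muD : good_density Omega mu).
Implicit Types (f h w : 'rV[R]_n -> R) (l a : seq 'I_n).

Notation leb := (leb R n).
Notation weak_list := (weak_list Omega).
Notation res := (res Omega).
Notation inner := (inner Omega).
Notation cutoff := (cutoff Omega).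

(** The mollifier centred at [x] is an admissible test function as soon as its
  support is inside the domain, and testing against it is convolving. *)
Lemma pderivs_conv_weak e r x l f w : 0 < e -> e < r -> inner r x ->
  sqint mu f -> sqint mu w -> weak_list l f w ->
  pderivs l (conv (moll e) (res f)) x = conv (moll e) (res w) x.
Proof.
move=> e0 er xr sf sw /weak_listE H.
rewrite pderivs_conv; [|exact: bsmooth_moll|exact: (integrable_res oOmega bOmega muD)].
have t := test_fun_moll e0 er xr.
have sgn b : (-1 : R) ^+ b * (-1) ^+ b = 1 by rewrite -expr2 sqrr_sign.
have := H _ t; rewrite /conv.
have -> : \int[leb]_y (res f y * pderivs l (fun z => moll e (x - z)) y) =
    (-1) ^+ size l * \int[leb]_y (pderivs l (moll e) (x - y) * res f y).
  rewrite -(@RintegralZl _ _ _ leb setT (fun y => pderivs l (moll e) (x - y) * res f y))//.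
    apply: eq_Rintegral => y _; rewrite pderivs_reflect; last exact: moll_smooth.
    by rewrite [LHS]mulrC mulrA.
  apply: bsmooth_conv_integrable; first exact/bsmooth_pderivs/bsmooth_moll.
  exact: (integrable_res oOmega bOmega muD).
move=> /(congr1 (fun t => (-1) ^+ size l * t)); rewrite !mulrA !sgn !mul1r => ->.
by apply: eq_Rintegral => y _; rewrite mulrC.
Qed.

Let rj j : R := j.+1%:R^-1.

Let rj0 j : 0 < rj j. Proof. by rewrite invr_gt0. Qed.

Let le_rj j k : (j <= k)%N -> rj k <= rj j.
Proof. by move=> jk; rewrite lef_pV2 ?posrE// ler_nat. Qed.

(** A partition of unity on the domain subordinate to an exhaustion. *)
Definition unity j : 'rV[R]_n -> R :=
  cutoff (rj j) - (if j is j'.+1 then cutoff (rj j') else 0).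

Lemma sum_unity N : \sum_(j < N.+1) unity j = cutoff (rj N).
Proof.
elim: N => [|N IH]; first by rewrite big_ord1 /unity subr0.
by rewrite big_ord_recr/= IH /unity addrC subrK.
Qed.

Lemma unity_smooth j : smooth (unity j).
Proof.
case: j => [|j] k; rewrite /unity; last first.
  by apply: (CkB openT); exact: cutoff_smooth.
by rewrite subr0; exact: cutoff_smooth.
Qed.

Lemma unity_out a j x : ~ inner (rj j) x -> pderivs a (unity j) x = 0.
Proof.
move=> xj; have oU : open (~` inner (rj j)) by apply: closed_openC; exact: closed_inner.
rewrite (@eq_pderivs _ _ _ a (unity j) (cst 0) oU _ x xj) ?pderivs_zero// => y yj.
rewrite /unity fsubE cutoff0// sub0r; case: j yj {oU xj} => [|j] yj; first by rewrite oppr0.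
rewrite cutoff0 ?oppr0// => /(le_inner _) y'; apply: yj; apply: y'.
exact: le_rj.
Qed.

Lemma unity_bounded a j : exists M : R, forall x, `|pderivs a (unity j) x| <= M.
Proof.
have cb r : 0 < r -> exists M : R, forall x, `|pderivs a (cutoff r) x| <= M.
  by move=> r0; have [C _ HC] := cutoff_bound oOmega bOmega a; eexists => x; exact: HC.
have [M HM] := cb _ (rj0 j).
case: j HM => [|j] HM; first by exists M; rewrite /unity subr0.
have [M' HM'] := cb _ (rj0 j); exists (M + M') => x.
rewrite /unity (CkB_pderivs openT)//; [|exact: cutoff_smooth..].
by rewrite (le_trans (ler_normB _ _))// lerD.
Qed.

(** Local finiteness of the partition of unity: near [x] the pieces [unity k]
  vanish for large [k]. *)
Lemma cutoff_near1 x : Omega x -> exists N V, [/\ open V, V x, V `<=` Omega &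
  forall y k, V y -> (N <= k)%N -> cutoff (rj k) y = 1].
Proof.
move=> Ox; have /nbhs_ballP[e /= e0 xe] : nbhs x Omega by exact: open_nbhs_nbhs.
have e20 : 0 < e / 2 by rewrite divr_gt0.
pose N := Num.truncn ((e / 2 / 3)^-1).
exists N, (ball x (e / 2)); split; [exact: ball_open|exact: ballxx| |].
  by move=> y xy; apply: xe; apply: le_ball xy; rewrite ler_pdivrMr// ler_peMr ?ler1n// ltW.
move=> y k xy Nk; apply: cutoff1 => // z yz; apply: xe.
have zy : ball y (e / 2) z.
  apply: le_ball yz; rewrite -[leLHS]mulr_natr -ler_pdivlMr//.
  apply: le_trans (le_rj Nk) _; rewrite -[leRHS]invrK lef_pV2 ?posrE ?invr_gt0 ?divr_gt0//.
  apply: ltW; apply: truncnS_gt.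
by have := ball_triangle xy zy; rewrite -splitr.
Qed.

Lemma leib_out l j v x : ~ inner (rj j) x -> leib l (unity j) v x = 0.
Proof. by move=> xj; rewrite /leib big1// => p _; rewrite unity_out// mul0r. Qed.

(** Representatives in H^2 that are smooth inside the domain; their weak
  derivatives are the classical ones. *)
Definition smoothH2 G := [/\ smooth_on Omega G, sqint mu G &
  forall l, (size l <= 2)%N -> sqint mu (res (pderivs l G))].

Lemma smoothH2_weak l G : smoothH2 G -> (size l <= 2)%N ->
  weak_list l G (res (pderivs l G)).
Proof.
move=> [sG _ _] l2; apply: (@weak_list_perm2 _ _ _ (rev l)); rewrite ?size_rev// ?perm_rev//.
move=> phi tphi; have := @weak_list_smooth _ _ _ oOmega bOmega (rev l) G (sG _) phi tphi.
rewrite revK => ->; congr (_ * _); apply: eq_Rintegral => x; rewrite inE => Ox.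
by rewrite res_in.
Qed.

Lemma smoothH2_Hp G : smoothH2 G -> Hp Omega mu 2 G.
Proof.
move=> SG; have [sG s sD] := SG; apply/Hp2P; split=> // l l2.
by exists (res (pderivs l G)); split; [exact: sD|exact: smoothH2_weak].
Qed.

Lemma smoothH2D G H : smoothH2 G -> smoothH2 H -> smoothH2 (G + H).
Proof.
move=> [sG s sD] [sG' s' sD']; split=> [k||l l2].
- by apply: CkD.
- exact: sqintD.
rewrite (_ : res (pderivs l (G + H)) = res (pderivs l G) + res (pderivs l H)).
  by apply: sqintD; [exact: sD|exact: sD'].
apply/funext => x; rewrite faddE; have [Ox|nO] := pselect (Omega x).
  by rewrite !res_in// (CkD_pderivs oOmega).
by rewrite !res_out// addr0.
Qed.

Section approximation.
Context (g : 'rV[R]_n -> R) (v : seq 'I_n -> 'rV[R]_n -> R) (v0 : v [::] = g).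
Hypothesis sv : forall l, (size l <= 2)%N -> sqint mu (v l).
Hypothesis wv : forall l, (size l <= 2)%N -> weak_list l g (v l).

Let err e b : 'rV[R]_n -> R := res (v b) - conv (moll e) (res (v b)).

Let sg : sqint mu g. Proof. by rewrite -v0; exact: sv. Qed.

(** The derivatives of [unity j] are bounded, and the mollifications of the finitely
  many weak derivatives converge in L^2. *)
Lemma mollify_piece (d : R) j : 0 < d -> exists e, 0 < e < rj j /\
  forall l, (size l <= 2)%N ->
    sqint leb (leib l (unity j) (err e)) /\ l2n leb (leib l (unity j) (err e)) <= d.
Proof.
move=> d0.
have [A _ HA] := sqint_res oOmega muD.
have serr e b : 0 < e -> (size b <= 2)%N -> sqint leb (err e b).
  move=> e0 b2; have [s _] := HA _ (sv b2).
  apply: sqintB => //; apply: (conv_l2 e0 _ s).1.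
  exact: (integrable_res oOmega bOmega muD (sv b2)).
have nerr b (t : R) : 0 < t -> (size b <= 2)%N -> \forall e \near 0^'+, l2n leb (err e b) <= t.
  move=> t0 b2; have [s _] := HA _ (sv b2).
  have [r r0 Hr] := moll_approx_sqint oOmega (leb_bounded_lty bOmega (open_measurable_rV oOmega)) s (@res_out _ _ _ _) t0.
  near=> e; rewrite /err -l2nN opprB; apply: Hr; apply/andP; split.
    by near: e; exact: nbhs_right_gt.
  by near: e; exact: nbhs_right_le.
suff : \forall e \near 0^'+, forall l, (size l <= 2)%N ->
    sqint leb (leib l (unity j) (err e)) /\ l2n leb (leib l (unity j) (err e)) <= d.
  move=> H; have : \forall e \near 0^'+, 0 < e < rj j /\ forall l, (size l <= 2)%N ->
    sqint leb (leib l (unity j) (err e)) /\ l2n leb (leib l (unity j) (err e)) <= d.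
    near=> e; split; last by near: e.
    by apply/andP; split; near: e; [exact: nbhs_right_gt|exact: nbhs_right_lt].
  by move=> /filter_ex.
apply: near_lists => l l2.
have [M [M0 HM]] : exists M : R, 0 < M /\ forall p x, p \in splits l -> `|pderivs p.1 (unity j) x| <= M.
  elim: (splits l) => [|p s [M [M0 HM]]]; first by exists 1; split.
  have [M' HM'] := unity_bounded p.1 j; exists (Num.max M M'); split.
    by rewrite lt_max M0.
  move=> q x; rewrite inE => /orP[/eqP ->|qs]; rewrite le_max; first by rewrite HM' orbT.
  by rewrite HM.
have piece e b p : 0 < e -> (size b <= 2)%N -> p \in splits l ->
    sqint leb (fun x => pderivs p.1 (unity j) x * err e b x) /\
    l2n leb (fun x => pderivs p.1 (unity j) x * err e b x) <= M * l2n leb (err e b).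
  move=> e0 b2 pl; apply: sqintM_bounded.
  - by apply: smooth_measurable; exact: unity_smooth.
  - by move=> x; exact: HM.
  - exact: serr.
pose K := (size (splits l))%:R : R.
have K0 : 0 < K by rewrite ltr0n size_splits_gt0.
near=> e.
have e0 : 0 < e by near: e; exact: nbhs_right_gt.
have lE : leib l (unity j) (err e) =
    \sum_(p <- splits l | p \in splits l) (fun x => pderivs p.1 (unity j) x * err e p.2 x).
  by apply/funext => x; rewrite /leib big_seq fct_sumE.
have p2 p : p \in splits l -> (size p.2 <= 2)%N by move=> /size_splits[_ /leq_trans]; apply.
rewrite lE; split.
  by apply: sqint_sum => p pl; apply: (piece _ _ _ e0 (p2 p pl) pl).1.
apply: le_trans (l2n_sum _ _) _.
  by move=> p pl; apply: (piece _ _ _ e0 (p2 p pl) pl).1.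
apply: (@le_trans _ _ (\sum_(p <- splits l | p \in splits l) (d / K))); last first.
  by rewrite -big_seq big_const_seq count_predT iter_addr_0 -mulr_natr -/K divfK ?gt_eqF.
have small : forall b, (size b <= 2)%N -> l2n leb (err e b) <= d / K / M.
  near: e; apply: near_lists => b b2; apply: nerr => //.
  by rewrite !divr_gt0.
apply: ler_sum => p pl; apply: le_trans (piece _ _ _ e0 (p2 p pl) pl).2 _.
by rewrite mulrC -ler_pdivlMr//; exact/small/p2.
Unshelve. all: by end_near. Qed.

(** The theorem of Meyers and Serrin: glue mollifications of ever smaller
  radius along the partition of unity, so that the errors are summable. *)
Lemma meyers_serrin_leb (d : R) : 0 < d -> exists G : 'rV[R]_n -> R,
  [/\ smooth_on Omega G, forall x, ~ Omega x -> G x = 0 &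
   forall l, (size l <= 2)%N -> sqint leb (res (v l - pderivs l G)) /\
     l2n leb (res (v l - pderivs l G)) <= d].
Proof.
move=> d0.
have [eps Heps] := @choice _ _ (fun j e => 0 < e < rj j /\
  forall l, (size l <= 2)%N -> sqint leb (leib l (unity j) (err e)) /\
    l2n leb (leib l (unity j) (err e)) <= d / 2 ^+ j.+1) (fun j => mollify_piece j (divr_gt0 d0 (exprn_gt0 j.+1 (ltr0n _ 2)))).
pose u j := conv (moll (eps j)) (res g).
have e0 j : 0 < eps j by have [/andP[]] := Heps j.
have er j : eps j < rj j by have [/andP[]] := Heps j.
have us j : smooth (u j).
  by apply: smooth_conv; [exact: bsmooth_moll|exact: (integrable_res oOmega bOmega muD sg)].
have pus j : smooth (unity j * u j).
  by move=> k; apply: (CkM openT); [exact: unity_smooth|exact: us].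
pose S N : 'rV[R]_n -> R := \sum_(j < N) (unity j * u j).
have sS N : smooth (S N) by move=> k; apply: (@Ck_sum _ _ _ _ _ k setT _ openT) => j _; exact: pus.
(* Near each point of the domain the sequence of partial sums is stationary. *)
pose G x := limn (fun N => S N x).
have GS N x : (forall k, (N < k)%N -> unity k x = 0) -> forall k, (N < k)%N -> G x = S k x.
  move=> H k Nk; rewrite /G; apply: (@lim_near_cst _ _ _ \oo) => //.
  have ext m : (N < m)%N -> S m x = S N.+1 x.
    move=> Nm; rewrite -(subnK Nm); elim: (m - N.+1)%N => // q IH.
    rewrite addSn /S big_ord_recr/= faddE fmulE H ?mul0r ?addr0//.
    by rewrite ltn_addl.
  by exists N.+1 => // m /= Nm; rewrite (ext m)// (ext k).
have loc x : Omega x -> exists N V, [/\ open V, V x, V `<=` Omega,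
    forall y k, V y -> (N < k)%N -> G y = S k y &
    forall y k, V y -> (N < k)%N -> (\sum_(j < k) unity j) y = 1].
  move=> /cutoff_near1[N [V [oV Vx VO H]]]; exists N, V; split=> // y k Vy Nk.
    apply: (GS N) => // {Nk}k Nk; rewrite /unity; case: k Nk => // k Nk.
    by rewrite fsubE !H ?subrr// ltnW.
  by case: k Nk => // k Nk; rewrite sum_unity H.
exists G; split=> [k|x nO|l l2].
- apply: Ck_local => x /loc[N [V [oV Vx VO GV _]]].
  exists V, (S N.+1); split=> //; first exact: sub_Ck (sS _ _).
  by move=> y Vy; exact: GV.
- have z k : unity k x = 0 by apply: (@unity_out [::]) => /(inner_sub (rj0 _)).
  rewrite (GS 0%N x _ 1%N)//.
  by rewrite /S big_ord1 fmulE z mul0r.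
(* The derivative of the error along l is the sum of the E j, because the
   partition of unity sums to 1. *)
pose E j := leib l (unity j) (err (eps j)).
have [A _ HA] := sqint_res oOmega muD.
apply: (@l2n_fatou _ _ _ _ (fun N => \sum_(j < N) E j)).
- by move=> N; apply: sqint_sum => j _; exact: ((Heps j).2 l l2).1.
- move=> x; apply: cvg_near_cst.
  have [Ox|nO] := pselect (Omega x); last first.
    apply: nearW => N; rewrite fct_sumE big1 ?res_out// => j _.
    by rewrite /E leib_out// => /(inner_sub (rj0 _)).
  have [N [V [oV Vx VO GV V1]]] := loc x Ox.
  exists N.+1 => // k /= Nk; rewrite fct_sumE res_in// fsubE.
  have -> : pderivs l G x = \sum_(j < k) leib l (unity j) (fun b => conv (moll (eps j)) (res (v b))) x.
    rewrite (@eq_pderivs _ _ V l _ (S k) oV _ x Vx); last by move=> y Vy; exact: GV.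
    rewrite /S (@Ck_sum_pderivs _ _ _ _ _ setT _ openT)//; last by move=> j; exact: pus.
    apply: eq_bigr => j _; rewrite (leibniz openT)//; [|exact: unity_smooth|exact: us].
    have [xj|xj] := pselect (inner (rj j) x); last by rewrite !leib_out.
    apply: eq_leib => b bl; apply: (pderivs_conv_weak (e0 j) (er j) xj sg).
      by apply: sv; exact: leq_trans bl l2.
    by apply: wv; exact: leq_trans bl l2.
  have -> : v l x = \sum_(j < k) leib l (unity j) (fun b => res (v b)) x.
    rewrite -(res_in _ Ox) -(@leib1 _ _ l (\sum_(j < k) unity j) (fun b => res (v b))).
      rewrite /leib [RHS]exchange_big/=; apply: eq_bigr => p _.
      rewrite (@Ck_sum_pderivs _ _ _ _ _ setT _ openT)//; last by move=> j; exact: unity_smooth.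
      by rewrite mulr_suml.
    move=> a _; rewrite (@eq_pderivs _ _ V a _ (cst 1) oV _ x Vx); last by move=> y Vy; exact: V1.
    by case: a => // i a; rewrite pderivs_cst.
  rewrite -sumrB; apply: eq_bigr => j _.
  by rewrite /E -leibB.
- move=> N; apply: le_trans (l2n_sum _ _) _ => [j _|]; first exact: ((Heps j).2 l l2).1.
  apply: (@le_trans _ _ (\sum_(j < N) (d / 2 ^+ j.+1))).
    by apply: ler_sum => j _; exact: ((Heps j).2 l l2).2.
  suff -> : \sum_(j < N) (d / 2 ^+ j.+1) = d * (1 - 2 ^- N).
    by rewrite ler_piMr ?(ltW d0)// gerBl invr_ge0 exprn_ge0.
  elim: N => [|N IH]; first by rewrite big_ord0 expr0 invr1 subrr mulr0.
  rewrite big_ord_recr/= IH exprS invfM.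
  by move: (2 ^- N) => t; field.
Qed.

End approximation.

Theorem meyers_serrin g (e : R) : Hp Omega mu 2 g -> 0 < e ->
  exists2 G, smoothH2 G & h2n Omega mu (g - G) <= e.
Proof.
move=> Hg e0; have [sg H] := (Hp2P Omega mu g).1 Hg.
have [v Hv] : exists v : seq 'I_n -> 'rV[R]_n -> R, v [::] = g /\
    forall l, (size l <= 2)%N -> sqint mu (v l) /\ weak_list l g (v l).
  have [v Hv] := @choice _ _ (fun l w => (size l <= 2)%N -> sqint mu w /\ weak_list l g w)
    (fun l => ltac:(by have [/H[w Hw]|?] := boolP (size l <= 2)%N; [exists w|exists 0])).
  exists (fun l => if l is [::] then g else v l); split=> // -[_|i l l2]; last exact: Hv.
  by split=> // phi tphi /=; rewrite expr0 mul1r.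
have [v0 {}Hv] := Hv.
have [A A0 HA] := sqint_unres oOmega muD.
have C0 : 0 < A * (h2const R n + 1) by rewrite mulr_gt0// ltr_wpDl// ler0n.
have [G [sG G0 HG]] := meyers_serrin_leb v0 (fun l lt2 => (Hv l lt2).1)
  (fun l lt2 => (Hv l lt2).2) (divr_gt0 e0 C0).
pose D l : 'rV[R]_n -> R := res (pderivs l G).
have mD l : measurable_fun setT (D l).
  apply: (measurable_res oOmega).
  apply: open_continuous_measurable_fun_rV => // x Ox.
  exact: (sG (size l)).2.
have vD l : (size l <= 2)%N -> sqint mu (v l - D l) /\ l2n mu (v l - D l) <= e / (h2const R n + 1).
  move=> l2; have [s le] := HG l l2; have [sl _] := Hv l l2.
  have E : res (v l - D l) = res (v l - pderivs l G).
    apply/funext => x; have [Ox|nO] := pselect (Omega x); last by rewrite !res_out.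
    by rewrite !res_in// !fsubE /D res_in.
  have mvD : measurable_fun setT (v l - D l).
    by apply: measurable_funB; [exact: (sqint_measurable sl)|exact: mD].
  have [|s' le'] := HA _ mvD; first by rewrite E.
  split=> //; apply: le_trans le' _; rewrite E.
  apply: (@le_trans _ _ (A * (e / (A * (h2const R n + 1))))).
    by rewrite ler_wpM2l// ltW.
  by rewrite invfM mulrCA mulVKf ?gt_eqF.
have sD l : (size l <= 2)%N -> sqint mu (D l).
  move=> l2; rewrite (_ : D l = v l - (v l - D l)).
    by apply: sqintB; [exact: (Hv l l2).1|exact: (vD l l2).1].
  by rewrite opprB addrCA subrr addr0.
have GD : G = D [::].
  by apply/funext => x; rewrite /D; have [Ox|nO] := pselect (Omega x); [rewrite res_in|rewrite res_out ?G0].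
have SG : smoothH2 G by split=> //; rewrite GD; exact: sD.
have wD l : (size l <= 2)%N -> weak_list l G (D l) by exact: smoothH2_weak.
have HG2 := smoothH2_Hp SG.
exists G => //.
have HgG : Hp Omega mu 2 (g - G) by exact: Hp2B.
apply: le_trans (h2n_le oOmega bOmega muD HgG (e := e / (h2const R n + 1)) _ _) _.
- by rewrite divr_ge0 ?ltW// ltr_wpDl// ler0n.
- move=> l l2; have [s le] := vD l l2; exists (v l - D l); split=> //.
  have [sv wv] := Hv l l2.
  by apply: (weak_listB oOmega bOmega muD) => //; [rewrite GD; exact: sD|exact: sD|exact: wD].
have h0 : 0 <= h2const R n by exact: ler0n.
rewrite mulrCA ler_piMr ?(ltW e0)// ler_pdivrMr ?mul1r ?lerDl//.
by rewrite ltr_wpDl.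
Qed.

End meyers_serrin.

(** * Error of a cutoff near the boundary *)
Lemma sum_splits (T : eqType) (l : seq T) p : p \in splits l ->
  (size p.1 + size p.2 = size l)%N.
Proof.
elim: l p => [|i l IH] p /=; first by rewrite inE => /eqP ->.
by rewrite mem_cat => /orP[] /mapP[q /IH <- ->] /=; rewrite ?addSn ?addnS.
Qed.

Section dot.
Context d (T : measurableType d) (R : realType) (mu : {measure set T -> \bar R}).
Implicit Types u v w : T -> R.

Definition ldot u v : R := \int[mu]_x (u x * v x).

Lemma ldotC u v : ldot u v = ldot v u.
Proof. by apply: eq_Rintegral => x _; rewrite mulrC. Qed.

Lemma ldotD u v w : sqint mu u -> sqint mu v -> sqint mu w ->
  ldot u (v + w) = ldot u v + ldot u w.
Proof.
move=> su sv sw; rewrite /ldot -RintegralD//; [|exact: sqintM_integrable..].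
by apply: eq_Rintegral => x _; rewrite faddE mulrDr.
Qed.

Lemma ldotZ (a : R) u v : sqint mu u -> sqint mu v -> ldot u (a *: v) = a * ldot u v.
Proof.
move=> su sv; rewrite /ldot.
rewrite -(@RintegralZl _ _ _ mu setT (fun x => u x * v x))//; last exact: sqintM_integrable.
by apply: eq_Rintegral => x _; rewrite fscaleE mulrCA.
Qed.

Lemma ldotB u v w : sqint mu u -> sqint mu v -> sqint mu w ->
  ldot u (v - w) = ldot u v - ldot u w.
Proof.
move=> su sv sw; rewrite ldotD//; last exact: sqintN.
by rewrite -scaleN1r ldotZ// mulN1r.
Qed.

Lemma ldotBl u v w : sqint mu u -> sqint mu v -> sqint mu w ->
  ldot (u - v) w = ldot u w - ldot v w.
Proof. by move=> su sv sw; rewrite ldotC ldotB// !(ldotC w). Qed.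

Lemma ldot_le u v : sqint mu u -> sqint mu v -> `|ldot u v| <= l2n mu u * l2n mu v.
Proof. exact: cauchy_schwarz_int. Qed.

Lemma ldot_cs u v : sqint mu u -> sqint mu v -> ldot u v <= l2n mu u * l2n mu v.
Proof. by move=> su sv; apply: le_trans (ler_norm _) _; exact: ldot_le. Qed.

End dot.

Section lists2.
Context (n : nat).

(** The lists of length at most 2, in the order of the terms of the pointwise
  Lipschitz bound on the operator. *)
Definition lists2 : seq (seq 'I_n) := [::] ::
  [seq [:: i] | i <- index_enum 'I_n] ++
  [seq [:: i; j] | i <- index_enum 'I_n, j <- index_enum 'I_n].

Lemma mem_lists2 l : (l \in lists2) = (size l <= 2)%N.
Proof.
rewrite /lists2 inE mem_cat; case: l => [|i [|j [|k l]]] //=.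
- by rewrite map_f ?mem_index_enum.
- by rewrite (allpairs_f (fun i j => [:: i; j])) ?mem_index_enum// orbT.
- by apply/orP => -[/mapP[? _ //]|/allpairsP[? [_ _ //]]].
Qed.

Lemma uniq_lists2 : uniq lists2.
Proof.
rewrite /lists2 cons_uniq; apply/andP; split.
  by rewrite mem_cat; apply/norP; split; apply/negP; [move=> /mapP[]|move=> /allpairsP[? []]].
rewrite cat_uniq; apply/and3P; split.
- by rewrite map_inj_uniq ?index_enum_uniq// => i j [].
- by apply/hasPn => l /allpairsP[p [_ _ ->]]; apply/mapP => -[].
- by apply: allpairs_uniq; rewrite ?index_enum_uniq// => -[i j] [i' j'] _ _ /= [-> ->].
Qed.

Lemma big_lists2 (R : realType) (F : seq 'I_n -> R) : \sum_(l <- lists2) F l =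
  F [::] + (\sum_(i < n) F [:: i] + \sum_(i < n) \sum_(j < n) F [:: i; j]).
Proof. by rewrite big_cons big_cat big_map big_allpairs_dep. Qed.

End lists2.

Section operator.
Context (R : realType) (n : nat) (Omega : set 'rV[R]_n).
Context (mu : {measure set 'rV[R]_n -> \bar R}).
Context (oOmega : open Omega) (bOmega : bounded_set Omega).
Context (muD : good_density Omega mu).
Context (L : ('rV[R]_n -> R) -> ('rV[R]_n -> R)).
Hypothesis HL : lipschitz_operator Omega mu L.
Implicit Types (f g h u v : 'rV[R]_n -> R) (r : R).

Notation res := (res Omega).
Notation inner := (inner Omega).
Notation cutoff := (cutoff Omega).
Notation H2 := (Hp Omega mu 2).
Notation h2n := (h2n Omega mu).
Notation l2n := (l2n mu).
Notation smoothH2 := (smoothH2 Omega mu).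

Let mOmega : measurable Omega. Proof. exact: open_measurable_rV. Qed.

Lemma sqint_op g : H2 g -> sqint mu (L g). Proof. by case: HL => _ _ + _ => /(_ g). Qed.

Lemma op_lipschitz_pointwise : exists2 C : R, 0 <= C & forall f1 f2,
  H2 f1 -> Ck 2 Omega f1 -> H2 f2 -> Ck 2 Omega f2 -> forall x, Omega x ->
  `|L f1 x - L f2 x| <= C * \sum_(l <- lists2 n) `|pderivs l f1 x - pderivs l f2 x|.
Proof.
have [[C HC] _ _ _] := HL; exists `|C| => // f1 f2 H1 C1 H2 C2 x Ox.
apply: le_trans (HC f1 f2 H1 C1 H2 C2 x Ox) _; rewrite big_lists2 /=.
set X := `|f1 x - f2 x|; set Y := \sum_(i < n) _; set Z := \sum_(i < n) _.
have X0 : 0 <= X by exact: normr_ge0.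
have Y0 : 0 <= Y by exact: sumr_ge0.
have Z0 : 0 <= Z by apply: sumr_ge0 => i _; exact: sumr_ge0.
apply: (@le_trans _ _ (`|C| * (X + Y + 2^-1 * Z))).
  by rewrite ler_wpM2r ?ler_norm// !addr_ge0// mulr_ge0.
rewrite ler_wpM2l//; have : 2^-1 * Z <= Z by rewrite ler_piMl// invf_le1// ler1n.
lra.
Qed.

Lemma op_lipschitz : exists2 C : R, 0 <= C & forall f1 f2, H2 f1 -> H2 f2 ->
  l2n (L f1 - L f2) <= C * h2n (f1 - f2).
Proof.
have [_ _ _ [C HC]] := HL; exists `|C| => // f1 f2 H1 H2'.
have HB := Hp2B oOmega bOmega muD H1 H2'.
have := HC f1 f2 H1 H2'; rewrite /L2norm Lnorm_l2n; last first.
  by apply: sqintB; exact: sqint_op.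
rewrite Hnorm2E// -EFinM lee_fin => /le_trans; apply.
by rewrite ler_wpM2r ?ler_norm//; exact: h2n_ge0.
Qed.

Lemma monotone_real : strongly_monotone Omega mu L -> exists2 gamma : R, 0 < gamma &
  forall f1 f2, H20 Omega mu f1 -> H20 Omega mu f2 ->
    ldot mu (f1 - f2) (L f1 - L f2) <= - (gamma * l2n (f1 - f2) ^+ 2).
Proof.
move=> [gamma g0 H]; exists gamma => // f1 f2 H1 H2'.
have := H _ _ H1 H2'; have [h1 _] := H1; have [h2 _] := H2'.
have s12 : sqint mu (f1 - f2) by apply: sqintB; [exact: (Hp_sqint h1)|exact: (Hp_sqint h2)].
have sL : sqint mu (L f1 - L f2) by apply: sqintB; exact: sqint_op.
rewrite /L2norm Lnorm_l2n// /L2dot (Rintegral_mu_Omega oOmega muD); last first.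
  by apply: measurable_funM; [exact: (sqint_measurable s12)|exact: (sqint_measurable sL)].
by rewrite -EFin_expe -EFinM lee_fin mulNr.
Qed.

(** The size of the derivatives of [h], weighted as they appear in the
  derivatives of [cutoff r * h]. *)
Definition wjet r h x : R := \sum_(l <- lists2 n) r^-1 ^+ (2 - size l) * `|pderivs l h x|.

Lemma cutoff_bound2 : exists2 C : R, 0 <= C & forall l r x, (size l <= 2)%N -> 0 < r ->
  `|pderivs l (cutoff r) x| <= C * r^-1 ^+ size l.
Proof.
suff [C C0 H] : exists2 C : R, 0 <= C & forall l r x, l \in lists2 n -> 0 < r ->
  `|pderivs l (cutoff r) x| <= C * r^-1 ^+ size l.
  by exists C => // l r x l2; apply: H; rewrite mem_lists2.
elim: (lists2 n) => [|l s [C C0 H]]; first by exists 0.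
have [C' C0' H'] := cutoff_bound oOmega bOmega l.
exists (Num.max C C') => [|l' r x]; first by rewrite le_max C0.
rewrite inE => /orP[/eqP ->|ls] r0.
  apply: le_trans (H' r x r0) _; rewrite ler_wpM2r//.
    by rewrite exprn_ge0// invr_ge0 ltW.
  by rewrite le_max lexx orbT.
apply: le_trans (H l' r x ls r0) _; rewrite ler_wpM2r//.
  by rewrite exprn_ge0// invr_ge0 ltW.
by rewrite le_max lexx.
Qed.

Lemma jet_cutoff : exists2 C : R, 0 <= C & forall r h x, 0 < r -> r <= 1 ->
  smooth_on Omega h -> Omega x ->
  \sum_(l <- lists2 n) `|pderivs l (cutoff r * h) x| <= C * wjet r h x.
Proof.
have [C C0 HC] := cutoff_bound2.
exists (\sum_(l <- lists2 n) \sum_(p <- splits l) C) => [|r h x r0 r1 sh Ox].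
  by apply: sumr_ge0 => l _; exact: sumr_ge0.
rewrite mulr_suml big_seq [leRHS]big_seq; apply: ler_sum => l; rewrite mem_lists2 => l2.
rewrite (leibniz oOmega) //; last first.
  by apply: (sub_Ck (@subsetT _ _)); exact: cutoff_smooth.
rewrite mulr_suml; apply: le_trans (ler_norm_sum _ _ _) _.
rewrite big_seq [leRHS]big_seq; apply: ler_sum => p pl; have [h1 h2'] := size_splits pl.
have p1 := leq_trans h1 l2; have p2 := leq_trans h2' l2.
rewrite normrM; apply: (@le_trans _ _ (C * (r^-1 ^+ (2 - size p.2) * `|pderivs p.2 h x|))).
  rewrite mulrA ler_wpM2r//; apply: le_trans (HC _ _ _ p1 r0) _.
  rewrite ler_wpM2l//; apply: ler_weXn2l; first by rewrite invf_ge1.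
  by rewrite leq_subRL// addnC (sum_splits pl).
rewrite ler_wpM2l// /wjet (bigD1_seq p.2)//=; last 2 first.
- by rewrite mem_lists2.
- exact: uniq_lists2.
rewrite lerDl; apply: sumr_ge0 => q _; by rewrite mulr_ge0// exprn_ge0// invr_ge0 ltW.
Qed.

(** The cutoff is 1 on [inner (r *+ 3)]. The factor 4 leaves room for a ball of
  radius [r] on which it is constant, so that its derivatives vanish at the
  points of [inner (r *+ 4)]. *)
Definition strip r : set 'rV[R]_n := Omega `\` inner (r *+ 4).

Definition on_strip r h : 'rV[R]_n -> R := fun x => \1_(strip r) x * h x.

Lemma on_stripE r h x : on_strip r h x = \1_(strip r) x * h x. Proof. by []. Qed.

Lemma measurable_strip r : measurable (strip r).
Proof. by apply: measurableD => //; exact: measurable_inner. Qed.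

Lemma on_strip_in r h x : strip r x -> on_strip r h x = h x.
Proof. by move=> sx; rewrite /on_strip indicE mem_set// mul1r. Qed.

Lemma on_strip_out r h x : ~ strip r x -> on_strip r h x = 0.
Proof. by move=> sx; rewrite /on_strip indicE memNset// mul0r. Qed.

Lemma sqint_strip r h : sqint mu h -> sqint mu (on_strip r h) /\ l2n (on_strip r h) <= l2n h.
Proof.
move=> sh; have := @sqintM_bounded _ _ _ mu 1 \1_(strip r) h _ _ sh.
rewrite mul1r; apply; first by apply: measurable_indic; exact: measurable_strip.
by move=> x; rewrite indicE; case: (_ \in _); rewrite ?normr1 ?normr0.
Qed.

Lemma cutoff_near r x : 0 < r -> inner (r *+ 4) x -> forall y, ball x r y -> cutoff r y = 1.
Proof.
move=> r0 xr y xy; apply: cutoff1 => // z yz; apply: xr.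
by have := ball_triangle xy yz; rewrite -mulrS.
Qed.

Lemma test_smoothH2 r G : 0 < r -> smoothH2 G -> test_fun Omega (cutoff r * G).
Proof. by move=> r0 [sG _ _]; apply: test_fun_mul => //; exact: test_fun_cutoff. Qed.

Definition strip_size r h : R := r^-1 * l2n (on_strip r h).

(** Outside of the strip the two differences agree, because a pointwise Lipschitz
  operator is local. In the strip each is at most a multiple of [wjet r H], where the
  term of order 0 has weight [r^-1 ^+ 2] and the others at most [r^-1]; by
  Cauchy-Schwarz, the factor [cutoff r * H] absorbs one power of [r^-1] and the
  term of order 0 of the jet another one. *)
Lemma strip_error : exists2 K : R, 0 <= K & forall r G H, 0 < r -> r <= 1 ->
  smoothH2 G -> smoothH2 H ->
  `|ldot mu (cutoff r * H)
     ((L (cutoff r * (G + H)) - L (cutoff r * G)) - (L (G + H) - L G))| <= K * (strip_size r H * (strip_size r H + h2n H)).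
Proof.
have [Cp Cp0 HCp] := op_lipschitz_pointwise; have [C C0 HC] := jet_cutoff.
pose M := Cp * (C + 1); have M0 : 0 <= M by rewrite mulr_ge0// addr_ge0.
pose N := (size (lists2 n))%:R : R.
exists (M * N) => [|r G H r0 r1 SG SH]; first by rewrite mulr_ge0// ler0n.
set a := strip_size r H.
have SGH := smoothH2D oOmega SG SH.
have ri1 : 1 <= r^-1 by rewrite invf_ge1.
have ri0 : 0 <= r^-1 by rewrite invr_ge0 ltW.
have t F : smoothH2 F -> test_fun Omega (cutoff r * F) by exact: test_smoothH2.
have tH F : smoothH2 F -> H2 (cutoff r * F).
  by move=> /t; exact: test_fun_Hp.
have tC F : smoothH2 F -> Ck 2 Omega (cutoff r * F).
  by move=> /t[tF _]; apply: (sub_Ck (@subsetT _ _)); exact: tF.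
have hH F : smoothH2 F -> H2 F by exact: smoothH2_Hp.
have hC F : smoothH2 F -> Ck 2 Omega F by case.
set D := (L (cutoff r * (G + H)) - L (cutoff r * G) - (L (G + H) - L G)).
have sD : sqint mu D.
  by apply: sqintB; apply: sqintB; apply: sqint_op; [exact: tH|exact: tH|exact: hH|exact: hH].
have D_in x : inner (r *+ 4) x -> D x = 0.
  move=> xr; have Ox : Omega x by apply: inner_sub xr; rewrite mulrn_wgt0.
  suff E F : smoothH2 F -> L (cutoff r * F) x = L F x by rewrite /D !fsubE !E// subrr.
  move=> SF; apply/eqP; rewrite -subr_eq0 -normr_le0.
  apply: le_trans (HCp _ _ (tH _ SF) (tC _ SF) (hH _ SF) (hC _ SF) _ Ox) _.
  rewrite big1 ?mulr0// => l _.
  have ob : open (ball x r) by exact: ball_open.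
  have xb : ball x r x by exact: ballxx.
  rewrite (@eq_pderivs _ _ (ball x r) l _ F ob _ x xb) ?subrr ?normr0//.
  by move=> y xy; rewrite fmulE (cutoff_near r0 xr)// mul1r.
have D_bound x : Omega x -> `|D x| <= M * wjet r H x.
  move=> Ox; have le_w : \sum_(l <- lists2 n) `|pderivs l H x| <= wjet r H x.
    by apply: ler_sum => l _; rewrite ler_peMl// exprn_ege1.
  have H1 : `|L (cutoff r * (G + H)) x - L (cutoff r * G) x| <= Cp * (C * wjet r H x).
    apply: le_trans (HCp _ _ (tH _ SGH) (tC _ SGH) (tH _ SG) (tC _ SG) _ Ox) _.
    rewrite ler_wpM2l//; apply: le_trans (HC r H x r0 r1 _ Ox); last by case: SH.
    rewrite big_seq [leRHS]big_seq; apply: ler_sum => l; rewrite mem_lists2 => l2.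
    rewrite -(CkB_pderivs oOmega)//; last 2 first.
    - exact: le_Ck (tC _ SGH).
    - exact: le_Ck (tC _ SG).
    by rewrite mulrDr addrAC subrr add0r.
  have H2' : `|L (G + H) x - L G x| <= Cp * wjet r H x.
    apply: le_trans (HCp _ _ (hH _ SGH) (hC _ SGH) (hH _ SG) (hC _ SG) _ Ox) _.
    rewrite ler_wpM2l//; apply: le_trans le_w.
    rewrite big_seq [leRHS]big_seq; apply: ler_sum => l; rewrite mem_lists2 => l2.
    rewrite -(CkB_pderivs oOmega)//; last 2 first.
    - exact: le_Ck (hC _ SGH).
    - exact: le_Ck (hC _ SG).
    by rewrite addrAC subrr add0r.
  rewrite /D !fsubE; apply: le_trans (ler_normB _ _) _.
  by apply: le_trans (lerD H1 H2') _; rewrite /M; move: (wjet r H x) => q; lra.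
pose w l : 'rV[R]_n -> R := fun x => r^-1 ^+ (2 - size l) * `|on_strip r (res (pderivs l H)) x|.
pose W : 'rV[R]_n -> R := \sum_(l <- lists2 n | l \in lists2 n) w l.
have SH' : forall l, (size l <= 2)%N -> sqint mu (res (pderivs l H)) by case: SH.
have ws l : (size l <= 2)%N -> sqint mu (w l) /\
    l2n (w l) <= r^-1 ^+ (2 - size l) * l2n (on_strip r (res (pderivs l H))).
  move=> l2; have [s _] := sqint_strip r (SH' l l2).
  have [] := @sqint_le _ _ _ mu (w l) (r^-1 ^+ (2 - size l) *: on_strip r (res (pderivs l H))).
  - by apply: measurable_funM => //; apply: measurableT_comp => //; exact: (sqint_measurable s).
  - exact: sqintZ.
  - apply: aeW => x; rewrite /w fscaleE.
    rewrite [X in X <= _]normrM [X in _ <= X]normrM normr_id.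
    exact: lexx.
  move=> sw; rewrite (l2nZ _ s) [`|r^-1 ^+ _|]ger0_norm ?exprn_ge0//.
have sW : sqint mu W.
  by apply: sqint_sum => l; rewrite mem_lists2 => /ws[].
have lW : l2n W <= N * (r^-1 * (a + h2n H)).
  apply: le_trans (l2n_sum _ _) _ => [l|]; first by rewrite mem_lists2 => /ws[].
  apply: (@le_trans _ _ (\sum_(l <- lists2 n | l \in lists2 n) (r^-1 * (a + h2n H)))); last first.
    by rewrite -big_seq big_const_seq count_predT iter_addr_0 -mulr_natl.
  have a0 : 0 <= a by rewrite mulr_ge0// l2n_ge0.
  have h0 : 0 <= h2n H by apply: h2n_ge0; exact: hH.
  apply: ler_sum => l; rewrite mem_lists2 => l2.
  apply: le_trans (ws l l2).2 _.
  have lh : l2n (on_strip r (res (pderivs l H))) <= h2n H.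
    apply: le_trans (sqint_strip r (SH' l l2)).2 _.
    apply: (h2n_ge oOmega bOmega muD (hH _ SH) l2 (SH' l l2)).
    exact: (smoothH2_weak oOmega bOmega SH).
  case: l l2 lh => [|i l] l2 lh.
    rewrite subn0 expr2 -mulrA ler_wpM2l// (_ : on_strip r _ = on_strip r H) ?lerDl//.
    apply/funext => x; have [sx|sx] := pselect (strip r x); last by rewrite !on_strip_out.
    by rewrite !on_strip_in// res_in//; case: sx.
  apply: (@le_trans _ _ (r^-1 * h2n H)); last by rewrite ler_wpM2l// lerDr.
  rewrite ler_pM ?exprn_ge0 ?l2n_ge0// -[leRHS]expr1; apply: ler_weXn2l => //.
  by rewrite /= subSS; exact: leq_subr.
have su : sqint mu (on_strip r H) /\ l2n (on_strip r H) <= l2n H.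
  by apply: sqint_strip; case: SH.
have tu : sqint mu (cutoff r * H) by apply: Hp_sqint; exact: tH.
have iW : mu.-integrable setT (EFin \o (fun x => `|on_strip r H x * W x|)).
  by apply: integrable_norm; exact: (sqintM_integrable su.1 sW).
apply: (@le_trans _ _ (\int[mu]_x (M * `|on_strip r H x * W x|))).
  apply: le_trans (le_normr_Rintegral _ _) _ => //; first exact: sqintM_integrable.
  apply: le_Rintegral => //.
  - by apply: integrable_norm; exact: sqintM_integrable.
  - exact: (integrable_realZ measurableT M iW).
  move=> x _; have [Ox|nO] := pselect (Omega x); last first.
    rewrite fmulE cutoff0//; last by move=> /(inner_sub r0).
    by rewrite !mul0r normr0; apply: mulr_ge0.
  have [xi|xi] := pselect (inner (r *+ 4) x); first by rewrite D_in// mulr0 normr0; apply: mulr_ge0.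
  have sx : strip r x by [].
  rewrite on_strip_in// !normrM mulrCA; apply: ler_pM => //.
    have /andP[? ?] := cutoff_bnd1 oOmega bOmega x r0.
    by rewrite ler_piMl// ger0_norm.
  apply: le_trans (D_bound x Ox) _; rewrite ler_wpM2l//.
  apply: le_trans (ler_norm _); rewrite /W fct_sumE -big_seq.
  by apply: ler_sum => l _; rewrite /w on_strip_in// res_in.
rewrite (@RintegralZl _ _ _ mu setT (fun x => `|on_strip r H x * W x|))//.
rewrite -mulrA ler_wpM2l//; apply: le_trans (cauchy_schwarz su.1 sW) _.
apply: le_trans (ler_wpM2l (l2n_ge0 _ _) lW) _.
by rewrite /a /strip_size; move: (l2n (on_strip r H)) (h2n H) (r^-1) => p q s; rewrite le_eqVlt; apply/orP; left; apply/eqP; ring.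
Qed.

End operator.

(** * Monotonicity along directions vanishing at the boundary *)
(** The lower bound [(t - q) ^+ 2] for the square, weakened so that it also holds
  when [t < q]. *)
Lemma sqr_lower (R : realDomainType) (s t q : R) : 0 <= s -> 0 <= t -> 0 <= q ->
  t - q <= s -> t ^+ 2 - 2 * t * q <= s ^+ 2.
Proof.
move=> s0 t0 q0 tqs; have [qt|qt] := leP q t.
  have : (t - q) ^+ 2 <= s ^+ 2 by rewrite ler_pXn2r ?nnegrE// subr_ge0.
  have := sqr_ge0 q; lra.
apply: le_trans (sqr_ge0 s); have : t * (t - q) <= 0 by rewrite mulr_ge0_le0// subr_le0 ltW.
have := mulr_ge0 t0 q0; lra.
Qed.

Section monotone_near.
Context (R : realType) (n : nat) (Omega : set 'rV[R]_n).
Context (mu : {measure set 'rV[R]_n -> \bar R}).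
Context (oOmega : open Omega) (bOmega : bounded_set Omega).
Context (muD : good_density Omega mu).
Context (L : ('rV[R]_n -> R) -> ('rV[R]_n -> R)).
Hypothesis HL : lipschitz_operator Omega mu L.
Implicit Types (f g h u v : 'rV[R]_n -> R) (r : R).

Notation leb := (leb R n).
Notation inner := (inner Omega).
Notation cutoff := (cutoff Omega).
Notation H2 := (Hp Omega mu 2).
Notation h2n := (h2n Omega mu).
Notation l2n := (l2n mu).
Notation dot := (ldot mu).
Notation smoothH2 := (smoothH2 Omega mu).
Notation on_strip := (on_strip Omega).
Notation strip := (strip Omega).
Notation sqint_strip := (@sqint_strip R n Omega mu oOmega).

Let mOmega : measurable Omega. Proof. exact: open_measurable_rV. Qed.

Let finmu A : measurable A -> (mu A < +oo)%E.
Proof.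
move=> mA; apply: le_lt_trans (mu_finite oOmega bOmega muD).
by apply: le_measure; rewrite ?inE.
Qed.

Let sind A : measurable A -> sqint mu \1_A.
Proof. by move=> mA; apply: indic_sqint => //; exact: finmu. Qed.

Definition strip_mass r : R := l2n \1_(strip r).

Lemma strip_mass_ge0 r : 0 <= strip_mass r. Proof. exact: l2n_ge0. Qed.

Lemma strip_mass_small (e : R) : 0 < e -> exists2 r0, 0 < r0 &
  forall r, 0 < r -> r <= r0 -> strip_mass r <= e.
Proof.
move=> e0; have [m [M [_ HM]]] := density_bounds oOmega muD.
pose M' := `|M| + 1; have M0 : 0 < M' by rewrite ltr_wpDl.
have fO := leb_bounded_lty bOmega mOmega.
have [r1 r10 Hr] := leb_strip oOmega fO (divr_gt0 (exprn_gt0 2 e0) M0).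
exists (r1 / 4) => [|r r0 rr]; first by rewrite divr_gt0.
rewrite -(@ler_pXn2r _ 2)// ?nnegrE ?l2n_ge0 ?(ltW e0)// -lee_fin.
have ms := measurable_strip oOmega r.
rewrite l2n_indic//; last exact: finmu.
have /andP[_ h] := HM _ ms; apply: le_trans h _.
apply: (@le_trans _ _ (M'%:E * (e ^+ 2 / M')%:E)%E).
  apply: (@le_trans _ _ (M'%:E * leb (strip r `&` Omega))%E).
    by apply: lee_wpmul2r => //; rewrite lee_fin (le_trans (ler_norm _))// lerDl.
  apply: lee_wpmul2l; first by rewrite lee_fin ltW.
  apply: le_trans Hr; apply: le_measure; rewrite ?inE.
  - exact: measurableI.
  - by apply: measurableD => //; exact: measurable_inner.
  - move=> x [[Ox xr] _]; split=> // x1; apply: xr; apply: le_inner x1.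
    by rewrite -[leLHS]mulr_natr -ler_pdivlMr.
by rewrite -EFinM lee_fin mulrC divfK ?gt_eqF.
Qed.

Section estimate.
Context (gamma : R) (gamma0 : 0 < gamma).
Hypothesis HM : forall f1 f2, H20 Omega mu f1 -> H20 Omega mu f2 ->
  dot (f1 - f2) (L f1 - L f2) <= - (gamma * l2n (f1 - f2) ^+ 2).
Context g h (Hg : H2 g) (Hh : H2 h) (C : R) (C0 : 0 <= C).
Hypothesis hC : forall r x, 0 < r -> Omega x -> ~ inner r x -> `|h x| <= C * r.

Lemma on_strip_small r : 0 < r -> l2n (on_strip r h) <= C * (r *+ 4) * strip_mass r.
Proof.
move=> r0; have sh := Hp_sqint Hh.
have [s _] := sqint_strip r sh.
have ss := sind (measurable_strip oOmega r).
have c0 : 0 <= C * (r *+ 4) by rewrite mulr_ge0// mulrn_wge0// ltW.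
rewrite /strip_mass -[X in X * _]ger0_norm// -l2nZ//; apply: l2n_le_ae => //.
  exact: sqintZ.
apply: aeW => x; rewrite fscaleE; have [sx|sx] := pselect (strip r x); last first.
  by rewrite on_strip_out// normr0.
rewrite on_strip_in// indicE mem_set// mulr1 [leRHS]ger0_norm//.
by case: sx => Ox xr; apply: hC => //; rewrite mulrn_wgt0.
Qed.

(** Write [u = cutoff r * H] for the cut off approximation of [h]. Monotonicity
  holds for [u], as a difference of test functions; passing from [u] to [h] costs
  [strip_error], the distance between [u] and [h], and the errors of the
  approximations [G] and [H]. *)
Lemma monotone_estimate : exists2 K : R, 0 <= K & forall r, 0 < r -> r <= 1 ->
  dot h (L (g + h) - L g) <= - (gamma * l2n h ^+ 2) + K * (r + strip_mass r).
Proof.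
have [K1 K10 HK1] := strip_error oOmega bOmega muD HL.
have [Cl Cl0 HCl] := op_lipschitz oOmega bOmega muD HL.
pose N := h2const R n; have N0 : 0 <= N by exact: ler0n.
have sh := Hp_sqint Hh; have sg := Hp_sqint Hg.
pose c := 4 * C + 1; have c0 : 0 <= c by rewrite addr_ge0// mulr_ge0.
pose s0 := l2n \1_setT; have s00 : 0 <= s0 by exact: l2n_ge0.
pose D0 := 1 + s0; have D00 : 0 <= D0 by rewrite addr_ge0.
pose B := N * (h2n h + N); have hh0 : 0 <= h2n h by exact: h2n_ge0.
have B0 : 0 <= B by rewrite mulr_ge0// addr_ge0.
pose D := L (g + h) - L g.
have sD : sqint mu D.
  by apply: sqintB; apply: (sqint_op HL) => //; exact: (Hp2D oOmega bOmega muD).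
pose K2 := Cl * (N * 2 + 1); have K20 : 0 <= K2 by rewrite mulr_ge0// addr_ge0// mulr_ge0.
exists (K1 * c * (c * D0 + B) + c * l2n D + (l2n h + c * D0) * K2 + 2 * gamma * l2n h * c).
  by rewrite !addr_ge0// ?mulr_ge0// ?addr_ge0// ?mulr_ge0// ?l2n_ge0// ?addr_ge0 ?mulr_ge0 ?(ltW gamma0) ?l2n_ge0.
move=> r r0 r1; set s := strip_mass r; have s_ge0 : 0 <= s by exact: strip_mass_ge0.
have ss0 : s <= s0.
  apply: l2n_le_ae; [exact: (sind (measurable_strip oOmega r))|exact: sind|].
  by apply: aeW => x; rewrite !indicE; case: (_ \in strip _); rewrite ?normr0// mem_set.
have r20 : 0 < r ^+ 2 by rewrite exprn_gt0.
have r2r : r ^+ 2 <= r by rewrite expr2 ler_piMr// ltW.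
(* The accuracy r^2 is still of order r after the division by r in strip_size. *)
have [G SG hG] := meyers_serrin oOmega bOmega muD Hg r20.
have [H SH hH] := meyers_serrin oOmega bOmega muD Hh r20.
have SGH := smoothH2D oOmega SG SH.
have HG := smoothH2_Hp oOmega bOmega SG; have HH := smoothH2_Hp oOmega bOmega SH.
have sH := Hp_sqint HH; have sG := Hp_sqint HG.
pose delta := r + s; have d0 : 0 <= delta by rewrite addr_ge0// ltW.
have dD0 : delta <= D0 by rewrite lerD.
have rd : r <= delta by rewrite /delta lerDl.
have HhH : H2 (h - H) by exact: (Hp2B oOmega bOmega muD).
have HgG : H2 (g - G) by exact: (Hp2B oOmega bOmega muD).
have HB : h2n H <= B.
  rewrite (_ : H = h + (-1) *: (h - H)); last by rewrite scaleN1r opprB addrC subrK.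
  have H1 : H2 ((-1) *: (h - H)) by exact: (Hp2Z oOmega bOmega muD).
  apply: le_trans (h2nD oOmega bOmega muD Hh H1) _; rewrite ler_wpM2l// lerD2l.
  apply: le_trans (h2nZ oOmega bOmega muD (-1) HhH) _.
  rewrite normrN1 mul1r -[leRHS]mulr1 ler_wpM2l//.
  by apply: le_trans hH _; apply: le_trans r2r r1.
have lHh : l2n (h - H) <= r ^+ 2.
  exact: le_trans (l2n_h2n oOmega bOmega muD HhH) hH.
have sh_strip : l2n (on_strip r h) <= r * (4 * C * s).
  apply: le_trans (on_strip_small r0) _; rewrite -/s -[r *+ 4]mulr_natr.
  by move: (s) => q; rewrite le_eqVlt; apply/orP; left; apply/eqP; ring.
have shH : sqint mu (h - H) by exact: sqintB.
set a := strip_size Omega mu r H.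
have a0 : 0 <= a by rewrite mulr_ge0 ?l2n_ge0// invr_ge0 ltW.
have ale : a <= c * delta.
  rewrite /a /strip_size mulrC ler_pdivrMr//.
  have E : on_strip r H = on_strip r h - on_strip r (h - H).
    by apply/funext => x; rewrite fsubE !on_stripE fsubE; move: (\1_ _ x) (h x) (H x) => p q t; ring.
  rewrite E; apply: le_trans (l2nB _ _) _; [by case: (sqint_strip r sh)|by case: (sqint_strip r shH)|].
  have h1 := le_trans (sqint_strip r shH).2 lHh.
  apply: le_trans (lerD sh_strip h1) _.
  rewrite expr2 -mulrDr mulrC ler_wpM2r ?(ltW r0)// /c /delta.
  by have := mulr_ge0 C0 (ltW r0); have := mulr_ge0 C0 s_ge0; lra.
pose u := cutoff r * H.
have tu : test_fun Omega u by exact: (@test_smoothH2 R n Omega mu oOmega bOmega).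
have Hu : H2 u by apply: test_fun_Hp tu.
have su := Hp_sqint Hu.
have suh : sqint mu (u - h) by exact: sqintB.
have luh : l2n (u - h) <= c * delta.
  have [sst _] := sqint_strip r sh.
  have chi1 x : `|cutoff r x| <= 1.
    by have /andP[? ?] := cutoff_bnd1 oOmega bOmega x r0; rewrite ger0_norm.
  have [s1 l1] := @sqintM_bounded _ _ _ mu 1 (cutoff r) (H - h)
     (@smooth_measurable _ _ _ [::] (cutoff_smooth oOmega bOmega r0)) chi1 (sqintB sH sh).
  pose v : 'rV[R]_n -> R := fun x => (cutoff r x - 1) * h x.
  have [sv lv] : sqint mu v /\ l2n v <= l2n (on_strip r h).
    apply: sqint_le => //.
      apply: measurable_funM; last exact: (sqint_measurable sh).
      apply: measurable_funB => //.
      exact: (@smooth_measurable _ _ _ [::] (cutoff_smooth oOmega bOmega r0)).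
    apply: filterS (mu_ae_Omega oOmega muD) => x Ox.
    have [xi|xi] := pselect (inner (r *+ 4) x).
      by rewrite /v (cutoff_near r0 xi) ?subrr ?mul0r ?normr0//; exact: ballxx.
    rewrite on_strip_in// normrM ler_piMl//.
    have /andP[? ?] := cutoff_bnd1 oOmega bOmega x r0.
    by rewrite ler_norml; apply/andP; split; lra.
  have -> : u - h = (fun x => cutoff r x * (H - h) x) + v.
    by apply/funext => x; rewrite fsubE faddE /v /u fmulE fsubE; move: (cutoff r x) (h x) (H x) => p q t; ring.
  apply: le_trans (l2nD s1 sv) _; rewrite mul1r in l1.
  rewrite -(l2nN mu (H - h)) opprB in l1.
  apply: le_trans (lerD (le_trans l1 lHh) (le_trans lv sh_strip)) _.
  rewrite /c /delta.
  have q1 : r * (4 * C * s) <= 4 * C * s by rewrite ler_piMl// !mulr_ge0.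
  have q2 : 0 <= 4 * C * r by rewrite !mulr_ge0// ltW.
  by move: (r ^+ 2) (4 * C) r2r q1 q2 => r2' cc; nra.
pose chiG := cutoff r * G; pose chiF := cutoff r * (G + H).
have SGt : test_fun Omega chiG by exact: (@test_smoothH2 R n Omega mu oOmega bOmega).
have SFt : test_fun Omega chiF by exact: (@test_smoothH2 R n Omega mu oOmega bOmega).
have uE : u = chiF - chiG by rewrite /u /chiF /chiG mulrDr addrC addKr.
have mono : dot u (L chiF - L chiG) <= - (gamma * l2n u ^+ 2).
  by rewrite uE; apply: HM; apply: test_fun_H20.
pose d := L (G + H) - L G.
have opS f : H2 f -> sqint mu (L f) by exact: (sqint_op HL).
have HGH : H2 (G + H) by exact: (Hp2D oOmega bOmega muD).
have Hgh : H2 (g + h) by exact: (Hp2D oOmega bOmega muD).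
have sd : sqint mu d by apply: sqintB; exact: opS.
have sX : sqint mu (L chiF - L chiG).
  by apply: sqintB; apply: opS; apply: test_fun_Hp.
have lDd : l2n (D - d) <= K2 * r.
  have -> : D - d = (L (g + h) - L (G + H)) - (L g - L G).
    rewrite /D /d; move: (L (g + h)) (L g) (L (G + H)) (L G) => p q t w.
    by rewrite !opprB addrACA [- q - t]addrC -addrACA.
  apply: le_trans (l2nB _ _) _; [by apply: sqintB; exact: opS|by apply: sqintB; exact: opS|].
  apply: le_trans (lerD (HCl _ _ Hgh HGH) (HCl _ _ Hg HG)) _.
  rewrite -mulrDr /K2 -mulrA ler_wpM2l//.
  have -> : g + h - (G + H) = (g - G) + (h - H) by rewrite opprD addrACA.
  apply: le_trans (lerD (h2nD oOmega bOmega muD HgG HhH) (lexx _)) _.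
  have q : N * (h2n (g - G) + h2n (h - H)) <= N * (r + r).
    by rewrite ler_wpM2l// lerD// (le_trans _ r2r).
  rewrite -/N; have := le_trans hG r2r; lra.
have dec : dot h D = dot u (L chiF - L chiG) - dot u (L chiF - L chiG - d)
    - dot (u - h) D + dot u (D - d).
  rewrite (ldotB su sX sd) (ldotBl su sh sD) (ldotB su sD sd).
  move: (dot u (L chiF - L chiG)) (dot u d) (dot u D) (dot h D) => p q t w.
  by ring.
have e1 : - dot u (L chiF - L chiG - d) <= K1 * (c * delta * (c * D0 + B)).
  apply: le_trans (ler_norm _) _; rewrite normrN.
  apply: le_trans (HK1 r G H r0 r1 SG SH) _; rewrite ler_wpM2l//.
  apply: ler_pM => //; first by rewrite addr_ge0// h2n_ge0.
  apply: lerD => //; apply: le_trans ale _; by rewrite ler_wpM2l.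
have e2 : - dot (u - h) D <= c * delta * l2n D.
  apply: le_trans (ler_norm _) _; rewrite normrN.
  by apply: le_trans (ldot_le suh sD) _; rewrite ler_wpM2r// l2n_ge0.
have lu : l2n u <= l2n h + c * D0.
  rewrite -(subrK h u) addrC; apply: le_trans (l2nD sh suh) _; rewrite lerD2l.
  by apply: le_trans luh _; rewrite ler_wpM2l.
have e3 : dot u (D - d) <= (l2n h + c * D0) * (K2 * delta).
  have le1 : l2n (D - d) <= K2 * delta by exact: le_trans lDd (ler_wpM2l K20 rd).
  have le2 := ldot_cs su (sqintB sD sd).
  exact: le_trans le2 (ler_pM (l2n_ge0 mu u) (l2n_ge0 mu (D - d)) lu le1).
have e4 : - (gamma * l2n u ^+ 2) <= - (gamma * l2n h ^+ 2) + 2 * gamma * l2n h * (c * delta).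
  have t := l2n_triB su sh.
  have : l2n h - c * delta <= l2n u.
    by have := le_trans t luh; rewrite ler_norml => /andP[]; lra.
  move=> /(sqr_lower (l2n_ge0 mu u) (l2n_ge0 mu h) (mulr_ge0 c0 d0)).
  move=> /(ler_wpM2l (ltW gamma0)).
  by move: (c * delta) (l2n u) (l2n h) => q t1 t2 k1; lra.
rewrite -/D dec.
apply: le_trans (lerD (lerD (lerD mono e1) e2) e3) _.
apply: le_trans (lerD (lerD (lerD e4 (lexx _)) (lexx _)) (lexx _)) _.
rewrite -/delta le_eqVlt; apply/orP; left; apply/eqP.
by move: (l2n h) (l2n D) => p q; ring.
Qed.

(** The width [r] of the strip tends to 0, and [strip_mass r] with it. *)
Lemma monotone_near_direction : dot h (L (g + h) - L g) <= - (gamma * l2n h ^+ 2).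
Proof.
have [K K0 HK] := monotone_estimate.
apply/ler_addgt0Pr => e e0.
pose e' := e / (2 * (K + 1)).
have e'0 : 0 < e' by rewrite divr_gt0// mulr_gt0// ltr_wpDl.
have [r0 r00 Hr] := strip_mass_small e'0.
pose r := Num.min 1 (Num.min e' r0).
have rp : 0 < r by rewrite !lt_min ltr01 e'0 r00.
have r1 : r <= 1 by rewrite ge_min lexx.
have re : r <= e' by rewrite !ge_min lexx orbT.
have rr0 : r <= r0 by rewrite !ge_min lexx !orbT.
apply: le_trans (HK r rp r1) _; rewrite lerD2l.
apply: le_trans (ler_wpM2l K0 (lerD re (Hr r rp rr0))) _.
have E : (K + 1) * (e' + e') = e by rewrite /e'; field; rewrite gt_eqF// ltr_wpDl.
by rewrite -[leRHS]E ler_wpM2r ?addr_ge0 ?ltW// ltrDl.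
Qed.

End estimate.
End monotone_near.

(** * Gram operators *)
Section bounded_integrable.
Context d (X : measurableType d) (R : realType) (mu : {measure set X -> \bar R}).
Implicit Types f a : X -> R.

Lemma integrable_boundedM f a (M : R) : measurable_fun setT f -> (forall x, `|f x| <= M) ->
  mu.-integrable setT (EFin \o a) -> mu.-integrable setT (EFin \o (fun x => f x * a x)).
Proof.
move=> mf fM ia; apply: (@le_integrable _ _ _ mu _ _ _ (EFin \o (fun x => M * a x))) => //.
- apply/measurable_EFinP; apply: measurable_funM => //.
  by apply/measurable_EFinP; case/integrableP: ia.
- move=> x _; rewrite lee_fin !normrM ler_wpM2r//.
  exact: le_trans (fM x) (ler_norm _).
- exact: integrable_realZ.
Qed.

Lemma Rintegral_bounded f a (M : R) : measurable_fun setT f -> (forall x, `|f x| <= M) ->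
  mu.-integrable setT (EFin \o a) ->
  `|\int[mu]_x (f x * a x)| <= M * \int[mu]_x `|a x|.
Proof.
move=> mf fM ia; have iM := integrable_boundedM mf fM ia.
have ia' : mu.-integrable setT (EFin \o (fun x => `|a x|)) by exact: integrable_norm.
apply: le_trans (le_normr_Rintegral _ _) _ => //.
rewrite -(@RintegralZl _ _ _ mu setT (fun x => `|a x|))//.
apply: le_Rintegral => //; [exact: integrable_norm|exact: integrable_realZ|].
by move=> x _; rewrite normrM ler_wpM2r.
Qed.

End bounded_integrable.

Section fubini_bounded.
Context d1 d2 (X : measurableType d1) (Y : measurableType d2) (R : realType).
Context (m1 : {finite_measure set X -> \bar R}) (m2 : {finite_measure set Y -> \bar R}).
Context (phi : X * Y -> R) (a : X -> R) (M : R).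
Hypothesis mphi : measurable_fun setT phi.
Hypothesis phiM : forall z, `|phi z| <= M.
Hypothesis ia : m1.-integrable setT (EFin \o a).

Let ma : measurable_fun setT a.
Proof. by apply/measurable_EFinP; case/integrableP: ia. Qed.

Let msec1 y : measurable_fun setT (fun x => phi (x, y)).
Proof. exact: measurableT_comp. Qed.

Let msec2 x : measurable_fun setT (fun y => phi (x, y)).
Proof. exact: measurableT_comp. Qed.

Let F (z : X * Y) : \bar R := (phi z * a z.1)%:E.

Let intF : (m1 \x m2)%E.-integrable setT F.
Proof.
have mF : measurable_fun setT F.
  apply/measurable_EFinP; apply: measurable_funM => //.
  exact: (measurableT_comp ma measurable_fst).
apply/integrable21ltyP => //.
have iMa : m1.-integrable setT (EFin \o (fun x => `|M| * `|a x|)).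
  by apply: integrable_realZ => //; exact: integrable_norm.
pose K := (\int[m1]_x (`|M| * `|a x|)%:E)%E.
have K0 : (0 <= K)%E by apply: integral_ge0 => x _; rewrite lee_fin mulr_ge0.
have fm2 : (m2 setT < +oo)%E := fin_num_fun_lty (@fin_num_measure _ _ _ m2).
have Kfin : K \is a fin_num by exact: integrable_fin_num.
apply: (@le_lt_trans _ _ (\int[m2]_y (fine K)%:E)%E); last first.
  by rewrite integral_cst// lte_mul_pinfty// lee_fin fine_ge0.
rewrite fineK//.
apply: ge0_le_integral => //.
- by move=> y _; apply: integral_ge0.
- apply: (measurable_fun_fubini_tonelli_G (abse \o F)) => //=.
  exact: measurableT_comp.
move=> y _; apply: ge0_le_integral => //.
- apply: measurableT_comp => //; apply/measurable_EFinP.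
  exact: measurable_funM.
- by case/integrableP: iMa.
- move=> x _; rewrite lee_fin normrM ler_wpM2r//.
  exact: le_trans (phiM _) (ler_norm _).
Qed.

Let V y : R := \int[m1]_x (phi (x, y) * a x).

Let isec y : m1.-integrable setT (EFin \o (fun x => phi (x, y) * a x)).
Proof. exact: integrable_boundedM (msec1 y) (fun x => phiM (x, y)) ia. Qed.

Let one_integrable : m2.-integrable setT (EFin \o cst (1 : R)).
Proof.
apply/integrableP; split; first exact/measurable_EFinP.
rewrite (_ : (fun x => _) = cst 1%:E); last by apply/funext => x /=; rewrite normr1.
rewrite integral_cst// mul1e; exact: (fin_num_fun_lty (@fin_num_measure _ _ _ m2)).
Qed.

Let isec2 x : m2.-integrable setT (EFin \o (fun y => phi (x, y) * a x)).
Proof.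
rewrite (_ : (fun y => _) = (fun y => a x * (phi (x, y) * cst 1 y))).
  apply: integrable_realZ => //.
  exact: integrable_boundedM (msec2 x) (fun y => phiM (x, y)) one_integrable.
by apply/funext => y; rewrite mulr1 mulrC.
Qed.

Lemma measurable_parameter_integral : measurable_fun setT V.
Proof.
have -> : V = fine \o fubini_G m1 F by [].
exact: (measurableT_comp (fine_measurable measurableT) (measurable_fubini_G intF)).
Qed.

Lemma fubini_bounded : \int[m1]_x (a x * \int[m2]_y phi (x, y)) = \int[m2]_y V y.
Proof.
rewrite /Rintegral; congr fine.
transitivity (\int[m1]_x \int[m2]_y F (x, y))%E.
  apply: eq_integral => x _; rewrite -[RHS]fineK; last first.
    exact: integrable_fin_num (isec2 x).
  congr EFin; rewrite mulrC -(@RintegralZr _ _ _ m2 setT (fun y => phi (x, y)))//.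
  rewrite (_ : (fun y => _) = (fun y => phi (x, y) * cst 1 y)).
    exact: integrable_boundedM (msec2 x) (fun y => phiM (x, y)) one_integrable.
  by apply/funext => y; rewrite mulr1.
rewrite Fubini//; apply: eq_integral => y _.
by rewrite -[LHS]fineK//; exact: integrable_fin_num (isec y).
Qed.

End fubini_bounded.

(** An operator whose kernel is an integral of products [phi (x, w) * phi (y, w)];
  the features are bounded so that Fubini's theorem applies to every integrable
  function. *)
Section gram.
Context d1 d2 (X : measurableType d1) (Y : measurableType d2) (R : realType).
Context (m : {measure set X -> \bar R}) (fm : (m setT < +oo)%E).
Context (P : {finite_measure set Y -> \bar R}).
Context (phi : X * Y -> R) (M : R).
Hypothesis mphi : measurable_fun setT phi.
Hypothesis phiM : forall z, `|phi z| <= M.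
Implicit Types a b : X -> R.

Let fmu : set X -> \bar R := m.

HB.instance Definition _ := Measure.on fmu.

Let fmu_fin : fin_num_fun fmu.
Proof. by apply: lty_fin_num_fun; exact: fm. Qed.

HB.instance Definition _ := Measure_isFinite.Build _ _ _ fmu fmu_fin.

Let mf : {finite_measure set X -> \bar R} := fmu.

Definition gram x y : R := \int[P]_w (phi (x, w) * phi (y, w)).

Definition coeff a w : R := \int[m]_x (phi (x, w) * a x).

Definition gram_op a y : R := \int[m]_x (gram x y * a x).

Let msec x : measurable_fun setT (fun w => phi (x, w)).
Proof. exact: measurableT_comp. Qed.

Let coeff_le a w : m.-integrable setT (EFin \o a) ->
  `|coeff a w| <= M * \int[m]_x `|a x|.
Proof.
move=> ia; apply: (@Rintegral_bounded _ _ _ m (fun x => phi (x, w)) a M) => //.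
exact: measurableT_comp.
Qed.

Let mcoeff a : m.-integrable setT (EFin \o a) -> measurable_fun setT (coeff a).
Proof. by move=> ia; exact: (@measurable_parameter_integral _ _ _ _ _ mf P phi a M). Qed.

Let oneP : P.-integrable setT (EFin \o cst (1 : R)).
Proof.
apply/integrableP; split; first exact/measurable_EFinP.
rewrite (_ : (fun x => _) = cst 1%:E); last by apply/funext => x /=; rewrite normr1.
rewrite integral_cst// mul1e; exact: (fin_num_fun_lty (@fin_num_measure _ _ _ P)).
Qed.

Let icoeff a : m.-integrable setT (EFin \o a) -> P.-integrable setT (EFin \o coeff a).
Proof.
move=> ia; rewrite (_ : coeff a = (fun w => coeff a w * cst 1 w)).
  exact: (integrable_boundedM (mcoeff ia) (fun w => coeff_le w ia) oneP).
by apply/funext => w; rewrite mulr1.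
Qed.

Let iphi y : P.-integrable setT (EFin \o (fun w => phi (y, w))).
Proof.
rewrite (_ : (fun w => _) = (fun w => phi (y, w) * cst 1 w)).
  exact: integrable_boundedM (msec y) (fun w => phiM (y, w)) oneP.
by apply/funext => w; rewrite mulr1.
Qed.

Let measurable_gram y : measurable_fun setT (gram ^~ y).
Proof.
pose psi (z : Y * X) := phi (z.2, z.1).
apply: (@measurable_parameter_integral _ _ _ _ _ P mf psi (fun w => phi (y, w)) M) => //.
- apply: measurableT_comp => //; exact: measurable_swap.
- by move=> z; exact: phiM.
Qed.

Definition gram_bound : R := M * M * \int[P]_w `|cst (1 : R) w|.

Let gram_le x y : `|gram x y| <= gram_bound.
Proof.
have := @Rintegral_bounded _ _ _ P (fun w => phi (x, w) * phi (y, w)) (cst 1) (M * M).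
have -> : \int[P]_w (phi (x, w) * phi (y, w) * cst 1 w) = gram x y.
  by apply: eq_Rintegral => w _; rewrite mulr1.
apply => //; first exact: measurable_funM.
by move=> w; rewrite normrM ler_pM.
Qed.

Lemma integrable_gram a y : m.-integrable setT (EFin \o a) ->
  m.-integrable setT (EFin \o (fun x => gram x y * a x)).
Proof. by move=> ia; exact: integrable_boundedM (measurable_gram y) (gram_le ^~ y) ia. Qed.

Lemma gram_op_le a y : m.-integrable setT (EFin \o a) ->
  `|gram_op a y| <= gram_bound * \int[m]_x `|a x|.
Proof. by move=> ia; exact: Rintegral_bounded (measurable_gram y) (gram_le ^~ y) ia. Qed.

Lemma gram_opB a b y : m.-integrable setT (EFin \o a) -> m.-integrable setT (EFin \o b) ->
  gram_op (a - b) y = gram_op a y - gram_op b y.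
Proof.
move=> ia ib; rewrite /gram_op -RintegralB//; [|exact: integrable_gram..].
by apply: eq_Rintegral => x _; rewrite fsubE mulrBr.
Qed.

Lemma gram_opE a y : m.-integrable setT (EFin \o a) ->
  gram_op a y = \int[P]_w (phi (y, w) * coeff a w).
Proof.
move=> ia; pose psi (z : X * Y) := phi z * phi (y, z.2).
have mpsi : measurable_fun setT psi.
  apply: measurable_funM => //; exact: (measurableT_comp (msec y) measurable_snd).
have psiM z : `|psi z| <= M * M by rewrite normrM ler_pM.
have E : \int[m]_x (a x * \int[P]_w psi (x, w)) = \int[P]_w \int[m]_x (psi (x, w) * a x) :=
  @fubini_bounded _ _ _ _ _ mf P psi a (M * M) mpsi psiM ia.
rewrite /gram_op /gram; transitivity (\int[m]_x (a x * \int[P]_w psi (x, w))).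
  by apply: eq_Rintegral => x _; rewrite mulrC.
rewrite E; apply: eq_Rintegral => w _; rewrite /psi /coeff.
rewrite -(@RintegralZl _ _ _ m setT (fun x => phi (x, w) * a x))//.
  by apply: eq_Rintegral => x _ /=; rewrite mulrCA -mulrA.
apply: (@integrable_boundedM _ _ _ m (fun x => phi (x, w)) a M) => //.
exact: measurableT_comp.
Qed.

Lemma measurable_gram_op a : m.-integrable setT (EFin \o a) -> measurable_fun setT (gram_op a).
Proof.
move=> ia; rewrite (_ : gram_op a = fun y => \int[P]_w (phi (y, w) * coeff a w)).
  pose psi (z : Y * X) := phi (z.2, z.1).
  apply: (@measurable_parameter_integral _ _ _ _ _ P mf psi (coeff a) M) => //.
  - apply: measurableT_comp => //; exact: measurable_swap.
  - by move=> z; exact: phiM.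
  - exact: icoeff.
by apply/funext => y; exact: gram_opE.
Qed.

(** By Fubini's theorem. For [a = b] the right-hand side is an integral of squares,
  which is why Gram operators are nonnegative. *)
Lemma gram_form a b : m.-integrable setT (EFin \o a) -> m.-integrable setT (EFin \o b) ->
  \int[m]_y (b y * gram_op a y) = \int[P]_w (coeff b w * coeff a w).
Proof.
move=> ia ib.
have [K HK] : exists K : R, forall w, `|coeff a w| <= K by eexists => w; exact: coeff_le.
pose psi (z : X * Y) := phi z * coeff a z.2.
have mpsi : measurable_fun setT psi.
  apply: measurable_funM => //; exact: (measurableT_comp (mcoeff ia) measurable_snd).
have psiM z : `|psi z| <= M * K by rewrite normrM ler_pM.
have E : \int[m]_x (b x * \int[P]_w psi (x, w)) = \int[P]_w \int[m]_x (psi (x, w) * b x) :=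
  @fubini_bounded _ _ _ _ _ mf P psi b (M * K) mpsi psiM ib.
 transitivity (\int[m]_x (b x * \int[P]_w psi (x, w))).
  by apply: eq_Rintegral => y _; rewrite gram_opE.
rewrite E; apply: eq_Rintegral => w _; rewrite /psi /= [RHS]mulrC.
rewrite /(coeff b) -(@RintegralZl _ _ _ m setT (fun x => phi (x, w) * b x))//.
  by apply: eq_Rintegral => x _ /=; rewrite mulrAC mulrC.
apply: (@integrable_boundedM _ _ _ m (fun x => phi (x, w)) b M) => //.
exact: measurableT_comp.
Qed.

End gram.

(** * The neural tangent kernel *)
(** Follow the segment from [y] to a point of the ball outside of the domain: the
  supremum of the parameters at which it is inside gives a boundary point. *)
Lemma boundary_point (R : realType) n (Omega : set 'rV[R]_n) (r : R) y :
  open Omega -> Omega y -> ~ inner Omega r y ->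
  exists2 q, bdry Omega q & `|y - q| <= r.
Proof.
move=> oO Oy /existsNP[z /not_implyP[yz nOz]].
pose p (t : R) := y + t *: (z - y).
pose A := [set t : R | 0 <= t <= 1 /\ Omega (p t)].
have A0 : A 0 by split; rewrite ?lexx ?ler01// /p scale0r addr0.
have supA : has_sup A by split; [exists 0|exists 1 => t [/andP[]]].
have s0 : 0 <= sup A by apply: sup_upper_bound.
have s1 : sup A <= 1 by apply: sup_le_ub; [exists 0|move=> t [/andP[]]].
have pB s t : `|p s - p t| <= `|s - t| * r.
  rewrite /p opprD addrACA subrr add0r -scalerBl normrZ ler_wpM2l//.
  by rewrite distrC; move: yz; rewrite -ball_normE => /ltW.
have r0 : 0 < r by move: yz; rewrite -ball_normE; exact: le_lt_trans.
exists (p (sup A)); last first.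
  have := pB 0 (sup A); rewrite {1}/p scale0r addr0 => /le_trans; apply.
  by rewrite sub0r normrN ger0_norm// ler_piMl// ltW.
split.
  move=> B /nbhs_ballP[e /= e0 HB].
  have [t At st] := sup_adherent (divr_gt0 e0 r0) supA.
  exists (p t); split; first by case: At.
  apply: HB; rewrite -ball_normE /=; apply: le_lt_trans (pB _ _) _.
  rewrite -ltr_pdivlMr// ger0_norm ?subr_ge0; first by rewrite ltrBlDr -ltrBlDl.
  exact: sup_upper_bound.
move=> /interior_subset Oq.
have /nbhs_ballP[e /= e0 He] : nbhs (p (sup A)) Omega by exact: open_nbhs_nbhs.
have s1' : sup A < 1.
  rewrite lt_neqAle s1 andbT; apply/eqP => sE; apply: nOz; move: Oq.
  by rewrite sE /p scale1r addrC subrK.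
pose t := sup A + Num.min (1 - sup A) (e / r / 2).
have m0 : 0 < Num.min (1 - sup A) (e / r / 2).
  by rewrite lt_min subr_gt0 s1' !divr_gt0.
have : t <= sup A.
  apply: sup_upper_bound => //; split.
    rewrite addr_ge0 ?(ltW m0)//=.
    by rewrite /t -lerBrDl ge_min lexx.
  apply: He; rewrite -ball_normE /=; apply: le_lt_trans (pB _ _) _.
  rewrite -ltr_pdivlMr// /t opprD addrA subrr sub0r normrN ger0_norm ?(ltW m0)//.
  by rewrite gt_min ltr_pdivrMr// mulr_natr mulr2n ltrDl divr_gt0// orbT.
by rewrite /t leNgt ltrDl m0.
Qed.

Section kernel.
Context (R : realType) (n : nat) (Omega : set 'rV[R]_n).
Context (mu : {measure set 'rV[R]_n -> \bar R}).
Context (oOmega : open Omega) (bOmega : bounded_set Omega).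
Context (muD : good_density Omega mu).
Context (eta : 'rV[R]_n -> R) (eta_C3b : Ckb 3 eta)
  (eta_bdry : forall x, bdry Omega x -> eta x = 0).
Context (sigma : R -> R) (sigma_C4b : Ckb1 4 sigma).
Context d (T : measurableType d) (P : probability T R).
Context (c : {RV P >-> R}) (w : {RV P >-> 'rV[R]_n}) (b : {RV P >-> R}).
Context (K0 : R) (c_bounded : {ae P, forall t, `|c t| < K0}).
Implicit Types (u v a : 'rV[R]_n -> R) (x y : 'rV[R]_n).

Notation l2n := (l2n mu).
Notation res := (res Omega).

Let fmu : (mu setT < +oo)%E. Proof. exact: (mu_finite oOmega bOmega muD). Qed.

(** A function with bounded derivatives is Lipschitz, and [eta] vanishes at the
  nearby point of the boundary. *)
Lemma eta_strip : exists2 C : R, 0 <= C & forall r x, 0 < r -> Omega x ->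
  ~ inner Omega r x -> `|eta x| <= C * r.
Proof.
have [Ceta Beta] := eta_C3b.
have [M HM] : exists M : R, forall i x, `|pderiv i eta x| <= M.
  have /choice[f Hf] : forall i : 'I_n, exists M : R, forall x, `|pderiv i eta x| <= M.
    by move=> i; exact: (Beta [:: i]).
  exists (\sum_i `|f i|) => i x; apply: le_trans (Hf i x) _.
  rewrite (bigD1 i)//= (le_trans (ler_norm _))// lerDl.
  by apply: sumr_ge0.
have lip := lipschitz_pderiv (fun i x => Ceta.1 [::] i x isT Logic.I) HM.
exists (`|n%:R * M|) => // r x r0 Ox xr.
have [q bq xq] := boundary_point oOmega Ox xr.
rewrite -[eta x]subr0 -(eta_bdry bq); apply: le_trans (lip x q) _.
apply: (@le_trans _ _ (`|n%:R * M| * `|x - q|)); first by rewrite ler_wpM2r// ler_norm.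
by rewrite ler_wpM2l.
Qed.

(** The feature that accounts for the inner product of the arguments is unbounded
  in them. Dividing it by a weight, to be absorbed into [eta], makes it bounded. *)
Definition weight x : R := 1 + `|x|.

Definition zeta x : R := eta x * weight x.

(** Almost everywhere equal to [c], and bounded everywhere. *)
Let c' t : R := if `|c t| < K0 then c t else 0.

(** Indexed by natural numbers, so that the features form one family. *)
Let coord (k : nat) x : R := if insub k is Some i then x 0 (i : 'I_n) else 0.

(** Features whose Gram kernels add up to the neural tangent kernel. Dividing by
  the weight makes them bounded on the whole space. *)
Definition feature (k : nat) (z : 'rV[R]_n * T) : R :=
  (weight z.1)^-1 *
  match k with
  | 0 => sigma (dotv (w z.2) z.1 + b z.2)
  | 1 => c' z.2 * derive1 sigma (dotv (w z.2) z.1 + b z.2)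
  | k'.+2 => c' z.2 * derive1 sigma (dotv (w z.2) z.1 + b z.2) * coord k' z.1
  end.

Let weight_gt0 x : 0 < weight x. Proof. by rewrite ltr_wpDr. Qed.

Let mweight : measurable_fun setT weight.
Proof.
apply: continuous_measurable_fun_rV => x.
by apply: continuousD; [exact: cst_continuous|exact: norm_continuous].
Qed.

Let mpreact : measurable_fun setT (fun z : 'rV[R]_n * T => dotv (w z.2) z.1 + b z.2).
Proof.
apply: measurable_funD; last exact: (measurableT_comp _ measurable_snd).
rewrite /dotv; apply: measurable_sum => i; apply: measurable_funM.
  apply: (measurableT_comp (measurable_rV_coord i)).
  exact: (measurableT_comp _ measurable_snd).
exact: (measurableT_comp (measurable_rV_coord i) measurable_fst).
Qed.

Let msigma : measurable_fun setT sigma.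
Proof. by apply: continuous_measurable_fun; exact: (sigma_C4b.2 0%N isT).1. Qed.

Let mdsigma : measurable_fun setT (derive1 sigma).
Proof. by apply: continuous_measurable_fun; exact: (sigma_C4b.2 1%N isT).1. Qed.

Let mc' : measurable_fun setT c'.
Proof.
apply: measurable_fun_ifT => //.
by apply: measurable_fun_ltr => //; exact: measurableT_comp.
Qed.

Let mcoord k : measurable_fun setT (coord k).
Proof. by rewrite /coord; case: insub => [i|]; [exact: measurable_rV_coord|]. Qed.

Lemma measurable_feature k : measurable_fun setT (feature k).
Proof.
apply: measurable_funM.
  have mi : measurable_fun setT (fun x => (weight x)^-1).
    apply: continuous_measurable_fun_rV => x.
    apply: continuousV; first by rewrite gt_eqF.
    by apply: continuousD; [exact: cst_continuous|exact: norm_continuous].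
  exact: (measurableT_comp mi measurable_fst).
have m1 : measurable_fun setT
    (fun z : 'rV[R]_n * T => c' z.2 * derive1 sigma (dotv (w z.2) z.1 + b z.2)).
  apply: measurable_funM; first exact: (measurableT_comp mc' measurable_snd).
  exact: measurableT_comp.
case: k => [|[//|k]]; first exact: measurableT_comp.
by apply: measurable_funM => //; exact: (measurableT_comp (mcoord k) measurable_fst).
Qed.

Lemma feature_bounded : exists M : R, forall k z, `|feature k z| <= M.
Proof.
have [_ [M0 HM0]] := sigma_C4b.2 0%N isT; have [_ [M1 HM1]] := sigma_C4b.2 1%N isT.
exists (`|M0| + `|K0| * `|M1|) => k [x t]; rewrite /feature /=.
have c'K : `|c' t| <= `|K0|.
  rewrite /c'; case: ifPn => [/ltW h|]; last by rewrite normr0.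
  exact: le_trans h (ler_norm _).
have s0 s : `|sigma s| <= `|M0| by exact: le_trans (HM0 s) (ler_norm _).
have s1 s : `|derive1 sigma s| <= `|M1| by exact: le_trans (HM1 s) (ler_norm _).
have w1 : `|(weight x)^-1| <= 1.
  by rewrite ger0_norm ?invr_ge0 ?(ltW (weight_gt0 x))// invf_le1// lerDl.
have cs : `|c' t * derive1 sigma (dotv (w t) x + b t)| <= `|K0| * `|M1|.
  by rewrite normrM ler_pM.
have Q0 : 0 <= `|K0| * `|M1| by rewrite mulr_ge0.
case: k => [|[|k]].
- by rewrite normrM -[leRHS]mul1r ler_pM// (le_trans (s0 _))// lerDl.
- by rewrite normrM -[leRHS]mul1r ler_pM// (le_trans cs)// lerDr.
rewrite mulrCA normrM; apply: le_trans (_ : `|K0| * `|M1| * 1 <= _); last by rewrite mulr1 lerDr.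
apply: ler_pM => //; rewrite normrM ger0_norm ?invr_ge0 ?(ltW (weight_gt0 x))// ler_pdivrMl// mulr1.
rewrite /coord; case: insub => [i|]; last by rewrite normr0 ltW.
by rewrite (le_trans (normr_coord _ _))// lerDr.
Qed.

Let integrable_feature k l x y :
  P.-integrable setT (EFin \o (fun t => feature k (x, t) * feature l (y, t))).
Proof.
have [M HM] := feature_bounded.
have i1 : P.-integrable setT (EFin \o cst (1 : R)).
  exact: finite_measure_integrable_cst.
have i2 : P.-integrable setT (EFin \o (fun t => feature l (y, t))).
  rewrite (_ : (fun t => feature l (y, t)) = (fun t => feature l (y, t) * cst 1 t)).
    apply: integrable_boundedM (fun t => HM l (y, t)) i1.
    exact: (measurableT_comp (measurable_feature l)).
  by apply/funext => t; rewrite mulr1.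
apply: integrable_boundedM (fun t => HM k (x, t)) i2.
exact: (measurableT_comp (measurable_feature k)).
Qed.

(** The factor [dotv x y + 1] is the sum of the products of the coordinates and of
  the constant features of [x] and [y]. *)
Lemma ntk_features x y : ntk_eta c w b sigma eta x y =
  zeta x * zeta y * \sum_(k < n.+2) gram P (feature k) x y.
Proof.
rewrite /ntk_eta /zeta [eta x * _ * (eta y * _)]mulrACA -[RHS]mulrA; congr (_ * _).
have wx := gt_eqF (weight_gt0 x); have wy := gt_eqF (weight_gt0 y).
have sumE m : \sum_(k < m) gram P (feature k) x y =
    \int[P]_t \sum_(k < m) (feature k (x, t) * feature k (y, t)) /\
    P.-integrable setT (EFin \o (fun t => \sum_(k < m) (feature k (x, t) * feature k (y, t)))).
  elim: m => [|m [IH im]].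
    rewrite big_ord0; split.
      rewrite (_ : (fun t => _) = cst 0); last by apply/funext => t; rewrite big_ord0.
      by rewrite Rintegral_cst// mul0r.
    rewrite (_ : (fun t => _) = cst 0); last by apply/funext => t; rewrite big_ord0.
    exact: finite_measure_integrable_cst.
  have E : (fun t => \sum_(k < m.+1) (feature k (x, t) * feature k (y, t))) =
    (fun t => \sum_(k < m) (feature k (x, t) * feature k (y, t)) +
      feature m (x, t) * feature m (y, t)) by apply/funext => t; rewrite big_ord_recr.
  split; last by rewrite E; apply: integrable_realD.
  rewrite big_ord_recr/= IH E RintegralD//.
rewrite (sumE _).1 -RintegralZl//; last exact: (sumE _).2.
rewrite /ntk unlock /Rintegral; congr fine; apply: ae_eq_integral => //.
- apply/measurable_EFinP.
  have mp z : measurable_fun setT (fun t => dotv (w t) z + b t).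
    exact: (measurableT_comp mpreact (pair1_measurable z)).
  apply: measurable_funD.
    by apply: measurable_funM; exact: measurableT_comp.
  apply: measurable_funM => //; apply: measurable_funM; last exact: measurableT_comp.
  by apply: measurable_funM; [exact: measurable_funX|exact: measurableT_comp].
- apply/measurable_EFinP; apply: measurable_funM => //.
  by apply/measurable_EFinP; case/integrableP: (sumE n.+2).2.
apply: filterS c_bounded => t ct _; congr EFin.
have c'E : c' t = c t by rewrite /c' ct.
rewrite !big_ord_recl /= /feature /= c'E.
rewrite (eq_bigr (fun i : 'I_n => (weight x)^-1 * (weight y)^-1 * (c t * derive1 sigma (dotv (w t) x + b t)) *
  (c t * derive1 sigma (dotv (w t) y + b t)) * (x 0 i * y 0 i))); last first.
  move=> i _; have cE z : coord (0 + i) z = z 0 i by rewrite /coord add0n valK.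
  rewrite !cE.
  by move: (weight x)^-1 (weight y)^-1 (derive1 sigma _) (derive1 sigma _) => p q r s; ring.
rewrite -mulr_sumr -/(dotv x y).
move: (sigma _) (sigma _) (derive1 sigma _) (derive1 sigma _) (dotv x y) (c t) => p q r s t' ct'.
by field; rewrite wx wy.
Qed.

Definition kernel_opn := kernel_op Omega mu (ntk_eta c w b sigma eta).

Lemma zeta_bounded : exists2 C : R, 0 <= C & forall x, Omega x -> `|zeta x| <= C * `|eta x|.
Proof.
have [M [_ HM]] := bOmega.
exists (`|M| + 2) => [|x Ox]; first by rewrite addr_ge0.
rewrite /zeta normrM mulrC ler_wpM2r// ger0_norm ?(ltW (weight_gt0 x))//.
have := HM (`|M| + 1) _ x Ox; rewrite (le_lt_trans (ler_norm _)) ?ltrDl// => /(_ isT) /= h.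
by rewrite /weight; lra.
Qed.

Lemma eta_bounded : exists2 C : R, 0 <= C & forall x, `|eta x| <= C.
Proof.
have [C HC] := eta_C3b.2 [::] isT; exists `|C| => // x.
exact: le_trans (HC x) (ler_norm _).
Qed.

Let mzeta : measurable_fun setT zeta.
Proof.
apply: measurable_funM => //; apply: continuous_measurable_fun_rV => x.
exact: (eta_C3b.1.2 [::] x isT Logic.I).
Qed.

Definition wtd u := res (zeta * u).

Lemma wtd_sqint : exists2 C : R, 0 <= C & forall u, sqint mu u ->
  sqint mu (wtd u) /\ l2n (wtd u) <= C * l2n u.
Proof.
have [C C0 HC] := zeta_bounded; have [D D0 HD] := eta_bounded.
exists (C * D) => [|u su]; first by rewrite mulr_ge0.
have E : wtd u = (fun x => res zeta x * u x).
  by apply/funext => x; rewrite /wtd !resE fmulE mulrA.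
rewrite E; apply: sqintM_bounded => // [|x].
  by apply: (measurable_res oOmega); exact: measurable_funTS.
have [Ox|nO] := pselect (Omega x); last by rewrite res_out// normr0 mulr_ge0.
by rewrite res_in// (le_trans (HC x Ox))// ler_wpM2l.
Qed.

Let sqint_one : sqint mu (cst 1).
Proof. by apply: (sqint_bounded oOmega bOmega muD (M := 1)) => // x; rewrite normr1. Qed.

Let sqint_int a : sqint mu a -> mu.-integrable setT (EFin \o a).
Proof.
move=> sa; rewrite (_ : a = (fun x => a x * cst 1 x)); first exact: sqintM_integrable.
by apply/funext => x; rewrite mulr1.
Qed.

Let l1_le a : sqint mu a -> \int[mu]_x `|a x| <= l2n a * l2n (cst 1).
Proof.
move=> sa; have := cauchy_schwarz sa sqint_one.
by under eq_Rintegral do rewrite mulr1.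
Qed.

Let mfeature := measurable_feature.

Lemma kernel_opE u y : sqint mu u ->
  kernel_opn u y = zeta y * \sum_(k < n.+2) gram_op mu P (feature k) (wtd u) y.
Proof.
move=> su; have [M HM] := feature_bounded.
have [C C0 HC] := wtd_sqint; have ia := sqint_int (HC u su).1.
have ig k : mu.-integrable setT (EFin \o (fun x => gram P (feature k) x y * wtd u x)).
  exact: (integrable_gram fmu P (mfeature k) (HM k)).
have sumE m : \sum_(k < m) gram_op mu P (feature k) (wtd u) y =
    \int[mu]_x \sum_(k < m) (gram P (feature k) x y * wtd u x) /\
    mu.-integrable setT (EFin \o (fun x => \sum_(k < m) (gram P (feature k) x y * wtd u x))).
  elim: m => [|m [IH im]].
    rewrite big_ord0; rewrite (_ : (fun x => _) = cst 0); last first.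
      by apply/funext => t; rewrite big_ord0.
    by rewrite Rintegral_cst// mul0r; split=> //; exact: integrable0.
  have E : (fun x => \sum_(k < m.+1) (gram P (feature k) x y * wtd u x)) =
    (fun x => \sum_(k < m) (gram P (feature k) x y * wtd u x) +
      gram P (feature m) x y * wtd u x) by apply/funext => t; rewrite big_ord_recr.
  split; last by rewrite E; apply: integrable_realD.
  by rewrite big_ord_recr/= IH E RintegralD.
rewrite (sumE _).1 -RintegralZl//; last exact: (sumE _).2.
rewrite /kernel_opn /kernel_op Rintegral_mkcond; apply: eq_Rintegral => x _.
rewrite patchE /wtd; case: ifPn => [|] xO.
  rewrite ntk_features -mulr_suml res_in; last by rewrite inE in xO.
  rewrite fmulE; move: (\sum_(k < n.+2) _) (zeta x) (zeta y) (u x) => p q r s; ring.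
rewrite big1 ?mulr0// => k _; rewrite res_out ?mulr0// => Ox.
by move: xO; rewrite notin_setE => /(_ Ox).
Qed.

Lemma kernel_bound : exists2 C : R, 0 <= C & forall u, sqint mu u ->
  forall y, `|kernel_opn u y| <= C * `|zeta y| * l2n u.
Proof.
have [M HM] := feature_bounded; have [C C0 HC] := wtd_sqint.
pose G := `|gram_bound P M|.
exists (n.+2%:R * (G * (C * l2n (cst 1)))) => [|u su y].
  exact: mulr_ge0 (ler0n _ _) (mulr_ge0 (normr_ge0 _) (mulr_ge0 C0 (l2n_ge0 _ _))).
have [sw lw] := HC u su; have ia := sqint_int sw.
rewrite kernel_opE// normrM mulrAC mulrC ler_wpM2r//.
apply: le_trans (ler_norm_sum _ _ _) _.
apply: (@le_trans _ _ (\sum_(k < n.+2) (G * (C * l2n (cst 1)) * l2n u))); last first.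
  by rewrite sumr_const card_ord -[leLHS]mulr_natl -[leRHS]mulrA.
apply: ler_sum => k _.
apply: le_trans (gram_op_le fmu P (mfeature k) (HM k) y ia) _.
have I0 : 0 <= \int[mu]_x `|wtd u x| by exact: Rintegral_ge0.
apply: (@le_trans _ _ (G * \int[mu]_x `|wtd u x|)); first by rewrite ler_wpM2r// ler_norm.
rewrite -[leRHS]mulrA ler_wpM2l ?normr_ge0//; apply: le_trans (l1_le sw) _.
by rewrite [leRHS]mulrAC ler_wpM2r// l2n_ge0.
Qed.

Lemma kernel_sqint : exists2 C : R, 0 <= C & forall u, sqint mu u ->
  sqint mu (kernel_opn u) /\ l2n (kernel_opn u) <= C * l2n u.
Proof.
have [C C0 HC] := kernel_bound; have [D D0 HD] := zeta_bounded; have [E E0 HE] := eta_bounded.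
have [M HM] := feature_bounded; have [W W0 HW] := wtd_sqint.
exists (C * (D * E) * l2n (cst 1)) => [|u su]; first by rewrite !mulr_ge0 ?l2n_ge0.
have mk : measurable_fun setT (kernel_opn u).
  rewrite (_ : kernel_opn u = fun y => zeta y * \sum_(k < n.+2) gram_op mu P (feature k) (wtd u) y).
    apply: measurable_funM => //; apply: measurable_sum => k.
    exact: (measurable_gram_op fmu P (mfeature k) (HM k) (sqint_int (HW u su).1)).
  by apply/funext => y; exact: kernel_opE.
pose KK := C * (D * E) * l2n u; have K_ge0 : 0 <= KK by rewrite !mulr_ge0 ?l2n_ge0.
have sK : sqint mu (KK *: cst 1) by exact: sqintZ.
have [|s l] := @sqint_le _ _ _ mu (kernel_opn u) (KK *: cst 1) mk sK.
  apply: filterS (mu_ae_Omega oOmega muD) => y Oy.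
  rewrite fscaleE mulr1 [leRHS]ger0_norm//; apply: le_trans (HC u su y) _.
  rewrite ler_wpM2r ?l2n_ge0// ler_wpM2l//; apply: le_trans (HD y Oy) _.
  by rewrite ler_wpM2l.
split=> //; apply: le_trans l _; rewrite l2nZ// ger0_norm//.
by rewrite /KK mulrAC.
Qed.

Lemma kernel_opB u v : sqint mu u -> sqint mu v ->
  kernel_opn (u - v) = kernel_opn u - kernel_opn v.
Proof.
move=> su sv; have [M HM] := feature_bounded; have [W W0 HW] := wtd_sqint.
have iu := sqint_int (HW u su).1; have iv := sqint_int (HW v sv).1.
apply/funext => y; rewrite fsubE !kernel_opE//; last exact: sqintB.
rewrite -mulrBr; congr (_ * _); rewrite -sumrB; apply: eq_bigr => k _.
rewrite -(gram_opB fmu P (mfeature k) (HM k) y iu iv); congr (gram_op _ _ _ _ _).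
apply/funext => x; rewrite fsubE /wtd !resE !fmulE fsubE.
by move: (\1_ _ x) (zeta x) (u x) (v x) => p q r s; ring.
Qed.

(** The form of the kernel is a sum of inner products of feature coefficients,
  hence symmetric and nonnegative. *)
Lemma kernel_form u v : sqint mu u -> sqint mu v -> ldot mu (kernel_opn u) v =
  \sum_(k < n.+2) \int[P]_t (coeff mu (feature k) (wtd v) t * coeff mu (feature k) (wtd u) t).
Proof.
move=> su sv; have [M HM] := feature_bounded; have [W W0 HW] := wtd_sqint.
have [C C0 HC] := kernel_sqint.
have swu := (HW u su).1; have swv := (HW v sv).1.
have iu := sqint_int swu; have iv := sqint_int swv.
pose Tk k := gram_op mu P (feature k) (wtd u).
have sT k : sqint mu (Tk k).
  apply: (sqint_bounded oOmega bOmega muD (M := gram_bound P M * \int[mu]_x `|wtd u x|)).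
    exact: (measurable_gram_op fmu P (mfeature k) (HM k) iu).
  by move=> y; exact: (gram_op_le fmu P (mfeature k) (HM k) y iu).
transitivity (ldot mu (wtd v) (\sum_(k < n.+2) Tk k)).
  rewrite /ldot /Rintegral; congr fine; apply: ae_eq_integral => //.
  - apply/measurable_EFinP; apply: measurable_funM; last exact: (sqint_measurable sv).
    exact: (sqint_measurable (HC u su).1).
  - apply/measurable_EFinP; apply: measurable_funM; first exact: (sqint_measurable swv).
    by apply: (@sqint_measurable _ _ _ mu); exact: sqint_sum.
  apply: filterS (mu_ae_Omega oOmega muD) => y Oy _; congr EFin.
  rewrite kernel_opE// fct_sumE /wtd (res_in _ Oy) fmulE -/(wtd u).
  by move: (\sum_(k < n.+2) _) (zeta y) (v y) => p q r; ring.
elim: n.+2 => [|m IH].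
  rewrite !big_ord0 /ldot; transitivity (\int[mu]_x (0 : R)).
    by apply: eq_Rintegral => x _; rewrite mulr0.
  by rewrite Rintegral_cst// mul0r.
rewrite !big_ord_recr/= ldotD//; last exact: sqint_sum.
rewrite IH; congr (_ + _).
exact: (gram_form fmu P (mfeature m) (HM m) iu iv).
Qed.

Lemma kernel_sym u v : sqint mu u -> sqint mu v ->
  ldot mu (kernel_opn u) v = ldot mu (kernel_opn v) u.
Proof.
move=> su sv; rewrite (kernel_form su sv) (kernel_form sv su); apply: eq_bigr => k _.
by apply: eq_Rintegral => t _; rewrite mulrC.
Qed.

Lemma kernel_ge0 u : sqint mu u -> 0 <= ldot mu (kernel_opn u) u.
Proof.
move=> su; rewrite kernel_form//; apply: sumr_ge0 => k _.
by apply: Rintegral_ge0 => t _; rewrite -expr2 sqr_ge0.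
Qed.

(** The factor [eta y] comes out of the integral, and it vanishes linearly at the
  boundary. *)
Lemma kernel_strip u : sqint mu u -> exists2 C : R, 0 <= C & forall r x, 0 < r -> Omega x ->
  ~ inner Omega r x -> `|kernel_opn u x| <= C * r.
Proof.
move=> su; have [C C0 HC] := kernel_bound; have [D D0 HD] := zeta_bounded.
have [E E0 HE] := eta_strip.
exists (C * (D * E) * l2n u) => [|r x r0 Ox xr]; first by rewrite !mulr_ge0// l2n_ge0.
apply: le_trans (HC u su x) _; rewrite [leRHS]mulrAC ler_wpM2r ?l2n_ge0// -mulrA ler_wpM2l//.
apply: le_trans (HD x Ox) _; rewrite -mulrA ler_wpM2l//; exact: HE.
Qed.

End kernel.

(** * An integrated dissipation inequality *)
Section dissipation.
Context (R : realType).
Implicit Types (f phi E : R -> R).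

(** Continuity and derivatives on the half-line are one-sided at 0; extending a
  function by its value at 0 reduces them to the two-sided ones. *)
Definition cont0 f := forall t, 0 <= t -> forall e : R, 0 < e -> exists2 d : R, 0 < d &
  forall s, 0 <= s -> `|s - t| < d -> `|f s - f t| <= e.

Definition clamp f s : R := f (Num.max 0 s).

Lemma clamp_ge0 f s : 0 <= s -> clamp f s = f s.
Proof. by move=> s0; rewrite /clamp max_r. Qed.

Lemma clamp_continuous f : cont0 f -> continuous (clamp f).
Proof.
move=> cf t; apply/cvgrPdist_le => e e0.
have m0 (s : R) : 0 <= Num.max 0 s by rewrite le_max lexx.
have [d d0 Hd] := cf _ (m0 t) e e0.
near=> s; rewrite distrC; apply: Hd => //.
have : `|Num.max 0 s - Num.max 0 t| <= `|s - t|.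
  case: (leP 0 s) => hs; case: (leP 0 t) => ht //.
  - by rewrite subr0 !ger0_norm ?subr_ge0; lra.
  - by rewrite sub0r normrN ger0_norm// distrC ger0_norm ?subr_ge0; lra.
  - by rewrite subrr normr0.
move=> /le_lt_trans; apply; near: s.
by exists d => //= s; rewrite /ball_ distrC.
Unshelve. all: by end_near. Qed.

Definition quot_cvg E t (l : R) := forall e : R, 0 < e -> exists2 d : R, 0 < d &
  forall s, 0 <= s -> s != t -> `|s - t| < d -> `|(s - t)^-1 * (E s - E t) - l| <= e.

Lemma quot_cvg_cont0 E : (forall t, 0 <= t -> exists l, quot_cvg E t l) -> cont0 E.
Proof.
move=> H t t0 e e0; have [l Hl] := H t t0.
have [d d0 Hd] := Hl 1 ltr01.
have K0 : 0 < `|l| + 1 by rewrite ltr_wpDl.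
exists (Num.min d (e / (`|l| + 1))) => [|s s0]; first by rewrite lt_min d0 divr_gt0.
rewrite lt_min => /andP[sd se]; have [->|st] := eqVneq s t.
  by rewrite subrr normr0 ltW.
have := Hd s s0 st sd => q.
have st0 : s - t != 0 by rewrite subr_eq0.
have : `|(s - t)^-1 * (E s - E t)| <= `|l| + 1.
  rewrite -[X in `|X|](subrK l) (le_trans (ler_normD _ _))// addrC lerD2l//.
rewrite normrM normfV ler_pdivrMl ?normr_gt0// => /le_trans; apply.
by rewrite -ler_pdivlMr// ltW.
Qed.

Lemma quot_cvg_derive E t l : 0 < t -> quot_cvg E t l -> is_derive t 1 (clamp E) l.
Proof.
move=> t0 H.
have cv : (fun h => h^-1 *: ((clamp E \o shift t) (h *: 1) - clamp E t)) @ 0^' --> l.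
  apply/cvgrPdist_le => e e0; have [d d0 Hd] := H (e / 2) (divr_gt0 e0 (ltr0n _ 2)).
  near=> h.
  have h0 : h != 0 by near: h; exact: nbhs_dnbhs_neq.
  have hd : `|h| < d.
    near: h; apply: dnbhs0_lt => //.
  have ht : `|h| < t by near: h; apply: dnbhs0_lt.
  have ht0 : 0 <= h + t by have := ler_norm (- h); rewrite normrN; lra.
  have hE : (h *: 1 : R) = h by rewrite [LHS]mulr1.
  rewrite distrC /= hE !clamp_ge0// ?ltW//.
  have q := Hd (h + t) ht0; rewrite addrK in q.
  have ht' : h + t != t by rewrite -subr_eq0 addrK.
  by apply: le_lt_trans (q ht' hd) _; rewrite ltr_pdivrMr// ltr_pMr// ltr1n.
apply: DeriveDef; first by apply: cvgP cv.
exact: cvg_lim cv.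
Unshelve. all: by end_near. Qed.

(** The function [E t + k * \int_0^t phi] is nonincreasing, and [E] is
  nonnegative. *)
Theorem dissipation E phi (k : R) : 0 < k -> (forall t, 0 <= t -> 0 <= E t) ->
  (forall t, 0 <= t -> 0 <= phi t) -> cont0 phi ->
  (forall t, 0 <= t -> exists2 l, l <= - (k * phi t) & quot_cvg E t l) ->
  forall t, 0 <= t ->
  (\int[lebesgue_measure]_(s in `[0%R, t]) (phi s)%:E <= (E 0 / k)%:E)%E.
Proof.
move=> k0 E0 phi0 cphi HE t t0.
have cE : cont0 E by apply: quot_cvg_cont0 => s s0; have [l _ ?] := HE s s0; exists l.
have c1 := clamp_continuous cphi; have c2 := clamp_continuous cE.
have int u : (lebesgue_measure : {measure set (measurableTypeR R) -> \bar R}).-integrable `[0, u] (EFin \o clamp phi).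
  apply: continuous_compact_integrable; first exact: segment_compact.
  exact: continuous_subspaceT.
pose F x := parameterized_integral lebesgue_measure 0 x (clamp phi).
have -> : (\int[lebesgue_measure]_(s in `[0%R, t]) (phi s)%:E = (F t)%:E)%E.
  rewrite /F /parameterized_integral /Rintegral fineK; last exact: integrable_fin_num (int t).
  apply: eq_integral => s; rewrite inE/= in_itv/= => /andP[s0 _].
  by rewrite clamp_ge0.
have F0 : F 0 = 0 by rewrite /F /parameterized_integral set_itv1 Rintegral_set1.
rewrite lee_fin ler_pdivlMr//.
have dF (x : R) : 0 < x -> is_derive x 1 F (phi x).
  move=> x0; have [|d1 d2] := @continuous_FTC1_closed R (clamp phi) 0 x (x + 1) _ (int _) x0 (c1 x).
    by rewrite ltrDl.
  apply: DeriveDef => //; by rewrite -derive1E d2 clamp_ge0 ?(ltW x0).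
pose G : R -> R := clamp E + k *: F.
have dG (x : R) : 0 < x -> exists2 g, g <= 0 & is_derive x 1 G g.
  move=> x0; have [l lk Hl] := HE x (ltW x0).
  have i1 := quot_cvg_derive x0 Hl; have i2 := dF x x0.
  exists (l + k *: phi x); last exact: is_deriveD.
  by rewrite /GRing.scale /=; lra.
have : G t <= G 0.
  move: t0; rewrite le_eqVlt => /orP[/eqP <-//|t0].
  have H1 (x : R) : x \in `]0, t[%R -> derivable G x 1.
    by rewrite in_itv/= => /andP[x0 _]; have [g _ Hg] := dG x x0; exact: ex_derive.
  have H2 (x : R) : x \in `]0, t[%R -> derive1 G x <= 0.
    rewrite in_itv/= => /andP[x0 _]; have [g g0 Hg] := dG x x0.
    by rewrite derive1E derive_val.
  have H3 : {within `[0, t], continuous G}.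
    move=> x; apply: continuousD; first exact: (continuous_subspaceT c2).
    apply: continuousZl_tmp.
    exact: (parameterized_integral_continuous (ltW t0) (int t)).
  have := ler0_derive1_le_cc H1 H2 H3; apply; last exact: ltW.
    by rewrite in_itv/= lexx (ltW t0).
  by rewrite in_itv/= lexx (ltW t0).
rewrite /G !faddE !fscaleE F0 mulr0 addr0 !clamp_ge0//.
have := E0 t t0; rewrite mulrC; lra.
Qed.

End dissipation.

(** * Energy along the flow *)
Lemma cvg0_near (R : realType) (T : Type) (F : set_system T) {FF : Filter F} (f : T -> \bar R) :
  f @ F --> 0%E -> forall e : R, 0 < e -> \forall s \near F, (f s < e%:E)%E.
Proof.
move=> fF e e0.
have H : nbhs 0%E [set x : \bar R | (x < e%:E)%E].
  apply: open_nbhs_nbhs; split; first exact: open_ereal_lt_ereal.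
  by rewrite /= lte_fin.
exact: (fF _ H).
Qed.

Section flow.
Context (R : realType) (n : nat) (Omega : set 'rV[R]_n).
Context (mu : {measure set 'rV[R]_n -> \bar R}).
Context (oOmega : open Omega) (bOmega : bounded_set Omega).
Context (muD : good_density Omega mu).
Context (L B : ('rV[R]_n -> R) -> ('rV[R]_n -> R)).
Hypothesis HL : lipschitz_operator Omega mu L.
Implicit Types (f g h u v : 'rV[R]_n -> R).

Notation H2 := (Hp Omega mu 2).
Notation h2n := (h2n Omega mu).
Notation l2n := (l2n mu).
Notation dot := (ldot mu).

Context (gamma : R) (gamma0 : 0 < gamma).
Hypothesis HM : forall f1 f2, H20 Omega mu f1 -> H20 Omega mu f2 ->
  dot (f1 - f2) (L f1 - L f2) <= - (gamma * l2n (f1 - f2) ^+ 2).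
Hypothesis HG : gateaux_differentiable Omega mu L.

(** Divide the monotonicity along [t *: h] by [t ^ 2] and let [t] tend to 0. *)
Lemma gateaux_monotone g h (C : R) : H2 g -> H2 h -> 0 <= C ->
  (forall r x, 0 < r -> Omega x -> ~ inner Omega r x -> `|h x| <= C * r) ->
  exists V, [/\ sqint mu V, dot h V <= - (gamma * l2n h ^+ 2) &
    forall e : R, 0 < e -> exists2 d : R, 0 < d & forall t : R, t != 0 -> `|t| < d ->
      l2n (t^-1 *: (L (g + t *: h) - L g) - V) <= e].
Proof.
move=> Hg Hh C0 hC; have [V sV cV] := HG Hg Hh.
have Ht (t : R) : H2 (g + t *: h).
  by apply: (Hp2D oOmega bOmega muD) => //; exact: (Hp2Z oOmega bOmega muD).
have sX (t : R) : sqint mu (L (g + t *: h) - L g).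
  by apply: sqintB; apply: (sqint_op HL).
have lim e : 0 < e -> exists2 d : R, 0 < d & forall t : R, t != 0 -> `|t| < d ->
    l2n (t^-1 *: (L (g + t *: h) - L g) - V) <= e.
  move=> e0; have : nbhs (0 : R) (fun t : R => t != 0 ->
      (L2norm mu (t^-1 *: (L (g + t *: h) - L g) - V)%R < e%:E)%E) by exact: (cvg0_near cV e0).
  move=> /nbhs_ballP[d /= d0 Hd].
  exists d => // t t0 td; have := Hd t; rewrite -ball_normE /= sub0r normrN => /(_ td t0).
  rewrite /L2norm Lnorm_l2n ?lte_fin => [/ltW//|].
  by apply: sqintB => //; exact: sqintZ.
exists V; split=> //.
have sh := Hp_sqint Hh.
apply/ler_addgt0Pr => e e0.
have K0 : 0 < l2n h + 1 by rewrite ltr_wpDl// l2n_ge0.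
have [d d0 Hd] := lim _ (divr_gt0 e0 K0).
pose t := d / 2; have t0 : 0 < t by rewrite divr_gt0.
have td : `|t| < d by rewrite gtr0_norm// ltr_pdivrMr// ltr_pMr// ltr1n.
have tn : t != 0 by rewrite gt_eqF.
pose X := L (g + t *: h) - L g.
have Hth : H2 (t *: h) by exact: (Hp2Z oOmega bOmega muD).
have C1 : 0 <= `|t| * C by rewrite mulr_ge0.
have m : dot (t *: h) X <= - (gamma * l2n (t *: h) ^+ 2).
  apply: (monotone_near_direction oOmega bOmega muD HL gamma0 HM Hg Hth C1).
  move=> r x r0 Ox xr; rewrite fscaleE normrM -mulrA ler_wpM2l//; exact: hC.
have st : sqint mu (t^-1 *: X) by exact: (sqintZ _ (sX t)).
have e1 : dot h (t^-1 *: X) <= - (gamma * l2n h ^+ 2).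
  rewrite (ldotZ _ sh (sX t)) mulrC ler_pdivrMr//.
  rewrite -(ler_pM2l t0); move: m; rewrite ldotC (ldotZ _ (sX t) sh) l2nZ// (ldotC mu X) => /le_trans; apply.
  rewrite exprMn real_normK ?num_real// le_eqVlt; apply/orP; left; apply/eqP; ring.
have e2 : `|dot h (V - t^-1 *: X)| <= e.
  apply: le_trans (ldot_le sh (sqintB sV st)) _.
  rewrite -(l2nN mu (V - _)) opprB.
  apply: le_trans (ler_wpM2l (l2n_ge0 _ _) (Hd t tn td)) _.
  by rewrite mulrCA ler_piMr ?(ltW e0)// ler_pdivrMr// mul1r lerDl.
have -> : dot h V = dot h (t^-1 *: X) + dot h (V - t^-1 *: X).
  by rewrite (ldotB sh sV st) addrC subrK.
by apply: lerD => //; exact: le_trans (ler_norm _) e2.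
Qed.

Context (Cb : R) (Cb0 : 0 <= Cb).
Hypothesis Bsq : forall u, sqint mu u -> sqint mu (B u) /\ l2n (B u) <= Cb * l2n u.
Hypothesis BB : forall u v, sqint mu u -> sqint mu v -> B (u - v) = B u - B v.
Hypothesis Bsym : forall u v, sqint mu u -> sqint mu v -> dot (B u) v = dot (B v) u.
Hypothesis Bge0 : forall u, sqint mu u -> 0 <= dot (B u) u.
Hypothesis Bstrip : forall u, sqint mu u -> exists2 C : R, 0 <= C &
  forall r x, 0 < r -> Omega x -> ~ inner Omega r x -> `|B u x| <= C * r.

Context (alpha : R) (alpha0 : 0 < alpha) (Q : R -> 'rV[R]_n -> R).
Hypothesis HQ : forall t, 0 <= t ->
  H2 (Q t) /\ H2_deriv Omega mu Q t (alpha *: B (L (Q t))).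

Let l (s : R) := L (Q s).

Let sl s : 0 <= s -> sqint mu (l s).
Proof. by move=> s0; apply: (sqint_op HL); have [] := HQ s0. Qed.

(** As [L] is Lipschitz from H^2 to L^2, replacing [Q s] by its first-order expansion
  at [t] changes [L (Q s)] by an error that is small compared with [s - t]. *)
Lemma flow_quotient t : 0 <= t -> exists V, [/\ sqint mu V,
    dot (B (l t)) V <= - (gamma * alpha * l2n (B (l t)) ^+ 2) &
    forall e : R, 0 < e -> exists2 d : R, 0 < d & forall s : R, 0 <= s -> s != t -> `|s - t| < d ->
      l2n ((s - t)^-1 *: (l s - l t) - V) <= e].
Proof.
move=> t0; have [HQt [HD cD]] := HQ t0.
set D := alpha *: B (L (Q t)) in HD cD.
have slt := sl t0; have [sB _] := Bsq slt.
have [C C0 hC] := Bstrip slt.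
have C1 : 0 <= alpha * C by rewrite mulr_ge0// ltW.
have [|V [sV mV cV]] := gateaux_monotone HQt HD C1.
  move=> r x r0 Ox xr; rewrite /D fscaleE normrM (gtr0_norm alpha0) -mulrA.
  by rewrite ler_wpM2l ?(ltW alpha0)//; exact: hC.
exists V; split=> //.
  move: mV; rewrite /D ldotC ldotZ// l2nZ// (gtr0_norm alpha0) (ldotC mu V).
  rewrite exprMn => mV; rewrite -(ler_pM2l alpha0); apply: le_trans mV _.
  by rewrite le_eqVlt; apply/orP; left; apply/eqP; ring.
move=> e e0.
have [Cl Cl0 HCl] := op_lipschitz oOmega bOmega muD HL.
pose N := h2const R n; have N0 : 0 <= N by exact: ler0n.
pose K := Cl * N + 1; have K0 : 0 < K by rewrite ltr_wpDl// mulr_ge0.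
have e20 : 0 < e / 2 by rewrite divr_gt0.
have e1 : 0 < e / 2 / K by rewrite divr_gt0.
have : nbhs t (fun s : R => s != t -> 0 <= s ->
    (Hnorm Omega mu 2 ((s - t)^-1 *: (Q s - Q t) - D)%R < (e / 2 / K)%:E)%E) by exact: (cvg0_near cD e1).
move=> /nbhs_ballP[d1 /= d10 Hd1].
have [d2 d20 Hd2] := cV _ e20.
exists (Num.min d1 d2) => [|s s0 st]; first by rewrite lt_min d10.
rewrite lt_min => /andP[sd1 sd2].
have [HQs _] := HQ s0.
have dn : s - t != 0 by rewrite subr_eq0.
pose q := (s - t)^-1 *: (Q s - Q t) - D.
have Hq : H2 q.
  apply: (Hp2B oOmega bOmega muD) => //; apply: (Hp2Z oOmega bOmega muD).
  exact: (Hp2B oOmega bOmega muD).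
have hq : h2n q <= e / 2 / K.
  have := Hd1 s; rewrite -ball_normE /= distrC => /(_ sd1 st s0).
  by rewrite Hnorm2E// lte_fin => /ltW.
have Hgt : H2 (Q t + (s - t) *: D).
  by apply: (Hp2D oOmega bOmega muD) => //; exact: (Hp2Z oOmega bOmega muD).
have s1 : sqint mu (l s - L (Q t + (s - t) *: D)).
  by apply: sqintB; apply: (sqint_op HL).
have s2 : sqint mu (L (Q t + (s - t) *: D) - l t).
  by apply: sqintB => //; apply: (sqint_op HL).
have -> : (s - t)^-1 *: (l s - l t) - V = (s - t)^-1 *: (l s - L (Q t + (s - t) *: D))
   + ((s - t)^-1 *: (L (Q t + (s - t) *: D) - l t) - V).
  by rewrite addrA -scalerDr addrA subrK.
have s3 : sqint mu ((s - t)^-1 *: (l s - L (Q t + (s - t) *: D))) by exact: sqintZ.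
have s4 : sqint mu ((s - t)^-1 *: (L (Q t + (s - t) *: D) - l t) - V).
  by apply: sqintB => //; exact: sqintZ.
apply: le_trans (l2nD s3 s4) _; rewrite [leRHS]splitr; apply: lerD; last exact: Hd2.
rewrite (l2nZ _ s1) normfV ler_pdivrMl ?normr_gt0//.
apply: le_trans (HCl _ _ HQs Hgt) _.
have -> : Q s - (Q t + (s - t) *: D) = (s - t) *: q.
  by rewrite /q scalerBr [_ *: (_ *: (Q s - Q t))]scalerA divff// scale1r opprD addrA.
apply: le_trans (ler_wpM2l Cl0 (h2nZ oOmega bOmega muD _ Hq)) _.
rewrite -/N; have -> : Cl * (N * (`|s - t| * h2n q)) = `|s - t| * (Cl * N * h2n q) by ring.
rewrite ler_wpM2l//.
apply: le_trans (ler_wpM2l _ hq) _; first by rewrite mulr_ge0.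
rewrite mulrCA ler_piMr ?(ltW e20)// ler_pdivrMr// mul1r /K mulrC lerDl; exact: ler01.
Qed.

Definition energy (s : R) : R := dot (B (l s)) (l s).

Definition rate (s : R) : R := l2n (B (l s)) ^+ 2.

Lemma flow_lipschitz t : 0 <= t -> exists K d : R, [/\ 0 <= K, 0 < d &
  forall s, 0 <= s -> `|s - t| < d -> l2n (l s - l t) <= K * `|s - t|].
Proof.
move=> t0; have [V [sV _ HV]] := flow_quotient t0.
have [d d0 Hd] := HV 1 ltr01.
exists (l2n V + 1), d; split=> [||s s0 sd]; [by rewrite addr_ge0// l2n_ge0|by []|].
have [->|st] := eqVneq s t; first by rewrite !subrr l2n0 normr0 mulr0.
have s1 : sqint mu (l s - l t) by apply: sqintB; exact: sl.
have dn : 0 < `|s - t| by rewrite normr_gt0 subr_eq0.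
have s2 : sqint mu ((s - t)^-1 *: (l s - l t)) by exact: sqintZ.
have := le_trans (l2n_triB s2 sV) (Hd s s0 st sd).
move=> /(le_trans (ler_norm _)); rewrite lerBlDl l2nZ// normfV.
by rewrite ler_pdivrMl// mulrC.
Qed.

(** By symmetry, the increment of the energy is twice [dot (B (l t)) (l s - l t)] up
  to the form of [B] at [l s - l t], which is of order [(s - t) ^+ 2]. *)
Lemma energy_quotient t : 0 <= t -> exists2 k, k <= - (2 * alpha * gamma * rate t) &
  quot_cvg energy t k.
Proof.
move=> t0; have [V [sV mV HV]] := flow_quotient t0.
have [K [d1 [K0 d10 Hd1]]] := flow_lipschitz t0.
have slt := sl t0; have [sB _] := Bsq slt.
exists (2 * dot (B (l t)) V).
  apply: le_trans (ler_wpM2l (ler0n _ 2) mV) _.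
  by rewrite /rate le_eqVlt; apply/orP; left; apply/eqP; ring.
move=> e e0.
pose b := l2n (B (l t)); have b0 : 0 <= b by exact: l2n_ge0.
have M1 : 0 < 4 * (b + 1) by rewrite mulr_gt0// ltr_wpDl.
have M2 : 0 < 2 * (Cb * K ^+ 2 + 1).
  by rewrite mulr_gt0// ltr_wpDl// mulr_ge0// exprn_ge0.
have [d2 d20 Hd2] := HV _ (divr_gt0 e0 M1).
exists (Num.min d1 (Num.min d2 (e / (2 * (Cb * K ^+ 2 + 1))))).
  by rewrite !lt_min d10 d20 divr_gt0.
move=> s s0 st; rewrite !lt_min => /and3P[sd1 sd2 sd3].
have sls := sl s0; pose z := l s - l t; have sz : sqint mu z by exact: sqintB.
have dn : s - t != 0 by rewrite subr_eq0.
have dp : 0 < `|s - t| by rewrite normr_gt0.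
pose q := (s - t)^-1 *: z; have sq : sqint mu q by exact: sqintZ.
have [sBz lBz] := Bsq sz.
have E : (s - t)^-1 * (energy s - energy t) - 2 * dot (B (l t)) V =
    2 * dot (B (l t)) (q - V) + (s - t)^-1 * dot (B z) z.
  rewrite (ldotB sB sq sV) ldotZ//.
  have -> : energy s = energy t + 2 * dot (B (l t)) z + dot (B z) z.
    have Bz : B z = B (l s) - B (l t) by exact: BB.
    have [sBs _] := Bsq sls.
    rewrite Bz (ldotBl sBs sB sz) /z !(ldotB _ sls slt)// /energy (Bsym sls slt).
    by move: (dot _ _) (dot _ _) (dot _ _) => p r w; ring.
  by move: (dot (B z) z) (dot _ z) (dot _ V) (energy t) (s - t)^-1 => p r w v i; ring.
rewrite E; apply: le_trans (ler_normD _ _) _; rewrite [leRHS]splitr; apply: lerD.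
  rewrite normrM (ger0_norm (ler0n _ 2)).
  apply: le_trans (ler_wpM2l (ler0n _ 2) (ldot_le sB (sqintB sq sV))) _.
  rewrite -/b; have h := Hd2 s s0 st sd2.
  have : b * l2n (q - V) <= (b + 1) * (e / (4 * (b + 1))).
    by apply: ler_pM; rewrite ?l2n_ge0 ?lerDl.
  have -> : (b + 1) * (e / (4 * (b + 1))) = e / 4 by field; rewrite gt_eqF// ltr_wpDl.
  lra.
rewrite normrM normfV ler_pdivrMl//.
apply: le_trans (ldot_le sBz sz) _.
have lz := Hd1 s s0 sd1.
apply: (@le_trans _ _ (Cb * (K * `|s - t|) * (K * `|s - t|))).
  apply: ler_pM; rewrite ?l2n_ge0//; apply: le_trans lBz _; exact: ler_wpM2l.
have -> : Cb * (K * `|s - t|) * (K * `|s - t|) = `|s - t| * (Cb * K ^+ 2 * `|s - t|) by ring.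
rewrite ler_wpM2l//.
have CK : 0 <= Cb * K ^+ 2 by rewrite mulr_ge0// exprn_ge0.
apply: le_trans (ler_wpM2l CK (ltW sd3)) _.
rewrite mulrCA; have -> : e / 2 = e * 2^-1 by [].
rewrite ler_wpM2l ?(ltW e0)// invfM mulrCA ler_piMr// ler_pdivrMr ?mul1r ?lerDl//.
by rewrite ltr_wpDl.
Qed.

Lemma rate_cont0 : cont0 rate.
Proof.
move=> t t0 e e0; have [K [d1 [K0 d10 Hd1]]] := flow_lipschitz t0.
have slt := sl t0; have [sBt _] := Bsq slt.
pose b := l2n (B (l t)); have b0 : 0 <= b by exact: l2n_ge0.
pose M := Cb * K + 1; have M0 : 0 < M by rewrite ltr_wpDl// mulr_ge0.
have P0 : 0 < M * (2 * b + 1) by rewrite mulr_gt0// ltr_wpDl// mulr_ge0.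
exists (Num.min d1 (Num.min (M^-1) (e / (M * (2 * b + 1))))).
  by rewrite !lt_min d10 invr_gt0 M0 divr_gt0.
move=> s s0; rewrite !lt_min => /and3P[sd1 sd2 sd3].
have sls := sl s0; have [sBs _] := Bsq sls.
have sz : sqint mu (l s - l t) by exact: sqintB.
pose y := l2n (B (l s)) - b.
have y1 : `|y| <= M * `|s - t|.
  apply: le_trans (l2n_triB sBs sBt) _; rewrite -BB//.
  apply: le_trans (Bsq sz).2 _; apply: le_trans (ler_wpM2l Cb0 (Hd1 s s0 sd1)) _.
  by rewrite mulrA ler_wpM2r// lerDl.
have y2 : `|y| <= 1.
  by apply: le_trans y1 _; rewrite -ler_pdivlMl// mulr1 ltW.
have -> : rate s - rate t = y * (y + 2 * b).
  by rewrite /rate /y /b; move: (l2n (B (l s))) (l2n (B (l t))) => p q; ring.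
rewrite normrM; apply: (@le_trans _ _ (M * `|s - t| * (2 * b + 1))).
  apply: ler_pM => //; apply: le_trans (ler_normD _ _) _.
  by rewrite addrC lerD// ger0_norm// mulr_ge0.
by rewrite mulrAC -ler_pdivlMl// mulrC ltW.
Qed.

Theorem flow_dissipation t : 0 <= t ->
  (\int[lebesgue_measure]_(s in `[0%R, t]) (rate s)%:E <= (energy 0 / (2 * alpha * gamma))%:E)%E.
Proof.
move=> t0; apply: dissipation => //.
- by rewrite !mulr_gt0.
- by move=> s s0; apply: Bge0; exact: sl.
- by move=> s s0; exact: sqr_ge0.
- exact: rate_cont0.
- exact: energy_quotient.
Qed.

End flow.

(** * The exceptional set of times *)
Section exceptional_set.
Context (R : realType).
Notation leb := (@lebesgue_measure R).

(** Each superlevel set [S m] of [phi] at level 1 / (m + 1) has finite measure, by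
  Markov's inequality, so that it has a tail of measure at most 2^-(m + 1); the
  union of these tails has measure at most 1. Off this union, late times are
  outside of [S m], whatever [m]. *)
Lemma exceptional_set (phi : R -> R) (K : R) :
  (forall s, 0 <= s -> 0 <= phi s) -> cont0 phi ->
  (forall t, 0 <= t -> (\int[leb]_(s in `[0%R, t]) (phi s)%:E <= K%:E)%E) ->
  exists A : set R, [/\ A `<=` [set s | 0 <= s], measurable A, (leb A < +oo)%E &
    forall t_ : R^nat, (forall k, 0 <= t_ k /\ ~ A (t_ k)) -> t_ @ \oo --> +oo ->
      forall e : R, 0 < e -> \forall k \near \oo, phi (t_ k) <= e].
Proof.
move=> phi0 cphi HK.
have mphi : measurable_fun setT (clamp phi).
  by apply: continuous_measurable_fun; exact: clamp_continuous.
pose S m : set R := [set s | 0 <= s] `&` [set s | m.+1%:R^-1 < clamp phi s].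
have mge (a : R) : measurable [set s : R | a <= s].
  by rewrite (_ : [set s | _] = `[a, +oo[%classic) //; apply/seteqP; split=> s /=; rewrite in_itv/= andbT.
have mS m : measurable (S m).
  apply: measurableI => //; rewrite -[X in measurable X]setTI.
  rewrite (_ : _ `&` _ = setT `&` clamp phi @^-1` `]m.+1%:R^-1, +oo[).
    exact: mphi.
  by apply/seteqP; split=> s /= [_]; rewrite in_itv/= andbT.
have K0 : 0 <= K.
  rewrite -lee_fin; apply: le_trans (HK 0 (lexx _)); apply: integral_ge0 => s.
  by rewrite /= in_itv/= => /andP[s0 _]; rewrite lee_fin phi0.
have bS m t : 0 <= t -> (leb (S m `&` `[0%R, t]) <= (m.+1%:R * K)%:E)%E.
  move=> t0; have m0 : 0 < m.+1%:R^-1 :> R by rewrite invr_gt0.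
  have mI : measurable (S m `&` `[0%R, t]) by exact: measurableI.
  have ge0 s : s \in `[0%R, t]%R -> (0 <= (clamp phi s)%:E)%E.
    by rewrite in_itv/= => /andP[s0 _]; rewrite lee_fin clamp_ge0// phi0.
  have h : (m.+1%:R^-1%:E * leb (S m `&` `[0%R, t]) <= K%:E)%E.
    rewrite -integral_cst//; apply: le_trans (HK t t0).
    rewrite (_ : (\int[leb]_(s in `[0%R, t]) (phi s)%:E = \int[leb]_(s in `[0%R, t]) (clamp phi s)%:E)%E); last first.
      by apply: eq_integral => s; rewrite inE/= in_itv/= => /andP[s0 _]; rewrite clamp_ge0.
    have mE D : measurable_fun D (EFin \o clamp phi).
      by apply/measurable_EFinP; exact: measurable_funTS.
    apply: (@le_trans _ _ (\int[leb]_(s in S m `&` `[0%R, t]) (clamp phi s)%:E)%E).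
      apply: ge0_le_integral => //.
      - by move=> s _; rewrite lee_fin ltW.
      - exact: mE.
      - by move=> s [[_ h] _]; rewrite lee_fin ltW.
    apply: ge0_subset_integral => //; exact: mE.
  rewrite EFinM -lee_pdivrMl// ; exact: h.
have fS m : (leb (S m) < +oo)%E.
  pose F k := S m `&` `[0%R, k%:R].
  have -> : S m = \bigcup_k F k.
    apply/seteqP; split=> [s Ss|s [k _ []//]].
    have [s0 _] := Ss; exists (Num.truncn s).+1 => //; split=> //=.
    by rewrite in_itv/= s0 ltW// truncnS_gt.
  apply: (@le_lt_trans _ _ (m.+1%:R * K)%:E); last exact: ltry.
  have mF k : measurable (F k) by exact: measurableI.
  have cv : leb (F k) @[k --> \oo] --> leb (\bigcup_k F k).
    apply: nondecreasing_cvg_mu => //.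
      by apply: (@bigcup_measurable _ (measurableTypeR R)) => k _; exact: mF.
    move=> i j ij; apply/subsetPset => s [Ss]; rewrite /= !in_itv/= => /andP[s0 si]; split=> //=.
    by rewrite in_itv/= s0 (le_trans si)// ler_nat.
  rewrite -(cvg_lim _ cv)//; apply: lime_le; first by apply/cvg_ex; eexists; exact: cv.
  by apply: nearW => k; exact: bS.
pose tail (N : nat) := [set s : R | N%:R <= s].
have small m : exists N : nat, (leb (S m `&` tail N) <= (2^-1 ^+ m.+1)%:E)%E.
  pose F N := S m `&` tail N.
  have mF N : measurable (F N) by apply: measurableI; [exact: mS|exact: mge].
  have F0 : \bigcap_N F N = set0.
    apply/seteqP; split=> // s Fs; have [_ /=] := Fs (Num.truncn s).+1 Logic.I.
    by rewrite /tail /= leNgt truncnS_gt.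
  have cv : leb (F N) @[N --> \oo] --> leb (\bigcap_N F N).
    apply: nonincreasing_cvg_mu => //.
    - apply: le_lt_trans (fS m); apply: le_measure; rewrite ?inE; [exact: mF|exact: mS|].
      exact: subIsetl.
    - by rewrite F0; exact: (@measurable0 _ (measurableTypeR R)).
    - move=> i j ij; apply/subsetPset => s [Ss js]; split=> //.
      by move: js; rewrite /tail /=; apply: le_trans; rewrite ler_nat.
  rewrite F0 measure0 in cv.
  have e0 : 0 < 2^-1 ^+ m.+1 :> R by rewrite exprn_gt0.
  have [N _ HN] := cvg0_near cv e0.
  by exists N; apply: ltW; apply: HN => /=.
have [N HN] := choice small.
pose A := \bigcup_m (S m `&` tail (N m)).
have mA m : measurable (S m `&` tail (N m)).
  by apply: measurableI; [exact: mS|exact: mge].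
exists A; split.
- by move=> s [m _ [[]]].
- exact: bigcup_measurable.
- apply: (@le_lt_trans _ _ 1%:E); last exact: ltry.
  have sub : (leb A <= \sum_(0 <= m <oo) leb (S m `&` tail (N m)))%E.
    apply: measure_sigma_subadditive => //.
    by apply: (@bigcup_measurable _ (measurableTypeR R)) => m _; exact: mA.
  apply: le_trans sub _.
  apply: (@le_trans _ _ (\sum_(0 <= m <oo) (2^-1 ^+ m.+1)%:E)%E).
    by apply: lee_nneseries => [m _ _|m _]; [exact: measure_ge0|exact: HN].
  apply: lime_le; first by apply: is_cvg_nneseries => m _ _; rewrite lee_fin exprn_ge0.
  apply: nearW => k; rewrite sumEFin lee_fin.
  have -> : \sum_(0 <= m < k) 2^-1 ^+ m.+1 = 1 - 2^-1 ^+ k :> R.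
    elim: k => [|k IH]; first by rewrite big_nil expr0 subrr.
    by rewrite big_nat_recr//= IH exprS; move: (2^-1 ^+ k) => q; field.
  by rewrite gerBl exprn_ge0.
move=> t_ Ht ct e e0.
have [m me] : exists m : nat, m.+1%:R^-1 <= e.
  exists (Num.truncn e^-1); rewrite -[leRHS]invrK lef_pV2 ?posrE ?invr_gt0//.
  exact/ltW/truncnS_gt.
have far : \forall k \near \oo, (N m)%:R <= t_ k.
  by move/cvgryPge : ct; apply.
apply: filterS far => k Nk.
have [t0 nA] := Ht k; rewrite leNgt; apply/negP => ek; apply: nA.
exists m => //; split=> //; split=> //=.
by rewrite clamp_ge0//; exact: le_lt_trans me ek.
Qed.

End exceptional_set.

Theorem theorem47 (R : realType) (n : nat) (n_gt0 : (0 < n)%N)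
  (Omega : set 'rV[R]_n) (kappa : R) (kappa01 : 0 < kappa < 1)
  (Omega_open : open Omega) (Omega_bounded : bounded_set Omega)
  (Omega_boundary : C3_boundary kappa Omega)
  (mu : {measure set 'rV[R]_n -> \bar R}) (mu_density : good_density Omega mu)
  (eta : 'rV[R]_n -> R) (eta_C3b : Ckb 3 eta)
  (eta_in : forall x, Omega x -> 0 < eta x < 1)
  (eta_bdry : forall x, bdry Omega x -> eta x = 0)
  (eta_normal : forall x nu, bdry Omega x ->
     outward_normal kappa Omega x nu -> dotv (grad eta x) nu <> 0)
  (L : ('rV[R]_n -> R) -> ('rV[R]_n -> R))
  (L_lipschitz : lipschitz_operator Omega mu L)
  (L_monotone : strongly_monotone Omega mu L)
  (f : 'rV[R]_n -> R) (f_H2 : Hp Omega mu 2 f)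
  (pde_wellposed : exists u, pde_solution Omega mu L f u /\
     forall u', pde_solution Omega mu L f u' -> u' = u %[ae mu])
  (sigma : R -> R) (sigma_C4b : Ckb1 4 sigma)
  (sigma_nonconstant : ~ exists a, forall x, sigma x = a)
  (d : measure_display) (T : measurableType d) (P : probability T R)
  (c : {RV P >-> R}) (w : {RV P >-> 'rV[R]_n}) (b : {RV P >-> R})
  (cwb_independent : independent3 c w b)
  (K0 : R) (c_bounded : {ae P, forall t, `|c t| < K0})
  (c_centered : ('E_P[c] = 0)%E)
  (wb_support : full_support w b)
  (w_moment : forall k : 'I_n, ('E_P[(fun t => `|w t 0 k| ^+ 3)%R] < +oo)%E)
  (b_moment : ('E_P[(fun t => `|b t|)%R] < +oo)%E)
  (alpha : R) (alpha_gt0 : 0 < alpha) (Q : R -> 'rV[R]_n -> R) :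
  let B := kernel_op Omega mu (ntk_eta c w b sigma eta) in
  wide_limit Omega mu alpha B L f Q ->
  gateaux_differentiable Omega mu L ->
  (exists2 K : R, 0 < K & forall t : R, 0 <= t ->
     (\int[lebesgue_measure]_(s in `[0%R, t]) (L2norm mu (B (L (Q s))) ^+ 2)
        <= K%:E)%E) /\
  (exists A : set R,
     [/\ A `<=` [set s | 0 <= s], measurable A, (lebesgue_measure A < +oo)%E &
       forall t_ : R^nat, (forall k, 0 <= t_ k /\ ~ A (t_ k)) ->
         t_ @ \oo --> +oo ->
         L2norm mu (B (L (Q (t_ k)))) @[k --> \oo] --> 0%E]).
Proof.
move=> B [_ HQ] HG.
have [gamma gamma0 HM] := monotone_real Omega_open mu_density L_lipschitz L_monotone.
have [Cb Cb0 Bsq] := kernel_sqint Omega_open Omega_bounded mu_density eta_C3b sigma_C4b w b c_bounded.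
have BB := kernel_opB Omega_open Omega_bounded mu_density eta_C3b sigma_C4b w b c_bounded.
have Bsym := kernel_sym Omega_open Omega_bounded mu_density eta_C3b sigma_C4b w b c_bounded.
have Bge0 := kernel_ge0 Omega_open Omega_bounded mu_density eta_C3b sigma_C4b w b c_bounded.
have Bstrip := kernel_strip Omega_open Omega_bounded mu_density eta_C3b eta_bdry sigma_C4b w b c_bounded.
have diss := flow_dissipation Omega_open Omega_bounded mu_density L_lipschitz gamma0 HM HG
  Cb0 Bsq BB Bsym Bge0 Bstrip alpha_gt0 HQ.
have crate := rate_cont0 Omega_open Omega_bounded mu_density L_lipschitz gamma0 HM HG
  Cb0 Bsq BB Bstrip alpha_gt0 HQ.
rewrite -/B in diss crate Bsq.
have sBL s : 0 <= s -> sqint mu (B (L (Q s))).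
  by move=> s0; have [HQs _] := HQ s s0; apply: (Bsq _ (sqint_op L_lipschitz HQs)).1.
have normE s : 0 <= s -> (L2norm mu (B (L (Q s))) = (l2n mu (B (L (Q s))))%:E)%E.
  by move=> s0; rewrite /L2norm Lnorm_l2n//; exact: sBL.
split.
  set E0 := energy _ _ _ _ _ / _ in diss.
  exists (`|E0| + 1) => [|t t0]; first by rewrite ltr_wpDl.
  apply: (@le_trans _ _ E0%:E); last first.
    by rewrite lee_fin (le_trans (ler_norm _))// lerDl.
  apply: le_trans (diss t t0); rewrite le_eqVlt; apply/orP; left; apply/eqP.
  apply: eq_integral => s; rewrite inE/= in_itv/= => /andP[s0 _].
  by rewrite normE// -EFin_expe.
have [A [A0 mA fA HA]] := exceptional_set (fun s _ => sqr_ge0 _) crate diss.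
exists A; split=> // t_ Ht ct.
rewrite (_ : (fun k => L2norm mu (B (L (Q (t_ k))))) = EFin \o (fun k => l2n mu (B (L (Q (t_ k)))))); last first.
  by apply/funext => k /=; rewrite normE//; case: (Ht k).
apply: cvg_EFin; first exact: nearW.
apply/cvgrPdist_le => e e0; have := HA t_ Ht ct _ (exprn_gt0 2 e0).
apply: filterS => k; rewrite /rate sub0r normrN ger0_norm ?l2n_ge0//.
by rewrite ler_pXn2r ?nnegrE ?l2n_ge0// ltW.
Qed.
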